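(* Let $n\in\mathbb{N}$ and let $Z$ be $\mathbb{Z}$ or a finite field. Let $\Gamma_1$ be an infinite amenable group of type $\mathrm{FP}_{n+1}$ and let $\Gamma_2$ be a group of type $\mathrm{FP}_{n+1}$. For $i\in\{1,2\}$, let $\alpha_i\colon\Gamma_i\curvearrowright(X_i,\mu_i)$ be a standard action. Denote by $\alpha_1\times\alpha_2\colon\Gamma_1\times\Gamma_2\curvearrowright(X_1\times X_2,\mu_1\otimes\mu_2)$ the product action. Then $$\mathrm{medim}^Z_r(\alpha_1\times\alpha_2)=0\quad\text{for all }r\in\{0,\dots,n+1\},$$ $$\mathrm{mevol}_r(\alpha_1\times\alpha_2)=0\quad\text{for all }r\in\{0,\dots,n\}.$$
   Context: $\mathbb{N}$ contains $0$. $Z$ denotes $\mathbb{Z}$ with the usual absolute value or a finite field with the trivial norm ($|0|=0$, $|x|=1$ for $x\neq 0$). A group $\Gamma$ is of type $\mathrm{FP}_m$ if the trivial $\mathbb{Z}\Gamma$-module $\mathbb{Z}$ has a projective resolution that is finitely generated in degrees $\le m$. Standard actions. A standard $\Gamma$-action $\alpha\colon\Gamma\curvearrowright(X,\mu)$ is an essentially free, probability measure preserving action of a countable group on a standard Borel probability space. $L^\infty(\alpha,Z)=L^\infty(X,\mu,Z)$ is the ring of essentially bounded measurable functions $X\to Z$ modulo a.e. equality, with $(\gamma\cdot\lambda)(x)=\lambda(\gamma^{-1}x)$. The crossed product ring $R=L^\infty(\alpha,Z)*\Gamma$ is the free $L^\infty(\alpha,Z)$-module with basis $\Gamma$ (elements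 are finite sums of terms $(\lambda,\gamma)$) with multiplication $(\lambda,\gamma)(\lambda',\gamma')=(\lambda\cdot(\gamma\cdot\lambda'),\gamma\gamma')$. It contains $Z\Gamma$ via $\gamma\mapsto(1,\gamma)$ and acts on $L^\infty(\alpha,Z)$ by $(\lambda,\gamma)\cdot f=\lambda\cdot(\gamma\cdot f)$. Marked modules. For measurable $A\subset X$ put $\langle A\rangle=R\cdot(\chi_A,1)$. A marked projective $R$-module is an $R$-module $M$ with a finite family $(A_i)_{i\in I}$ of measurable subsets of $X$ and an isomorphism $M\cong\bigoplus_{i\in I}\langle A_i\rangle$ (suppressed from notation); $\dim_R(M)=\sum_i\mu(A_i)$. On $R$ let $|\sum_\gamma(\lambda_\gamma,\gamma)|_1=\sum_\gamma\int_X|\lambda_\gamma|\,d\mu$; elements of $M\subset\bigoplus_I R$ have norm $\|\sum_i\lambda_ie_i\|_1=\sum_i|\lambda_i|_1$. For an $R$-homomorphism $f\colon M\to N$ of marked projective modules, $\|f\|$ is the least $c$ with $\|f(z)\|_1\le c\|z\|_1$ for all $z$ (always finite). A marked direct summand of $\bigoplus_j\langle B_j\rangle$ is a submodule $\bigoplus_j\langle B_j'\rangle$ with $B_j'\subset B_j$ measurable. A finite marked decomposition of $M=\bigoplus_i\langle A_i\rangle$ is a finite family $(M_k)_k$ with $M_k=\bigoplus_i\langle A_{i,k}\rangle$ for measurable partitions $A_i=\bigsqcup_kA_{i,k}$. Logarithmic norm. $\log_+(t)=\max\{\log t,0\}$ (and $\log_+0=0$). $\mathrm{rk}(f)=\inf\{\dim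 N'\mid N'\subset N\text{ marked direct summand with }f(M)\subset N'\}$; $\mathrm{lognorm}'(f)=\min\{\dim(M)\log_+\|f\|,\ \mathrm{rk}(f)\log_+\|f\|\}$; $\mathrm{lognorm}(f)=\inf\sum_k\mathrm{lognorm}'(f|_{M_k}\colon M_k\to N)$, the infimum over all finite marked decompositions $(M_k)_k$ of $M$. Measured embeddings. A marked projective augmented $R$-chain complex $D_*\twoheadrightarrow L^\infty(\alpha,Z)$ is a chain complex $(D_k)_{k\ge0}$ of marked projective $R$-modules with a surjective $R$-homomorphism $\eta\colon D_0\to L^\infty(\alpha,Z)$, $\eta\circ\partial_1=0$. Fix a free $Z\Gamma$-resolution $C_*\twoheadrightarrow Z$ (the following is independent of the choice). An $\alpha$-embedding (up to degree $r$) is such a complex together with a $Z\Gamma$-chain map $C_*\to D_*$ up to degree $r+1$ extending the inclusion $Z\to L^\infty(\alpha,Z)$ as constant functions. $A_r(\alpha)$ is the class of all augmented complexes $D_*$ arising in this way. For $\Gamma$ of type $\mathrm{FP}_{n+1}$ and $r\le n$: $\mathrm{medim}^Z_r(\alpha)=\inf_{D_*\in A_r(\alpha)}\dim_R(D_r)$, and (for $Z=\mathbb{Z}$) $\mathrm{mevol}_r(\alpha)=\inf_{D_*\in A_r(\alpha)}\mathrm{lognorm}(\partial^D_{r+1})$. In the boundary degree, $\mathrm{medim}^Z_{n+1}(\alpha)=\inf_{D_*\in A_n(\alpha)}\dim_R(D_{n+1})$. *)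

(* Defs.v *)
From HB Require Import structures.
From mathcomp Require Import all_boot all_order all_algebra finmap.
From mathcomp Require Import all_classical all_reals all_analysis.
From mathcomp Require monalg.
Import (canonicals, coercions) monalg.

Set Implicit Arguments.
Unset Strict Implicit.
Unset Printing Implicit Defensive.

Import Order.TTheory GRing.Theory Num.Theory.

Local Open Scope classical_set_scope.
Local Open Scope ring_scope.
Local Open Scope quotient_scope.

Notation malg := monalg.malg (only parsing).
Notation "x @_ g" := (monalg.mcoeff g x)
  (at level 3, g at level 2, left associativity, format "x @_ g") : ring_scope.
Notation "<< a *g g >>" := (monalg.mkmalgU g a)
  (format "<< a  *g  g >>") : ring_scope.
Notation msupp := monalg.msupp (only parsing).

(* [G] acts on the ring [A] by automorphisms; bijectivity is implied *)
Record ring_action (G : groupType) (A : comNzRingType) := RingAction {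
  ract :> G -> {rmorphism A -> A};
  ract1 : forall a, ract 1%g a = a;
  ractM : forall g h a, ract (g * h)%g a = ract g (ract h a) }.

Definition trivial_action (G : groupType) (A : comNzRingType) :
    ring_action G A :=
  @RingAction G A (fun=> idfun) (fun=> erefl) (fun _ _ _ => erefl).

(* The ring with left [A]-basis [G] and (a, g)(b, h) = (a * g.b, gh), and its
   module [A] with (a, g).b = a * g.b; [monalg.malg G A] is the additive group
   of finitely supported families [G -> A]. Both are aliases that record the
   action [t], on which the product and the scaling depend. *)
Definition skew_ring (G : groupType) (A : comNzRingType)
  (t : ring_action G A) : Type := malg G A.

Definition skew_mod (G : groupType) (A : comNzRingType)
  (t : ring_action G A) : Type := A.

Section SkewGroupRing.
Context {G : groupType} {A : comNzRingType} (t : ring_action G A).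
Local Notation skew_ring := (skew_ring t).
Local Notation skew_mod := (skew_mod t).

HB.instance Definition _ := GRing.Zmodule.on skew_ring.

Implicit Types (x y z : skew_ring) (a b : A) (g h : G).

Definition skew_one : skew_ring := << 1 *g 1%g >>.

Definition skew_mul x y : skew_ring :=
  \sum_(g <- msupp x) \sum_(h <- msupp y)
    << x@_g * t g (y@_h) *g (g * h)%g >>.

Lemma skew_mulw (D E : {fset G}) x y :
  (msupp x `<=` D)%fset -> (msupp y `<=` E)%fset ->
  skew_mul x y = \sum_(g <- D) \sum_(h <- E)
    << x@_g * t g (y@_h) *g (g * h)%g >>.
Proof.
move=> xD yE; rewrite /skew_mul (big_fset_incl _ xD) /=.
  apply/eq_bigr => g _; apply/big_fset_incl => // h _ /monalg.mcoeff_outdom ->.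
  by rewrite rmorph0 mulr0 monalg.monalgU0.
move=> g _ /monalg.mcoeff_outdom xg.
by rewrite big1 // => h _; rewrite xg mul0r monalg.monalgU0.
Qed.

Lemma skew_mulUU a b g h :
  skew_mul << a *g g >> << b *g h >> = << a * t g b *g (g * h)%g >>.
Proof.
by rewrite (skew_mulw monalg.msuppU_le monalg.msuppU_le) !big_seq_fset1
  !monalg.mcoeffUU.
Qed.

Lemma skew_mulDl : left_distributive skew_mul +%R.
Proof.
move=> x y z.
have s := fsubset_refl (msupp z).
rewrite [in RHS](skew_mulw (fsubsetUl (msupp x) (msupp y)) s).
rewrite (skew_mulw (fsubsetUr (msupp x) (msupp y)) s).
rewrite (skew_mulw (monalg.msuppD_le _ _) s) -big_split /=.
apply/eq_bigr => g _; rewrite -big_split /=; apply/eq_bigr => h _.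
by rewrite monalg.mcoeffD mulrDl monalg.monalgUD.
Qed.

Lemma skew_mulDr : right_distributive skew_mul +%R.
Proof.
move=> z x y.
have s := fsubset_refl (msupp z).
rewrite [in RHS](skew_mulw s (fsubsetUl (msupp x) (msupp y))).
rewrite (skew_mulw s (fsubsetUr (msupp x) (msupp y))).
rewrite (skew_mulw s (monalg.msuppD_le _ _)) -big_split /=.
apply/eq_bigr => g _; rewrite -big_split /=; apply/eq_bigr => h _.
by rewrite monalg.mcoeffD rmorphD mulrDr monalg.monalgUD.
Qed.

Lemma skew_mul0x : left_zero 0 skew_mul.
Proof. by move=> x; rewrite /skew_mul monalg.msupp0 big_seq_fset0. Qed.

Lemma skew_mulx0 : right_zero 0 skew_mul.
Proof.
by move=> x; rewrite /skew_mul big1 // => g _; rewrite monalg.msupp0 big_seq_fset0.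
Qed.

Lemma skew_mul_suml I (r : seq I) F x :
  skew_mul (\sum_(i <- r) F i) x = \sum_(i <- r) skew_mul (F i) x.
Proof.
exact: (big_morph (skew_mul^~ x) (fun _ _ => skew_mulDl _ _ _) (skew_mul0x _)).
Qed.

Lemma skew_mul_sumr I (r : seq I) F x :
  skew_mul x (\sum_(i <- r) F i) = \sum_(i <- r) skew_mul x (F i).
Proof.
exact: (big_morph (skew_mul x) (fun _ _ => skew_mulDr _ _ _) (skew_mulx0 _)).
Qed.

Lemma skew_mulA : associative skew_mul.
Proof.
move: skew_mul_suml skew_mul_sumr skew_mulUU.
generalize skew_mul => m suml sumr mUU x y z.
rewrite [x]monalg.monalgE [y]monalg.monalgE [z]monalg.monalgE.
rewrite !suml; apply/eq_bigr => g _.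
rewrite !(sumr _ _ _ << x@_g *g g >>) suml; apply/eq_bigr => h _.
rewrite !sumr; apply/eq_bigr => k _.
by rewrite !mUU rmorphM ractM mulrA mulgA.
Qed.

Lemma skew_mul1 : left_id skew_one skew_mul.
Proof.
move: skew_mul_sumr skew_mulUU; rewrite /skew_one.
generalize skew_mul => m sumr mUU x.
rewrite [x in LHS]monalg.monalgE sumr [RHS]monalg.monalgE.
by apply/eq_bigr => g _; rewrite mUU ract1 mul1r mul1g.
Qed.

Lemma skew_mulr1 : right_id skew_one skew_mul.
Proof.
move: skew_mul_suml skew_mulUU; rewrite /skew_one.
generalize skew_mul => m suml mUU x.
rewrite [x in LHS]monalg.monalgE suml [RHS]monalg.monalgE.
by apply/eq_bigr => g _; rewrite mUU rmorph1 mulr1 mulg1.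
Qed.

Lemma skew_one_neq0 : skew_one != 0.
Proof.
apply/eqP => /(congr1 (monalg.mcoeff 1%g)) /eqP.
by rewrite monalg.mcoeffUU monalg.mcoeff0 oner_eq0.
Qed.

HB.instance Definition _ := GRing.Zmodule_isNzRing.Build skew_ring
  skew_mulA skew_mul1 skew_mulr1 skew_mulDl skew_mulDr skew_one_neq0.

Lemma skewUU a b g h :
  (<< a *g g >> : skew_ring) * << b *g h >> = << a * t g b *g (g * h)%g >>.
Proof. exact: skew_mulUU. Qed.

HB.instance Definition _ := GRing.Zmodule.on skew_mod.

Definition skew_scale x (a : skew_mod) : skew_mod :=
  \sum_(g <- msupp x) x@_g * t g a.

Lemma skew_scalew (D : {fset G}) x a : (msupp x `<=` D)%fset ->
  skew_scale x a = \sum_(g <- D) x@_g * t g a.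
Proof.
move=> xD; rewrite /skew_scale (big_fset_incl _ xD) //=.
by move=> g _ /monalg.mcoeff_outdom ->; rewrite mul0r.
Qed.

Lemma skew_scaleDl (a : skew_mod) : {morph skew_scale^~ a : x y / x + y}.
Proof.
move=> x y /=; rewrite (skew_scalew a (fsubsetUl (msupp x) (msupp y))).
rewrite (skew_scalew a (fsubsetUr (msupp x) (msupp y))).
rewrite (skew_scalew a (monalg.msuppD_le _ _)) -big_split /=.
by apply/eq_bigr => g _; rewrite monalg.mcoeffD mulrDl.
Qed.

Lemma skew_scaleDr : right_distributive skew_scale +%R.
Proof.
move=> x a b; rewrite /skew_scale -big_split /=.
by apply/eq_bigr => g _; rewrite rmorphD mulrDr.
Qed.

Lemma skew_scaleU a g (b : skew_mod) : skew_scale << a *g g >> b = a * t g b.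
Proof.
by rewrite (skew_scalew _ monalg.msuppU_le) big_seq_fset1 monalg.mcoeffUU.
Qed.

Lemma skew_scale0x a : skew_scale 0 a = 0.
Proof. by rewrite /skew_scale monalg.msupp0 big_seq_fset0. Qed.

Lemma skew_scalex0 x : skew_scale x 0 = 0.
Proof. by rewrite /skew_scale big1 // => g _; rewrite rmorph0 mulr0. Qed.

Lemma skew_scale_suml I (r : seq I) F (a : skew_mod) :
  skew_scale (\sum_(i <- r) F i) a = \sum_(i <- r) skew_scale (F i) a.
Proof.
exact: (big_morph (skew_scale^~ a) (skew_scaleDl a) (skew_scale0x a)).
Qed.

Lemma skew_scaleA x y (a : skew_mod) :
  skew_scale x (skew_scale y a) = skew_scale (x * y) a.
Proof.
rewrite [x]monalg.monalgE [y]monalg.monalgE mulr_suml !skew_scale_suml.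
apply/eq_bigr => g _; rewrite mulr_sumr skew_scale_suml skew_scaleU.
rewrite raddf_sum mulr_sumr; apply/eq_bigr => h _.
by rewrite skewUU !skew_scaleU /= rmorphM ractM mulrA.
Qed.

Lemma skew_scale1 : left_id 1 skew_scale.
Proof. by move=> a; rewrite skew_scaleU ract1 mul1r. Qed.

HB.instance Definition _ := GRing.Zmodule_isLmodule.Build skew_ring skew_mod
  skew_scaleA skew_scale1 skew_scaleDr skew_scaleDl.

End SkewGroupRing.

Section SkewMap.
Context {G : groupType} {A B : comNzRingType}.
Context {t : ring_action G A} {u : ring_action G B}.
Context (f : {rmorphism A -> B}) (fE : forall g a, f (t g a) = u g (f a)).

Definition skew_map of (forall g a, f (t g a) = u g (f a)) :=
  fun x : skew_ring t => \sum_(g <- msupp x) << f x@_g *g g >> : skew_ring u.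

Local Notation F := (skew_map fE).

Lemma skew_mapw (D : {fset G}) x : (msupp x `<=` D)%fset ->
  F x = \sum_(g <- D) << f x@_g *g g >>.
Proof.
move=> xD; rewrite /skew_map (big_fset_incl _ xD) //=.
by move=> g _ /monalg.mcoeff_outdom ->; rewrite rmorph0 monalg.monalgU0.
Qed.

Lemma skew_mapD : {morph F : x y / x + y}.
Proof.
move=> x y /=; rewrite (skew_mapw (fsubsetUl (msupp x) (msupp y))).
rewrite (skew_mapw (fsubsetUr (msupp x) (msupp y))).
rewrite (skew_mapw (monalg.msuppD_le _ _)) -big_split /=.
by apply/eq_bigr => g _; rewrite monalg.mcoeffD rmorphD monalg.monalgUD.
Qed.

Lemma skew_map0 : F 0 = 0.
Proof. by rewrite /skew_map monalg.msupp0 big_seq_fset0. Qed.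

Lemma skew_map_zmod : zmod_morphism F.
Proof.
move=> x y; apply/eqP; rewrite eq_sym subr_eq -skew_mapD subrK; exact/eqP.
Qed.

HB.instance Definition _ := GRing.isZmodMorphism.Build _ _ F skew_map_zmod.

Lemma skew_mapU a g : F << a *g g >> = << f a *g g >>.
Proof.
by rewrite (skew_mapw monalg.msuppU_le) big_seq_fset1 monalg.mcoeffUU.
Qed.

Lemma skew_map_monoid : monoid_morphism F.
Proof.
split=> [|x y]; first by rewrite skew_mapU rmorph1.
rewrite [x]monalg.monalgE [y]monalg.monalgE mulr_suml !raddf_sum mulr_suml.
apply/eq_bigr => g _; rewrite !mulr_sumr raddf_sum; apply/eq_bigr => h _.
by rewrite skewUU /= !skew_mapU skewUU rmorphM fE.
Qed.

HB.instance Definition _ := GRing.isMonoidMorphism.Build _ _ F skew_map_monoid.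

End SkewMap.

(* the coefficients Z: the integers or a finite field *)
Variant coef := CoefInt | CoefFin of finFieldType.

Definition coef_ring (Z : coef) : comNzRingType :=
  match Z with CoefInt => int | CoefFin F => F end.

Definition coef_norm (Z : coef) : coef_ring Z -> nat :=
  match Z with
  | CoefInt => fun x : int => `|x|%N
  | CoefFin F => fun x : F => nat_of_bool (x != 0)
  end.

Lemma countable_coef (Z : coef) : countable [set: coef_ring Z].
Proof. by case: Z => [|F]; exact: countableP. Qed.

Lemma coef_norm0 Z : @coef_norm Z 0 = 0%N.
Proof. by case: Z => [|F] //=; rewrite eqxx. Qed.

Lemma coef_normN Z (a : coef_ring Z) : coef_norm (- a) = coef_norm a.
Proof. by case: Z a => [|F] a /=; rewrite ?abszN ?oppr_eq0. Qed.

Lemma coef_normD Z (a b : coef_ring Z) :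
  (coef_norm (a + b)%R <= coef_norm a + coef_norm b)%N.
Proof.
case: Z a b => [|F] a b /=.
  by have := leqD_dist a 0 (- b); rewrite !subr0 !sub0r opprK.
case: (eqVneq a 0) => [->|_]; first by rewrite add0r.
by case: (_ != 0).
Qed.

Lemma coef_normM Z (a b : coef_ring Z) :
  coef_norm (a * b) = (coef_norm a * coef_norm b)%N.
Proof.
case: Z a b => [|F] a b /=; first exact: abszM.
by rewrite mulf_eq0 negb_or mulnb.
Qed.

Section EssentiallyBounded.
Context {R : realType} {d} {X : measurableType d} (mu : probability X R).
Context (Z : coef).
Local Notation ZZ := (coef_ring Z).

(* measurable for the discrete sigma-algebra on Z, and essentially bounded *)
Definition ess_bounded : {pred X -> ZZ} := fun f =>
  `[< (forall B : set ZZ, measurable (f @^-1` B)) /\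
      exists c : nat, {ae mu, forall x, (coef_norm (f x) <= c)%N} >].

Lemma measurable_op2 (op : ZZ -> ZZ -> ZZ) (f g : X -> ZZ) :
  (forall B : set ZZ, measurable (f @^-1` B)) ->
  (forall B : set ZZ, measurable (g @^-1` B)) ->
  forall B : set ZZ, measurable ((fun x => op (f x) (g x)) @^-1` B).
Proof.
move=> mf mg B.
rewrite [X in measurable X](_ : _ = \bigcup_a
    (f @^-1` [set a] `&` g @^-1` [set b | B (op a b)])).
  apply: countable_bigcupT_measurable; first exact: countable_coef.
  by move=> a; apply: measurableI.
apply/seteqP; split => [x /= Bx|x [a _ [/= -> //]]].
by exists (f x).
Qed.

Lemma ess_bounded_subring : subring_closed ess_bounded.
Proof.
split=> [|f g /asboolP[mf [c fc]] /asboolP[mg [e ge]]|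
          f g /asboolP[mf [c fc]] /asboolP[mg [e ge]]]; apply/asboolP.
- split=> [B|].
    by rewrite (_ : 1 = cst 1) // preimage_cst; case: ifP.
  by exists (@coef_norm Z 1); apply: aeW.
- split; first exact: (measurable_op2 (fun a b => a - b)).
  exists (c + e)%N; apply: filterS2 fc ge => x fx gx.
  by rewrite (leq_trans (coef_normD _ _))// coef_normN leq_add.
- split; first exact: (measurable_op2 (fun a b => a * b)).
  exists (c * e)%N; apply: filterS2 fc ge => x fx gx.
  by rewrite coef_normM leq_mul.
Qed.

HB.instance Definition _ := GRing.isSubringClosed.Build _ ess_bounded
  ess_bounded_subring.

Record bfun := BFun { bfun_val :> X -> ZZ; _ : bfun_val \in ess_bounded }.

HB.instance Definition _ := [isSub for bfun_val].
HB.instance Definition _ := [Choice of bfun by <:].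
HB.instance Definition _ := [SubChoice_isSubComNzRing of bfun by <:].

Definition null_fun : {pred bfun} := fun f =>
  `[< {ae mu, forall x, bfun_val f x = 0} >].

Lemma null_fun_ideal : idealr_closed null_fun.
Proof.
split.
- by apply/asboolP; apply: aeW.
- apply/negP => /asboolP n1.
  have : mu.-negligible [set: X].
    apply: negligibleS n1 => x _ /=; apply/eqP; exact: oner_neq0.
  move/(measure_negligible measurableT)/eqP.
  by rewrite [_ setT](probability_setT mu) onee_eq0.
- move=> a f g /asboolP f0 /asboolP g0; apply/asboolP.
  apply: filterS2 f0 g0 => x fx gx.
  rewrite (_ : bfun_val (a * f + g) x = a x * f x + g x) //.
  by rewrite fx gx mulr0 addr0.
Qed.

HB.instance Definition _ := isIdealr.Build bfun null_fun null_fun_ideal.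

Definition Linf : Type := Quotient.quot null_fun.

HB.instance Definition _ := GRing.ComNzRing.on Linf.
HB.instance Definition _ := EqQuotient.on Linf.

Lemma LinfP (f g : bfun) :
  \pi_Linf f = \pi_Linf g <-> {ae mu, forall x, f x = g x}.
Proof.
have e : (\pi_Linf f = \pi_Linf g) <-> (f - g \in null_fun).
  by rewrite Quotient.idealrBE; split => [/eqP|] // /eqP.
apply: (iff_trans e); split=> [/asboolP|fg].
  by apply: filterS => x fg; apply/eqP; rewrite -subr_eq0; apply/eqP.
by apply/asboolP; apply: filterS fg => x fg; rewrite -(subrr (f x)) {2}fg.
Qed.

Lemma bfun_cst_subproof (a : ZZ) : (fun=> a) \in ess_bounded.
Proof.
apply/asboolP; split=> [B|]; last by exists (coef_norm a); apply: aeW.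
by rewrite preimage_cst; case: ifP.
Qed.

Definition bfun_cst a := BFun (bfun_cst_subproof a).

Definition Linf_cst (a : ZZ) : Linf := \pi_Linf (bfun_cst a).

Lemma Linf_cst_zmod : zmod_morphism Linf_cst.
Proof.
by move=> a b; rewrite /Linf_cst -raddfB; congr \pi; apply: val_inj.
Qed.

HB.instance Definition _ := GRing.isZmodMorphism.Build _ _ Linf_cst Linf_cst_zmod.

Lemma Linf_cst_monoid : monoid_morphism Linf_cst.
Proof.
split=> [|a b]; first by rewrite -(rmorph1 \pi_Linf); congr \pi; apply: val_inj.
by rewrite /Linf_cst -rmorphM; congr \pi; apply: val_inj.
Qed.

HB.instance Definition _ := GRing.isMonoidMorphism.Build _ _ Linf_cst
  Linf_cst_monoid.

Lemma bfun_indic_subproof (A : set X) :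
  measurable A -> (\1_A : X -> ZZ) \in ess_bounded.
Proof.
move=> mA; apply/asboolP; split=> [B|].
  rewrite preimage_indic; do 2 case: ifP => // _.
  exact: measurableC.
exists (@coef_norm Z 1); apply: aeW => x; rewrite indicE.
by case: (x \in A) => //=; rewrite coef_norm0.
Qed.

Definition Linf_indic (A : set X) (mA : measurable A) : Linf :=
  \pi_Linf (BFun (bfun_indic_subproof mA)).

Lemma Linf_indicM (B A : set X) (mB : measurable B) (mA : measurable A) :
  B `<=` A -> Linf_indic mB * Linf_indic mA = Linf_indic mB.
Proof.
move=> BA; rewrite /Linf_indic -rmorphM; congr \pi; apply: val_inj.
apply/funext => x; rewrite /= !fctE !indicE.
have [/set_mem Bx|] := boolP (x \in B); last by rewrite mul0r.
by rewrite (mem_set (BA _ Bx)) mulr1.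
Qed.

(* independent of the representative chosen by [repr] *)
Definition Linf_norm1 (l : Linf) : R :=
  (\int[mu]_x (coef_norm (bfun_val (repr l) x))%:R)%R.

End EssentiallyBounded.

Arguments ess_bounded {R d X} mu Z.
Arguments null_fun {R d X} mu Z.
Arguments Linf_cst {R d X} mu Z.

Record pmp_action (R : realType) d (X : measurableType d)
    (mu : probability X R) (G : groupType) := PmpAction {
  pact :> G -> X -> X;
  pact1 : forall x, pact 1%g x = x;
  pactM : forall g h x, pact (g * h)%g x = pact g (pact h x);
  measurable_pact : forall g, measurable_fun setT (pact g);
  pact_preserving : forall g (A : set X),
    measurable A -> mu (pact g @^-1` A) = mu A }.

Section LinfAction.
Context {R : realType} {d} {X : measurableType d} {mu : probability X R}.
Context {G : groupType} (alpha : pmp_action mu G) (Z : coef).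

Lemma ae_pact (g : G) (P : X -> Prop) :
  {ae mu, forall x, P x} -> {ae mu, forall x, P (alpha g x)}.
Proof.
move=> [A [mA A0 sA]]; exists (alpha g @^-1` A); split.
- by rewrite -[X in measurable X]setTI; apply: measurable_pact.
- by rewrite -A0; apply: pact_preserving.
- by move=> x; apply: sA.
Qed.

Lemma bfun_act_subproof (g : G) (f : bfun mu Z) :
  (fun x => f (alpha g^-1%g x)) \in ess_bounded mu Z.
Proof.
case: f => f /= /asboolP[mf [c fc]]; apply/asboolP; split=> [B|].
  rewrite -[X in measurable X]setTI.
  exact: (measurable_pact alpha g^-1%g measurableT (mf B)).
by exists c; exact: (ae_pact (g^-1)%g fc).
Qed.

Definition bfun_act g f : bfun mu Z := BFun (bfun_act_subproof g f).

Definition Linf_act (g : G) (l : Linf mu Z) : Linf mu Z :=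
  \pi_(Linf mu Z) (bfun_act g (repr l)).

Lemma Linf_act_pi g f :
  Linf_act g (\pi_(Linf mu Z) f) = \pi_(Linf mu Z) (bfun_act g f).
Proof.
have /LinfP e : \pi_(Linf mu Z) (repr (\pi_(Linf mu Z) f)) = \pi_(Linf mu Z) f.
  by rewrite reprK.
by apply/LinfP; exact: (ae_pact (g^-1)%g e).
Qed.

Lemma Linf_act_zmod g : zmod_morphism (Linf_act g).
Proof.
move=> l m; rewrite -[l]reprK -[m]reprK -raddfB !Linf_act_pi -raddfB.
by congr \pi; apply: val_inj.
Qed.

HB.instance Definition _ g :=
  GRing.isZmodMorphism.Build _ _ (Linf_act g) (Linf_act_zmod g).

Lemma Linf_act_monoid g : monoid_morphism (Linf_act g).
Proof.
split=> [|l m].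
  rewrite -[1 in LHS](rmorph1 \pi_(Linf mu Z)) Linf_act_pi.
  by rewrite -(rmorph1 \pi_(Linf mu Z)); congr \pi; apply: val_inj.
rewrite -[l]reprK -[m]reprK -rmorphM !Linf_act_pi -rmorphM.
by congr \pi; apply: val_inj.
Qed.

HB.instance Definition _ g :=
  GRing.isMonoidMorphism.Build _ _ (Linf_act g) (Linf_act_monoid g).

Lemma Linf_act1 l : Linf_act 1%g l = l.
Proof.
rewrite -[l]reprK Linf_act_pi; congr \pi; apply: val_inj.
by apply/funext => x /=; rewrite invg1 pact1.
Qed.

Lemma Linf_actM g h l : Linf_act (g * h)%g l = Linf_act g (Linf_act h l).
Proof.
rewrite -[l]reprK; move: (repr l) => f.
rewrite (Linf_act_pi h) !Linf_act_pi; congr \pi; apply: val_inj.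
by apply/funext => x /=; rewrite invgM pactM.
Qed.

Definition Linf_ring_action : ring_action G (Linf mu Z) :=
  RingAction Linf_act1 Linf_actM.

Definition crossed_product := skew_ring Linf_ring_action.

Definition Linf_mod := skew_mod Linf_ring_action.

Lemma Linf_cst_equivariant (g : G) (a : coef_ring Z) :
  Linf_cst mu Z (trivial_action G _ g a) =
  Linf_ring_action g (Linf_cst mu Z a).
Proof. by rewrite /= Linf_act_pi; congr \pi; apply: val_inj. Qed.

End LinfAction.

Definition group_ring (G : groupType) (A : comNzRingType) :=
  skew_ring (trivial_action G A).

Definition trivial_mod (G : groupType) (A : comNzRingType) :=
  skew_mod (trivial_action G A).

Section GroupRingInclusion.
Context {R : realType} {d} {X : measurableType d} {mu : probability X R}.
Context {G : groupType} (alpha : pmp_action mu G) (Z : coef).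

Definition group_ring_incl :
    group_ring G (coef_ring Z) -> crossed_product alpha Z :=
  skew_map (Linf_cst_equivariant alpha (Z := Z)).

HB.instance Definition _ := GRing.RMorphism.copy group_ring_incl
  (skew_map (Linf_cst_equivariant alpha (Z := Z))).

Definition cp_norm1 (x : crossed_product alpha Z) : R :=
  \sum_(g <- msupp x) Linf_norm1 x@_g.

End GroupRingInclusion.

Section MeasurableFamilies.
Context {d} {X : measurableType d}.

Record mfamily (p : nat) := MFamily {
  mfam :> 'I_p -> set X;
  measurable_mfam : forall i, measurable (mfam i) }.

Definition msubfamily p (B A : mfamily p) := forall i, B i `<=` A i.

(* a finite family (A_i) stands for the marked module it indexes, which is the
   submodule [marked_mod] below of the free module of row vectors *)
Record marked := Marked {
  marked_size : nat;
  marked_family :> mfamily marked_size }.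

Record mdecomp p (A : mfamily p) := MDecomp {
  mdecomp_size : nat;
  mdecomp_part :> 'I_mdecomp_size -> mfamily p;
  mdecomp_disj : forall i, trivIset setT (fun k => mdecomp_part k i);
  mdecomp_cover : forall i, \bigcup_k mdecomp_part k i = A i }.

Lemma mdecomp_sub p (A : mfamily p) (D : mdecomp A) k : msubfamily (D k) A.
Proof. by move=> i x Dx; rewrite -(mdecomp_cover D i); exists k. Qed.

End MeasurableFamilies.

Arguments mfamily {d} X p.
Arguments mdecomp_sub {d X p A} D k.
Arguments marked {d} X.

Definition marked_dim (R : realType) d (X : measurableType d)
    (mu : probability X R) p (A : mfamily X p) : R :=
  \sum_i fine (mu (A i)).

Section MarkedModules.
Context {R : realType} {d} {X : measurableType d} {mu : probability X R}.
Context {G : groupType} (alpha : pmp_action mu G) (Z : coef).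
Local Notation CP := (crossed_product alpha Z).

Definition cp_indic (A : set X) (mA : measurable A) : CP :=
  << Linf_indic mu Z mA *g 1%g >>.

Definition marked_pred p (A : mfamily X p) : {pred 'rV[CP]_p} := fun v =>
  `[< forall i, exists x : CP, v 0 i = x * cp_indic (measurable_mfam A i) >].

Lemma marked_predP p (A : mfamily X p) (v : 'rV[CP]_p) :
  reflect (forall i, exists x : CP, v 0 i = x * cp_indic (measurable_mfam A i))
          (v \in marked_pred A).
Proof. exact: asboolP. Qed.

Lemma marked_pred_submod p (A : mfamily X p) : submod_closed (marked_pred A).
Proof.
split=> [|x u v /marked_predP uA /marked_predP vA]; apply/marked_predP => i.
  by exists 0; rewrite mxE mul0r.
have [y uy] := uA i; have [z vz] := vA i.
by exists (x * y + z); rewrite !mxE uy vz mulrDl mulrA.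
Qed.

HB.instance Definition _ p (A : mfamily X p) :=
  GRing.isSubmodClosed.Build _ _ (marked_pred A) (marked_pred_submod A).

Record marked_mod p (A : mfamily X p) := MarkedMod {
  marked_val :> 'rV[CP]_p;
  _ : marked_val \in marked_pred A }.

HB.instance Definition _ p (A : mfamily X p) :=
  [isSub for @marked_val p A].
HB.instance Definition _ p (A : mfamily X p) :=
  [Choice of marked_mod A by <:].
HB.instance Definition _ p (A : mfamily X p) :=
  [SubChoice_isSubLmodule of marked_mod A by <:].

Lemma marked_predS p (B A : mfamily X p) :
  msubfamily B A -> {subset marked_pred B <= marked_pred A}.
Proof.
move=> BA v /marked_predP vB; apply/marked_predP => i.
have [x vx] := vB i; exists (x * cp_indic (measurable_mfam B i)).
rewrite {}vx -mulrA skewUU mulg1 /= Linf_act1; congr (_ * _).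
by rewrite Linf_indicM.

Qed.

Definition marked_incl p (B A : mfamily X p) (BA : msubfamily B A)
    (v : marked_mod B) : marked_mod A :=
  MarkedMod (marked_predS BA (valP v)).

Lemma marked_incl_linear p (B A : mfamily X p) (BA : msubfamily B A) :
  linear (marked_incl BA).
Proof. by move=> x u v; apply: val_inj. Qed.

HB.instance Definition _ p (B A : mfamily X p) (BA : msubfamily B A) :=
  GRing.isLinear.Build _ _ _ _ (marked_incl BA) (marked_incl_linear BA).

Definition marked_norm1 p (A : mfamily X p) (v : marked_mod A) : R :=
  \sum_i cp_norm1 (marked_val v 0 i).

End MarkedModules.

Arguments marked_mod {R d X mu G} alpha Z {p} A.
Arguments marked_pred {R d X mu G} alpha Z {p} A.

Section LogNorm.
Context {R : realType} {d} {X : measurableType d} {mu : probability X R}.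
Context {G : groupType} {alpha : pmp_action mu G} {Z : coef}.
Local Notation mod := (marked_mod alpha Z).

Context {p q : nat} {M : mfamily X p} {N : mfamily X q}.
Implicit Types f : {linear mod M -> mod N}.

(* [0 <= c] matters only if all elements have norm 0, as when M = 0 *)
Definition op_norm f : R :=
  inf [set c : R | 0 <= c /\
    forall z, marked_norm1 (f z) <= c * marked_norm1 z].

Definition marked_rank f : R :=
  inf [set r : R | exists N' : mfamily X q, [/\ msubfamily N' N,
    forall z, marked_val (f z) \in marked_pred alpha Z N' &
    r = marked_dim mu N']].

(* [ln 0 = 0] *)
Definition log_plus (t : R) : R := Num.max (ln t) 0.

Definition lognorm' f : R :=
  Num.min (marked_dim mu M * log_plus (op_norm f))
          (marked_rank f * log_plus (op_norm f)).

End LogNorm.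

Definition lognorm (R : realType) d (X : measurableType d)
    (mu : probability X R) (G : groupType) (alpha : pmp_action mu G) (Z : coef)
    p q (M : mfamily X p) (N : mfamily X q)
    (f : {linear marked_mod alpha Z M -> marked_mod alpha Z N}) : R :=
  inf [set r : R | exists D : mdecomp M,
    r = \sum_k lognorm' (f \o marked_incl (mdecomp_sub D k))].

Section Modules.
Context {S : nzRingType}.
Implicit Types M P : lmodType S.

Definition is_basis M (B : set M) :=
  (forall v : M, exists (s : seq M) (c : M -> S),
     [set` s] `<=` B /\ v = \sum_(b <- s) c b *: b) /\
  (forall (s : seq M) (c : M -> S), uniq s -> [set` s] `<=` B ->
     \sum_(b <- s) c b *: b = 0 -> forall b, b \in s -> c b = 0).

Definition is_free M := exists B : set M, is_basis B.

Definition is_fg M := exists s : seq M, forall v : M, exists c : M -> S,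
  v = \sum_(b <- s) c b *: b.

Definition is_projective P :=
  forall (M N : lmodType S) (g : {linear M -> N}) (f : {linear P -> N}),
    (forall y, exists x, g x = y) ->
    exists h : {linear P -> M}, forall x, g (h x) = f x.

Record resolution (T : lmodType S) := Resolution {
  res_obj :> nat -> lmodType S;
  res_diff : forall k, {linear res_obj k.+1 -> res_obj k};
  res_aug : {linear res_obj 0%N -> T};
  res_aug_surj : forall t, exists c, res_aug c = t;
  res_exact0 : forall c, res_aug c = 0 <-> exists b, c = res_diff 0 b;
  res_exact : forall k c, res_diff k c = 0 <-> exists b, c = res_diff k.+1 b }.

End Modules.

Definition type_FP (m : nat) (G : groupType) :=
  exists C : resolution (trivial_mod G int),
    (forall k, is_projective (C k)) /\ (forall k, (k <= m)%N -> is_fg (C k)).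

Section MeasuredEmbeddings.
Context {R : realType} {d} {X : measurableType d} {mu : probability X R}.
Context {G : groupType} (alpha : pmp_action mu G) (Z : coef).

Record marked_complex := MarkedComplex {
  mc_obj :> nat -> marked X;
  mc_diff : forall k, {linear marked_mod alpha Z (mc_obj k.+1) ->
                              marked_mod alpha Z (mc_obj k)};
  mc_aug : {linear marked_mod alpha Z (mc_obj 0%N) -> Linf_mod alpha Z};
  mc_diff_diff : forall k v, mc_diff k (mc_diff k.+1 v) = 0;
  mc_aug_diff : forall v, mc_aug (mc_diff 0 v) = 0;
  mc_aug_surj : forall l, exists v, mc_aug v = l }.

(* D belongs to A_r(alpha), for the resolution C. A chain map up to degree r.+1
   is given by a family [f] in all degrees, of which only those up to r.+1 are
   constrained. *)
Definition embedding_target (C : resolution (trivial_mod G (coef_ring Z)))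
    (r : nat) (D : marked_complex) : Prop :=
  exists f : forall k, {linear C k -> marked_mod alpha Z (D k) |
                         group_ring_incl alpha (Z := Z) \; *:%R},
    (forall k, (k <= r)%N -> forall c,
       f k (res_diff C k c) = mc_diff D k (f k.+1 c)) /\
    (forall c, mc_aug D (f 0%N c) = Linf_cst mu Z (res_aug C c)).

(* Meant for r <= n.+1, for a group of type FP_(n.+1): [minn r n] is r if
   r <= n, and n in the boundary degree r = n.+1. The infimum is taken in
   [\bar R], so that it is +oo over the empty class. *)
Definition medim (C : resolution (trivial_mod G (coef_ring Z))) (n r : nat) :
    \bar R :=
  ereal_inf [set (marked_dim mu (D r))%:E | D in embedding_target C (minn r n)].

End MeasuredEmbeddings.

Definition mevol (R : realType) d (X : measurableType d)
    (mu : probability X R) (G : groupType) (alpha : pmp_action mu G)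
    (C : resolution (trivial_mod G int)) (r : nat) : \bar R :=
  ereal_inf [set (lognorm (mc_diff D r))%:E |
    D in @embedding_target _ _ _ _ _ alpha CoefInt C r].

(* X is isomorphic to the Borel space of a Polish space P *)
Definition standard_borel (R : realType) d (X : measurableType d) :=
  exists (P : completePseudoMetricType R) (f : X -> P),
    [/\ hausdorff_space P,
        (exists S : set P, countable S /\ dense S),
        bijective f &
        forall A : set X, measurable A <-> <<s [set U : set P | open U] >> (f @` A)].

Definition essentially_free (R : realType) d (X : measurableType d)
    (mu : probability X R) (G : groupType) (alpha : pmp_action mu G) :=
  {ae mu, forall x, forall g : G, alpha g x = x -> g = 1%g}.

Definition standard_action (R : realType) d (X : measurableType d)
    (mu : probability X R) (G : groupType) (alpha : pmp_action mu G) :=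
  [/\ countable [set: G], standard_borel R X & essentially_free alpha].

(* existence of a left-invariant mean on bounded functions; the values of [m]
   at unbounded functions are irrelevant *)
Definition amenable (R : realType) (G : groupType) :=
  let bounded (f : G -> R) := exists c : R, forall g, `|f g| <= c in
  exists m : (G -> R) -> R,
    [/\ m (fun=> 1) = 1,
        (forall (a : R) f h, bounded f -> bounded h ->
           m (fun g => a * f g + h g) = a * m f + m h),
        (forall f, bounded f -> (forall g, 0 <= f g) -> 0 <= m f) &
        (forall f (h : G), bounded f -> m (fun g => f (h^-1 * g)%g) = m f)].

Section ProductAction.
Context {R : realType} {d1 d2} {X1 : measurableType d1} {X2 : measurableType d2}.
Context {mu1 : probability X1 R} {mu2 : probability X2 R} {G1 G2 : groupType}.
Context (a1 : pmp_action mu1 G1) (a2 : pmp_action mu2 G2).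

Definition prod_act (g : G1 * G2) (x : X1 * X2) : X1 * X2 :=
  (a1 g.1 x.1, a2 g.2 x.2).

Lemma prod_act1 x : prod_act 1%g x = x.
Proof. by case: x => x y; rewrite /prod_act !pact1. Qed.

Lemma prod_actM g h x : prod_act (g * h)%g x = prod_act g (prod_act h x).
Proof. by rewrite /prod_act /= !pactM. Qed.

Lemma measurable_prod_act g : measurable_fun setT (prod_act g).
Proof.
apply: measurable_fun_pair => /=.
- exact: measurableT_comp (measurable_pact a1 g.1) measurable_fst.
- exact: measurableT_comp (measurable_pact a2 g.2) measurable_snd.
Qed.

Lemma prod_act_preserving g (A : set (X1 * X2)) : measurable A ->
  (mu1 \x mu2)%E (prod_act g @^-1` A) = (mu1 \x mu2)%E A.
Proof.
move=> mA; symmetry.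
have mg := @measurable_prod_act g.
change ((mu1 \x mu2)%E A = pushforward (mu1 \x mu2)%E (prod_act g) A).
apply: product_measure_unique => // B C mB mC.
rewrite /pushforward.
have mB' : measurable (a1 g.1 @^-1` B).
  by rewrite -[X in measurable X]setTI; exact: measurable_pact.
have mC' : measurable (a2 g.2 @^-1` C).
  by rewrite -[X in measurable X]setTI; exact: measurable_pact.
transitivity (mu1 (a1 g.1 @^-1` B) * mu2 (a2 g.2 @^-1` C))%E.
  by rewrite -product_measure1E.
by congr (_ * _)%E; exact: pact_preserving.
Qed.

Definition prod_action : pmp_action (mu1 \x mu2)%E (G1 * G2)%type :=
  PmpAction prod_act1 prod_actM (@measurable_prod_act) prod_act_preserving.

End ProductAction.

(* Main.v *)
Require Import Defs.
From HB Require Import structures.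
From mathcomp Require Import all_boot all_order all_algebra finmap.
From mathcomp Require Import all_classical all_reals all_analysis.
From mathcomp Require Import measurable_realfun.
From mathcomp Require Import ring lra zify.
From mathcomp Require monalg.
Import (canonicals, coercions) monalg.

(** Why the invariants vanish. For every eps > 0 there is one marked complex
    with an embedding up to degree n, all of whose modules have dimension at
    most eps and all of whose boundary maps have logarithmic norm at most eps
    (small_targets). Only the first factor of the group has to be made small.

    Tilings. Since G1 is amenable and acts freely, almost all of X1 can be
    tiled almost equivariantly: there are a finite set K of G1 and a partition
    of X1 into sets T t, t in K, such that x in T t implies s x in T (s t)
    outside a set of measure at most eps, for finitely many s given in
    advance. Since G1 is infinite, tiles are large, so that the set A of their
    base points t^-1 x, x in T t, has measure at most eps (folner, tiling,
    sparse_tiling). In the crossed product consider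
    theta = sum_t chi_(T t x X2) (t, 1). It satisfies theta chi_A = theta,
    commutes with G2, fixes the constant functions, and g theta - theta is
    supported on a small set for the given elements g of G1
    (theta_commutator).

    The target. Let M be a finite complex of free modules over the group
    ring of G1 x G2, and let phi be a matrix from M to an augmented complex
    N of free modules over the group ring of G2 that is a chain map once G1
    acts trivially; matrices multiply rows from the right. Then theta phi is
    an equivariant map from M to copies of the small module of A, and it is
    a chain map up to an error supported on a small set. Adding to the
    target the part of M that lies over this set and its finitely many
    relevant translates corrects the error, as in a mapping cylinder
    (cyl_map_diff, defect). All dimensions are then at most a constant times
    eps, and the norms of the boundary maps have a bound that only depends
    on M, N and phi. So the logarithmic norms, at most dimension times log_+
    of the norm, are small too (small_embedding).

    The source. From the finiteness properties of G1 and G2 one gets finitely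
    generated projective resolutions up to degree n + 1 over the integral group
    rings, hence matrices d, idempotents e and additive contractions h
    (contracted_model_exists). The tensor product of the two, with any
    coefficients, is the complex M, its contraction is the usual
    h1 (x) e2 + p1 (x) h2 (tcontrP), and N is the second factor, phi being the
    augmentation of the first (product_model). The contraction, available in
    degrees at most n, is all that is needed to construct recursively a chain
    map from a free resolution to M up to degree n + 1 (comparison_diff). Its
    composition with the map above is the embedding. *)

Set Implicit Arguments.
Unset Strict Implicit.
Unset Printing Implicit Defensive.

Import Order.TTheory GRing.Theory Num.Theory.

Local Open Scope classical_set_scope.
Local Open Scope ring_scope.
Local Open Scope quotient_scope.

(** * Linear functionals below sublinear ones *)

Section HahnBanach.
Context {R : realType} {V : lmodType R}.
Implicit Types (p q : V -> R) (x y v w : V) (t : R).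

Definition sublinear p :=
  (forall x y, p (x + y) <= p x + p y) /\
  (forall t x, 0 < t -> p (t *: x) <= t * p x).

Lemma sublinear0 p : sublinear p -> p 0 = 0.
Proof.
move=> [pD pZ].
have h1 := pD 0 0; rewrite addr0 in h1.
have := pZ (2^-1) 0; rewrite scaler0 => /(_ ltac:(by rewrite invr_gt0)) h2.
by apply/eqP; rewrite eq_le; apply/andP; split; lra.
Qed.

Lemma sublinear_ge p q x : sublinear p -> (forall y, p y <= q y) -> - q (- x) <= p x.
Proof.
move=> sp pq; have := sp.1 x (- x); rewrite subrr sublinear0 // => h.
by have := pq (- x); lra.
Qed.

Let descent p v w := [set r | exists t, 0 <= t /\ r = p (w + t *: v) - t * p v].

Let descent_lb p v w : sublinear p -> lbound (descent p v w) (- p (- w)).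
Proof.
move=> sp r [t [t0 ->]].
have := sp.1 (w + t *: v) (- w); rewrite addrAC subrr add0r => h.
have tp : p (t *: v) = t * p v.
  move: t0; rewrite le_eqVlt => /predU1P[<-|t0].
    by rewrite scale0r sublinear0 // mul0r.
  apply/eqP; rewrite eq_le sp.2 //=.
  have := sp.2 t^-1 (t *: v); rewrite invr_gt0 => /(_ t0).
  by rewrite scalerA mulVf ?gt_eqF // scale1r -ler_pdivlMl ?invr_gt0 // invrK.
by rewrite tp in h; lra.
Qed.

(** The infimum of descent p v is again sublinear and lies below p, and at w
    it is at most p (w + v) - p v. If p is minimal this gives p w <= p (w + v)
    - p v. *)
Lemma minimal_sublinear_additive p : sublinear p ->
  (forall q, sublinear q -> (forall x, q x <= p x) -> forall x, p x <= q x) ->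
  forall v w, p (w + v) = p w + p v.
Proof.
move=> sp pmin v w; apply/eqP; rewrite eq_le sp.1 /=.
have hl w' : has_lbound (descent p v w').
  by exists (- p (- w')); apply: descent_lb.
have ne w' : nonempty (descent p v w').
  by exists (p (w' + 0 *: v) - 0 * p v), 0.
pose q w' := inf (descent p v w').
have sq : sublinear q.
  split=> [x y|t x t0].
    rewrite -lerBlDr; apply: lb_le_inf => // _ [a [a0 ->]].
    rewrite lerBlDr -lerBlDl; apply: lb_le_inf => // _ [b [b0 ->]].
    rewrite lerBlDr; apply: (@le_trans _ _ (p (x + y + (a + b) *: v) - (a + b) * p v)).
      by apply: ge_inf => //; exists (a + b); rewrite addr_ge0.
    have := sp.1 (x + a *: v) (y + b *: v).
    by rewrite addrACA -scalerDl mulrDl; lra.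
  rewrite -ler_pdivrMl //; apply: lb_le_inf => // _ [a [a0 ->]].
  rewrite ler_pdivrMl //.
  apply: (@le_trans _ _ (p (t *: x + (t * a) *: v) - (t * a) * p v)).
    by apply: ge_inf => //; exists (t * a); rewrite mulr_ge0 // ltW.
  by rewrite -scalerA -scalerDr mulrBr mulrA lerD2r sp.2.
have qp x : q x <= p x.
  apply: ge_inf => //; exists 0; split=> //.
  by rewrite scale0r mul0r addr0 subr0.
have := pmin q sq qp w.
have : q w <= p (w + v) - p v.
  by apply: ge_inf => //; exists 1; rewrite scale1r mul1r.
by lra.
Qed.

(** Zorn's lemma provides a minimal sublinear functional below q, and a
    minimal one is additive. *)
Theorem hahn_banach q : sublinear q ->
  exists phi : V -> R, [/\ forall x y, phi (x + y) = phi x + phi y,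
    forall t x, 0 < t -> phi (t *: x) = t * phi x & forall x, phi x <= q x].
Proof.
move=> sq.
pose T := {p : V -> R | sublinear p /\ forall x, p x <= q x}.
pose r (a b : T) := `[< forall x, sval b x <= sval a x >].
have [| | | |[p [sp pq]] pmax] := @Zorn T r.
- by move=> a; apply/asboolP.
- move=> a b c /asboolP ab /asboolP bc; apply/asboolP => x.
  exact: le_trans (bc x) (ab x).
- move=> [a ha] [b hb] /asboolP ab /asboolP ba; apply: eq_exist => /=.
  by apply/funext => x; apply/eqP; rewrite eq_le ab ba.
- move=> A totA; have [->|/set0P[a0 Aa0]] := eqVneq A set0.
    by exists (exist _ q (conj sq (fun x => lexx (q x)))) => s.
  pose E x := [set sval a x | a in A].
  have lE x : has_lbound (E x).
    exists (- q (- x)) => _ [[a [sa aq]] _ <-] /=; exact: sublinear_ge.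
  have nE x : nonempty (E x) by exists (sval a0 x), a0.
  pose p x := inf (E x).
  have pa a x : A a -> p x <= sval a x by move=> Aa; apply: ge_inf => //; exists a.
  have sp : sublinear p.
    split=> [x y|t x t0].
      rewrite -lerBlDr; apply: lb_le_inf => // _ [a Aa <-].
      rewrite lerBlDr -lerBlDl; apply: lb_le_inf => // _ [b Ab <-].
      rewrite lerBlDr.
      have [/asboolP ab|/asboolP ba] := totA a b Aa Ab.
        apply: (le_trans (pa b _ Ab)).
        by apply: (le_trans ((svalP b).1.1 x y)); rewrite addrC lerD2l ab.
      apply: (le_trans (pa a _ Aa)).
      by apply: (le_trans ((svalP a).1.1 x y)); rewrite addrC lerD2r ba.
    rewrite -ler_pdivrMl //; apply: lb_le_inf => // _ [a Aa <-].
    rewrite ler_pdivrMl //; apply: (le_trans (pa a _ Aa)).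
    exact: (svalP a).1.2.
  have pq x : p x <= q x by apply: (le_trans (pa a0 x Aa0)); apply: (svalP a0).2.
  by exists (exist _ p (conj sp pq)) => s As; apply/asboolP => x /=; apply: pa.
have pmin q' : sublinear q' -> (forall x, q' x <= p x) -> forall x, p x <= q' x.
  move=> sq' q'p x.
  have q'q y : q' y <= q y by apply: le_trans (q'p y) (pq y).
  have := pmax (exist _ q' (conj sq' q'q)).
  move=> /(_ ltac:(by apply/asboolP)) /(congr1 sval) /= ->.
  exact: lexx.
exists p; split=> // [x y|t x t0]; first exact: minimal_sublinear_additive.
apply/eqP; rewrite eq_le sp.2 //=.
have := sp.2 t^-1 (t *: x); rewrite invr_gt0 => /(_ t0).
by rewrite scalerA mulVf ?gt_eqF // scale1r -ler_pdivlMl ?invr_gt0 // invrK.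
Qed.

End HahnBanach.

(** * Amenability and Folner sets *)

Lemma exists_argmin (T : eqType) (R : realDomainType) (f : T -> R) (s : seq T) :
  s != [::] -> exists2 x, x \in s & forall y, y \in s -> f x <= f y.
Proof.
elim: s => // x [|y s] IH _.
  by exists x; rewrite ?mem_head // => y; rewrite inE => /eqP ->.
have [//|z zs zmin] := IH; have [xz|zx] := leP (f x) (f z).
  exists x; rewrite ?mem_head // => w; rewrite inE => /predU1P[->//|ws].
  exact: le_trans xz (zmin _ ws).
exists z; first by rewrite inE zs orbT.
by move=> w; rewrite inE => /predU1P[->|/zmin//]; rewrite ltW.
Qed.

Section Coarea.
Context {R : realType} {G : choiceType} {I : finType} (s : I -> G -> G).
Context (delta : R).
Context (expand : forall K : {fset G}, K != fset0 ->
  delta * #|` K|%:R <= \sum_i \sum_(g <- K) (s i g \notin K)%:R).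

(** Both sides are integrals over t > 0 of the same expressions for the
    indicator functions of the finite superlevel sets of p at t, and for those
    the inequality is the expansion property. The induction integrates level
    by level: it subtracts from p its minimum on D. *)
Lemma coarea (D : {fset G}) (p : G -> R) :
  (forall g, 0 <= p g) -> (forall g, g \notin D -> p g = 0) ->
  delta * (\sum_(g <- D) p g) <=
  \sum_i \sum_(g <- D) Num.max (p g - p (s i g)) 0.
Proof.
have [n] := ubnP #|` D|; elim: n => // n IH in D p *.
rewrite ltnS => Dn p0 pD.
have [->|D0] := eqVneq D fset0.
  by rewrite big_seq_fset0 mulr0 sumr_ge0 // => i _; rewrite big_seq_fset0.
have [g0 g0D g0min] : exists2 x, x \in D & forall y, y \in D -> p x <= p y.
  apply: (@exists_argmin _ _ p (enum_fset D)); apply: contraNneq D0 => D0.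
  by apply/eqP/fsetP => g; rewrite -[LHS]/(g \in enum_fset D) D0 !inE.
pose a := p g0; pose p' g := if g \in D then p g - a else 0.
have p'0 g : 0 <= p' g by rewrite /p'; case: ifP => // gD; rewrite subr_ge0 g0min.
have p'g0 : p' g0 = 0 by rewrite /p' g0D subrr.
have p'D g : g \notin (D `\ g0)%fset -> p' g = 0.
  rewrite !inE negb_and negbK => /orP[/eqP->//|gD].
  by rewrite /p' (negbTE gD).
have cD' : (#|` (D `\ g0)%fset| < n)%N.
  by move: Dn; rewrite (cardfsD1 g0) g0D.
have IH' := IH _ p' cD' p'0 p'D.
have eD (f : G -> R) : \sum_(g <- D) f g = f g0 + \sum_(g <- (D `\ g0)%fset) f g.
  by rewrite (big_fsetD1 g0).
have -> : \sum_(g <- D) p g = a * #|` D|%:R + \sum_(g <- (D `\ g0)%fset) p' g.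
  have -> : \sum_(g <- (D `\ g0)%fset) p' g = \sum_(g <- D) p' g by rewrite eD p'g0 add0r.
  have -> : a * #|` D|%:R = \sum_(g <- D) a.
    by rewrite big_const_seq count_predT iter_addr_0 mulr_natr.
  rewrite -big_split /= big_seq [RHS]big_seq; apply: eq_bigr => g gD.
  by rewrite /p' gD addrC subrK.
have key i : \sum_(g <- (D `\ g0)%fset) Num.max (p' g - p' (s i g)) 0 +
    a * (\sum_(g <- D) (s i g \notin D)%:R) <=
    \sum_(g <- D) Num.max (p g - p (s i g)) 0.
  apply: (@le_trans _ _ (\sum_(g <- D) Num.max (p' g - p' (s i g)) 0 +
     a * (\sum_(g <- D) (s i g \notin D)%:R))).
    by rewrite lerD2r eD lerDr le_max lexx orbT.
  rewrite mulr_sumr -big_split /= big_seq [leRHS]big_seq; apply: ler_sum => g gD.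
  rewrite /p' gD; case: ifPn => sgD /=.
    by rewrite mulr0 addr0 opprB addrA subrK.
  by rewrite mulr1 !subr0 (pD _ sgD) subr0 !max_l ?subrK ?subr_ge0 ?g0min.
apply: le_trans (ler_sum _ (fun i _ => key i)); rewrite big_split /= -mulr_sumr.
have e := ler_wpM2l (p0 g0) (expand D0).
rewrite mulrDr [X in _ <= X]addrC; apply: lerD => //.
by rewrite mulrCA.
Qed.

End Coarea.

Section Folner.
Context {R : realType} {G : groupType}.

Section Flow.
Context (S : seq G).
Local Notation I := 'I_(size S).
Local Notation K := (I * G)%type.
Local Notation V := (malg K R).
Local Notation s i := (nth 1%g S i).
Context (delta : R).
Context (expand : forall K : {fset G}, K != fset0 ->
  delta * #|` K|%:R <= \sum_(i : I) \sum_(g <- K) ((s i * g)%g \notin K)%:R).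

Let posn (w : V) : R := \sum_(k <- msupp w) Num.max w@_k 0.

Let posnw (D : {fset K}) w : (msupp w `<=` D)%fset ->
  posn w = \sum_(k <- D) Num.max w@_k 0.
Proof.
move=> wD; rewrite /posn (big_fset_incl _ wD) //=.
by move=> k _ /monalg.mcoeff_outdom ->; rewrite max_l.
Qed.

Let posn_sublinear : sublinear posn.
Proof.
split=> [x y|t x t0].
  rewrite (posnw (fsubsetUl (msupp x) (msupp y))).
  rewrite (posnw (fsubsetUr (msupp x) (msupp y))).
  rewrite (posnw (monalg.msuppD_le _ _)) -big_split /=.
  apply: ler_sum => k _; rewrite monalg.mcoeffD.
  by rewrite ge_max lerD ?le_max ?lexx //= addr_ge0 // le_max lexx orbT.
rewrite (posnw (monalg.msuppZ_le _ _)) mulr_sumr; apply: ler_sum => k _.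
by rewrite monalg.mcoeffZ (maxr_pMr _ _ (ltW t0)) mulr0 lexx.
Qed.

Let posn_ge w (r : seq K) : uniq r -> \sum_(k <- r) Num.max w@_k 0 <= posn w.
Proof.
move=> ur; pose A := [fset k in r]%fset; pose m k := Num.max w@_k 0.
rewrite (posnw (fsubsetUr A (msupp w))).
have -> : \sum_(k <- r) m k = \sum_(k <- A) m k * (k \in A)%:R.
  rewrite big_seq; under eq_bigr => k kr.
    have -> : m k = m k * (k \in A)%:R by rewrite !inE kr mulr1.
    over.
  rewrite -big_seq; apply: perm_big; apply: uniq_perm => [//||k]; first exact: fset_uniq.
  by rewrite -[RHS]/(k \in A) !inE.
rewrite (big_fset_incl _ (fsubsetUl A (msupp w))) /=; last first.
  by move=> k _ /negbTE ->; rewrite mulr0.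
apply: ler_sum => k _; case: (k \in A); rewrite ?mulr1 // mulr0.
by rewrite le_max lexx orbT.
Qed.

Let div (g : G) : V :=
  \sum_(i : I) (<< 1 *g (i, g) >> - << 1 *g (i, ((s i)^-1 * g)%g) >>).
Let T (l : seq (R * G)) : V := \sum_(x <- l) x.1 *: div x.2.
Let tot (l : seq (R * G)) : R := \sum_(x <- l) x.1.
Let pos (l : seq (R * G)) := all (fun x => 0 <= x.1) l.

Let T_coef l i g : (T l)@_(i, g) =
  \sum_(x <- l) x.1 * (x.2 == g)%:R - \sum_(x <- l) x.1 * (x.2 == (s i * g)%g)%:R.
Proof.
rewrite /T raddf_sum -sumrB /=; apply: eq_bigr => -[a h] _ /=.
rewrite monalg.mcoeffZ -mulrBr; congr (_ * _).
rewrite /div raddf_sum (bigD1 i) //= big1 ?addr0; last first.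
  move=> j /negbTE ji; rewrite monalg.mcoeffB !monalg.mcoeffU !xpair_eqE ji.
  by rewrite subrr.
rewrite monalg.mcoeffB !monalg.mcoeffU !xpair_eqE eqxx; congr (_ - _%:R).
by congr (nat_of_bool _); apply/eqP/eqP => [<-|->]; rewrite ?mulKg ?mulVKg.
Qed.

Let T_bound l : pos l -> delta * tot l <= posn (T l).
Proof.
move=> pl.
pose p g := \sum_(x <- l) x.1 * (x.2 == g)%:R : R.
pose D := [fset x | x in [seq x.2 | x <- l]]%fset.
have p0 g : 0 <= p g.
  by rewrite /p big_seq sumr_ge0 // => x /(allP pl) x0; rewrite mulr_ge0.
have pD g : g \notin D -> p g = 0.
  move=> gD; rewrite /p big_seq big1 // => x xl.
  case: eqP => [xg|]; last by rewrite mulr0.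
  by move: gD; rewrite !inE /= -xg map_f.
have := coarea (s := fun (i : I) g => (s i * g)%g) expand p0 pD.
have -> : \sum_(g <- D) p g = tot l.
  rewrite exchange_big /= /tot big_seq [RHS]big_seq; apply: eq_bigr => x xl.
  rewrite -mulr_sumr (big_fsetD1 x.2) /=; last by rewrite !inE map_f.
  rewrite eqxx big_seq big1 ?addr0 ?mulr1 // => g.
  by rewrite !inE eq_sym => /andP[/negbTE ->].
move=> h; apply: (le_trans h).
pose r := [seq (i, g) | i : I <- enum I, g <- D].
have ur : uniq r.
  by apply: allpairs_uniq; rewrite ?enum_uniq ?fset_uniq // => -[? ?] [? ?] _ _ [-> ->].
apply: le_trans (posn_ge (T l) ur).
rewrite /r big_allpairs big_enum /=; apply: ler_sum => i _; apply: ler_sum => g _.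
by rewrite T_coef.
Qed.

Let T_cat l l' : T (l ++ l') = T l + T l'.
Proof. by rewrite /T big_cat. Qed.

Let q (w : V) := inf [set x | exists l, pos l /\ x = posn (w + T l) - delta * tot l].

Let q_lb w : lbound [set x | exists l, pos l /\ x = posn (w + T l) - delta * tot l]
  (- posn (- w)).
Proof.
move=> _ [l [pl ->]]; have := T_bound pl.
have := posn_sublinear.1 (w + T l) (- w); rewrite addrAC subrr add0r.
by lra.
Qed.

Let q_le w l : pos l -> q w <= posn (w + T l) - delta * tot l.
Proof.
by move=> pl; apply: ge_inf; [exists (- posn (- w)); exact: q_lb|exists l].
Qed.

Let q_ge w x : (forall l, pos l -> x <= posn (w + T l) - delta * tot l) -> x <= q w.
Proof.
move=> h; apply: lb_le_inf => [|_ [l [pl ->]]]; last exact: h.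
by exists (posn (w + T [::]) - delta * tot [::]), [::].
Qed.

Let q_sublinear : sublinear q.
Proof.
split=> [x y|t x t0].
  rewrite -lerBlDr; apply: q_ge => l pl.
  rewrite lerBlDr -lerBlDl; apply: q_ge => l' pl'; rewrite lerBlDl.
  have pll : pos (l ++ l') by rewrite /pos all_cat; apply/andP.
  apply: (le_trans (q_le _ pll)); rewrite T_cat /tot big_cat /= mulrDr.
  by have := posn_sublinear.1 (x + T l) (y + T l'); rewrite addrACA /tot; lra.
rewrite -ler_pdivrMl //; apply: q_ge => l pl; rewrite ler_pdivrMl //.
pose l' := [seq (t * z.1, z.2) | z <- l].
have pl' : pos l'.
  by apply/allP => _ /mapP[z zl ->] /=; rewrite mulr_ge0 ?(ltW t0) // (allP pl).
apply: (le_trans (q_le _ pl')).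
have -> : T l' = t *: T l.
  by rewrite /T big_map scaler_sumr; apply: eq_bigr => z _; rewrite scalerA.
have -> : tot l' = t * tot l by rewrite /tot big_map mulr_sumr.
rewrite -scalerDr mulrBr mulrCA lerD2r; exact: posn_sublinear.2.
Qed.

(** A form of the max-flow min-cut theorem: if the translations by S expand
    all finite sets, some flow on the Cayley graph with values in [0, 1] has
    divergence at least delta everywhere. A flow is a linear functional on the
    finitely supported functions on edges. Its values are in [0, 1] when it
    lies below posn, and q is the largest sublinear functional below posn
    whose value at - div g is at most - delta. That q is finite is the coarea
    inequality. *)
Lemma expanding_flow : exists f : I -> G -> R,
  (forall i g, 0 <= f i g <= 1) /\
  (forall g, delta <= \sum_i (f i g - f i ((s i)^-1 * g)%g)).
Proof.
have [phi [phiD phiZ phiq]] := hahn_banach q_sublinear.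
have phi0 : phi 0 = 0 by have := phiD 0 0; rewrite addr0; lra.
have phiN x : phi (- x) = - phi x by have := phiD x (- x); rewrite subrr; lra.
have phi_sum (J : Type) (r : seq J) (F : J -> V) :
    phi (\sum_(j <- r) F j) = \sum_(j <- r) phi (F j).
  exact: (big_morph phi phiD phi0).
have phiposn x : phi x <= posn x.
  apply: (le_trans (phiq x)); apply: (le_trans (q_le x (l := [::]) _)) => //.
  by rewrite /T /tot !big_nil addr0 mulr0 subr0.
have posnU k a : posn << a *g k >> <= Num.max a 0.
  by rewrite (posnw monalg.msuppU_le) big_seq_fset1 monalg.mcoeffUU lexx.
exists (fun i g => phi << 1 *g (i, g) >>); split=> [i g|g].
  have eN : << -1 *g (i, g) >> = - << 1 *g (i, g) >> :> V by exact: monalg.monalgUN.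
  have h1 := le_trans (phiposn << 1 *g (i, g) >>) (posnU _ _).
  have h2 := le_trans (phiposn << -1 *g (i, g) >>) (posnU _ _).
  rewrite eN phiN (max_r (lerN10 R)) in h2; rewrite (max_l ler01) in h1.
  by apply/andP; split; lra.
have : phi (- div g) <= - delta.
  apply: (le_trans (phiq _)); apply: (le_trans (q_le _ (l := [:: (1, g)]) _)).
    by rewrite /pos /= ler01.
  rewrite /T /tot !big_seq1 /= scale1r addNr sublinear0 //.
  by rewrite mulr1 sub0r.
rewrite phiN lerN2 /div phi_sum => h; apply: (le_trans h).
by apply: ler_sum => i _; rewrite phiD phiN.
Qed.

End Flow.

(** Otherwise all finite sets expand, and the mean of the divergence of the
    flow of expanding_flow is both at least delta and, by invariance, zero. *)
Theorem folner (S : seq G) (delta : R) : amenable R G -> 0 < delta ->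
  exists K : {fset G}, K != fset0 /\
    \sum_(s <- S) \sum_(g <- K) ((s * g)%g \notin K)%:R <= delta * #|` K|%:R.
Proof.
move=> [m [m1 mlin mpos minv]] d0; apply: contrapT => nK.
have expand (K : {fset G}) : K != fset0 ->
    delta * #|` K|%:R <=
    \sum_(i < size S) \sum_(g <- K) ((nth 1%g S i * g)%g \notin K)%:R.
  move=> K0; rewrite leNgt; apply/negP => h; apply: nK; exists K; split=> //.
  by rewrite (big_nth 1%g) big_mkord ltW.
have [f [f01 fdiv]] := expanding_flow expand.
have bd (h : G -> R) (c : R) : (forall g, `|h g| <= c) -> exists c : R, forall g, `|h g| <= c.
  by move=> hc; exists c.
have bf i : exists c : R, forall g, `|f i g| <= c.
  by exists 1 => g; have /andP[a b] := f01 i g; rewrite ger0_norm.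
have bft i s : exists c : R, forall g, `|f i (s * g)%g| <= c.
  by exists 1 => g; have /andP[a b] := f01 i (s * g)%g; rewrite ger0_norm.
have bsum (J : finType) (F : J -> G -> R) : (forall j, exists c : R, forall g, `|F j g| <= c) ->
    exists c : R, forall g, `|\sum_j F j g| <= c.
  move=> /choice[c hc]; exists (\sum_j c j) => g.
  by apply: (le_trans (ler_norm_sum _ _ _)); apply: ler_sum.
have bdc (c : R) : exists c' : R, forall g : G, `|(fun=> c) g| <= c' by exists `|c|.
have m0 : m (fun=> 0) = 0.
  have := mlin (-1) (fun=> 0) (fun=> 0) (bdc _) (bdc _).
  by rewrite (_ : (fun _ => _) = fun=> 0); [lra|apply/funext => g; rewrite mulr0 addr0].
have mD f1 f2 : (exists c : R, forall g, `|f1 g| <= c) ->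
    (exists c : R, forall g, `|f2 g| <= c) -> m (fun g => f1 g + f2 g) = m f1 + m f2.
  move=> b1 b2; have := mlin 1 f1 f2 b1 b2; rewrite mul1r => <-.
  by congr m; apply/funext => g; rewrite mul1r.
have mN f1 : (exists c : R, forall g, `|f1 g| <= c) -> m (fun g => - f1 g) = - m f1.
  move=> b1; have := mlin (-1) f1 (fun=> 0) b1 (bdc _); rewrite m0 addr0 mulN1r => <-.
  by congr m; apply/funext => g; rewrite mulN1r addr0.
pose F i g := f i g - f i ((nth 1%g S i)^-1 * g)%g.
have bN f1 : (exists c : R, forall g, `|f1 g| <= c) ->
    exists c : R, forall g : G, `|- f1 g| <= c.
  by move=> [c hc]; exists c => g; rewrite normrN.
have bF i : exists c : R, forall g, `|F i g| <= c.
  exists 1 => g; have /andP[a b] := f01 i g.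
  have /andP[a' b'] := f01 i ((nth 1%g S i)^-1 * g)%g.
  by rewrite ler_norml /F; apply/andP; split; lra.
have mF i : m (F i) = 0.
  by rewrite mD ?mN ?minv ?subrr //; apply: bN; apply: bft.
have msum (r : seq 'I_(size S)) : (exists c : R, forall g, `|\sum_(i <- r) F i g| <= c) /\
    m (fun g => \sum_(i <- r) F i g) = 0.
  elim: r => [|i r [[c hc] IH]].
    split; first by exists 0 => g; rewrite big_nil normr0.
    by rewrite -[RHS]m0; congr m; apply/funext => g; rewrite big_nil.
  have [c' hc'] := bF i; split.
    exists (c' + c) => g; rewrite big_cons.
    by apply: (le_trans (ler_normD _ _)); apply: lerD.
  have -> : (fun g => \sum_(j <- i :: r) F j g) = fun g => F i g + \sum_(j <- r) F j g.
    by apply/funext => g; rewrite big_cons.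
  by rewrite mD ?mF ?IH ?addr0 //; exists c.
have [b s0] := msum (index_enum _).
have : 0 <= m (fun g => \sum_i F i g + - delta).
  apply: mpos; last by move=> g; rewrite subr_ge0; exact: fdiv.
  have [c hc] := b; exists (c + delta) => g.
  apply: (le_trans (ler_normB _ _)).
  by rewrite (gtr0_norm d0); apply: lerD.
rewrite mD // s0 (_ : m (fun=> - delta) = - delta); first by lra.
have := mlin (- delta) (fun=> 1) (fun=> 0) (bdc _) (bdc _).
by rewrite m1 m0 addr0 mulr1.
Qed.

End Folner.

(** * Measures of sets and pointwise counting *)

Section Counting.
Context {R : realType} {d} {X : measurableType d} (mu : probability X R).

Definition pr (A : set X) : R := fine (mu A).

Lemma prE A : measurable A -> mu A = (pr A)%:E.
Proof. by move=> mA; rewrite /pr fineK // fin_num_measure. Qed.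

Lemma pr_ge0 A : 0 <= pr A.
Proof. exact/fine_ge0. Qed.

Lemma integral_comb (I : Type) (r : seq I) (a : I -> R) (A : I -> set X) :
  (forall i, 0 <= a i) -> (forall i, measurable (A i)) ->
  (\int[mu]_x (\sum_(i <- r) a i * (x \in A i)%:R)%:E)%E =
  (\sum_(i <- r) a i * pr (A i))%:E.
Proof.
move=> a0 mA.
under eq_integral => x _ do rewrite -sumEFin.
rewrite ge0_integral_sum //; last first.
- by move=> i x _; rewrite lee_fin mulr_ge0.
- move=> i; apply/measurable_EFinP; apply: measurable_funM => //.
  exact: measurable_indic.
rewrite -sumEFin; apply: eq_bigr => i _.
under eq_integral => x _ do rewrite EFinM.
rewrite ge0_integralZl_EFin //; last first.
  by apply/measurable_EFinP; exact: measurable_indic.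
rewrite EFinM -prE //; congr (_ * _)%E.
by have := integral_indic mu measurableT (mA i); rewrite setIT.
Qed.

(** The measure estimates below compare, at almost every point, the numbers of
    sets of two families that contain it. *)
Lemma counting_le (I J : Type) (r : seq I) (s : seq J) (a : I -> R) (b : J -> R)
    (A : I -> set X) (B : J -> set X) :
  (forall i, 0 <= a i) -> (forall j, 0 <= b j) ->
  (forall i, measurable (A i)) -> (forall j, measurable (B j)) ->
  {ae mu, forall x, \sum_(i <- r) a i * (x \in A i)%:R <=
                    \sum_(j <- s) b j * (x \in B j)%:R} ->
  \sum_(i <- r) a i * pr (A i) <= \sum_(j <- s) b j * pr (B j).
Proof.
move=> a0 b0 mA mB h; rewrite -lee_fin -!integral_comb //.
have m (K : Type) (t : seq K) c (C : K -> set X) : (forall k, measurable (C k)) ->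
   measurable_fun setT (fun x => (\sum_(k <- t) c k * (x \in C k)%:R : R)%:E).
  move=> mC; apply/measurable_EFinP; apply: measurable_sum => k.
  apply: measurable_funM => //; exact: measurable_indic.
apply: ae_ge0_le_integral => //.
- by move=> x _; rewrite lee_fin sumr_ge0 // => i _; rewrite mulr_ge0.
- exact: m.
- by move=> x _; rewrite lee_fin sumr_ge0 // => i _; rewrite mulr_ge0.
- exact: m.
- by apply: filterS h => x hx _; rewrite lee_fin.
Qed.

End Counting.

(** * Independent sets of a free action *)

Section Separation.
Context {R : realType} {d} {X : measurableType d}.

(** The balls of radius 1 / (k + 1) around the points of a dense sequence,
    transported from the Polish space. *)
Lemma standard_borel_separating : standard_borel R X ->
  exists U : nat -> set X, (forall n, measurable (U n)) /\
    forall x y, x <> y -> exists n, U n x /\ ~ U n y.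
Proof.
move=> [P [f [hP [S [cS dS]] bf mf]]].
case: (pselect (nonempty [set: X])) => [[x0 _]|nX]; last first.
  by exists (fun=> set0); split=> // x; case: nX; exists x.
have [e eS] : exists e : nat -> P, S `<=` range e.
  have /pfcard_geP[S0|[g]] := cS.
    by exists (fun=> f x0); rewrite S0; apply: sub0set.
  by exists g => s Ss; have [n _ <-] := @surj _ _ _ _ g _ Ss; exists n.
pose W (k : nat * nat) : set P := interior (ball (e k.1) (k.2.+1%:R^-1 : R)).
pose U n := f @^-1` (match @choice.unpickle (nat * nat)%type n with Datatypes.Some k => W k | None => set0 end).
exists U; split=> [n|x y xy].
  apply/mf; rewrite /U image_preimage; last first.
    by apply/seteqP; split=> // p _; have [g fg gf] := bf; exists (g p).
  case: choice.unpickle => [k|]; apply: sub_sigma_algebra => /=.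
    exact: open_interior.
  exact: open0.
have fxy : f x != f y by apply/eqP => /(bij_inj bf).
have := hP; rewrite ball_hausdorff => /(_ _ _ fxy)[[r1 r2] /= r12].
have r10 : 0 < r1%:num / 2 by rewrite divr_gt0.
have [k _ /(_ k (leqnn k)) kr] := near_infty_natSinv_lt (PosNum r10).
pose t : R := k.+1%:R^-1; have t0 : 0 < t by rewrite invr_gt0.
have t20 : 0 < t / 2 by rewrite divr_gt0.
have [|s [sx Ss]] := dS (interior (ball (f x) (t / 2))) _ (open_interior _).
  by exists (f x); apply: nbhsx_ballx.
have {}sx := interior_subset sx.
have [i _ ei] := eS s Ss.
exists (choice.pickle (i, k)); rewrite /U /= choice.pickleK /W /= ei; split.
  have : nbhs (f x) (ball (f x) (t / 2)) by apply: nbhsx_ballx.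
  apply: filterS => z xz; apply: (@ball_split _ _ (f x)) => //.
  exact: ball_sym.
move=> /interior_subset sy; move/eqP/seteqP: r12 => [r12 _].
apply: (r12 (f y)); split; last exact: ballxx.
apply: (le_ball (e1 := t / 2 + t)).
  by move: kr; rewrite /= -/t; lra.
exact: ball_triangle sx sy.
Qed.

End Separation.

Section Markers.
Context {R : realType} {d} {X : measurableType d} {mu : probability X R}.
Context {G : groupType} (alpha : pmp_action mu G).
Local Notation pr := (pr mu).

Definition independent (L : seq G) (E : set X) :=
  forall x g, g \in L -> E x -> E (alpha g x) -> g = 1%g.

Lemma measurable_translate g A : measurable A -> measurable (alpha g @^-1` A).
Proof. by move=> mA; rewrite -[X in measurable X]setTI; apply: measurable_pact. Qed.

Lemma pr_translate g A : measurable A -> pr (alpha g @^-1` A) = pr A.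
Proof. by move=> mA; rewrite /pr pact_preserving. Qed.

(** If g moves x, some U n contains x but not g x; the part of U n that g
    moves out of U n does not meet its translate. Intersections of such sets,
    one for each g in L, contain all points with trivial stabilizer. *)
Lemma independent_cover (U : nat -> set X) (L : seq G) :
  (forall n, measurable (U n)) ->
  (forall x y, x <> y -> exists n, U n x /\ ~ U n y) ->
  exists B : nat -> set X, [/\ forall n, measurable (B n),
    forall n, independent L (B n) &
    forall x, (forall g, alpha g x = x -> g = 1%g) -> exists n, B n x].
Proof.
move=> mU sepU; elim: L => [|g L [B [mB iB cB]]].
  by exists (fun=> setT); split=> // x _; exists 0%N.
have [->|g1] := eqVneq g 1%g.
  exists B; split=> // n x h; rewrite inE => /predU1P[//|hL]; exact: iB.
pose W (k : nat * nat) := B k.1 `&` (U k.2 `\` alpha g @^-1` (U k.2)).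
exists (fun n => match @choice.unpickle (nat * nat)%type n with
                 | Datatypes.Some k => W k | None => set0 end); split=> [n|n|x fx].
- case: choice.unpickle => [k|//]; apply: measurableI => //.
  by apply: measurableD => //; apply: measurable_translate.
- case: choice.unpickle => [k|//] x h; rewrite inE => /predU1P[->|hL].
    by move=> [_ [_ /= nU]] [_ [/= Ug _]].
  by move=> [Bx _] [Bhx _]; apply: iB Bhx.
- have [n Bn] := cB x fx.
  have [|k [Ux nU]] := sepU x (alpha g x).
    by move=> e; move: g1; rewrite (fx g (esym e)) eqxx.
  by exists (choice.pickle (n, k)); rewrite choice.pickleK.
Qed.

Context (std : standard_action alpha).

(** A maximal independent subset E' of E is obtained by running through the
    sets B n of independent_cover and adding what is compatible with the
    points chosen so far. By maximality the translates of E' by L cover almost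
    all of E. *)
Lemma independent_subset (L : seq G) (E : set X) : measurable E ->
  1%g \in L -> (forall g, g \in L -> g^-1%g \in L) ->
  exists E' : set X, [/\ measurable E', E' `<=` E, independent L E' &
    pr E <= (size L)%:R * pr E'].
Proof.
move=> mE L1 LV; have [cG [U [mU sepU]] free] :
  [/\ countable [set: G], (exists U : nat -> set X, (forall n, measurable (U n)) /\
    (forall x y, x <> y -> exists n, U n x /\ ~ U n y)) & essentially_free alpha].
  by case: std => cG sb fr; split=> //; exact: standard_borel_separating sb.
have [B [mB iB cB]] := independent_cover L mU sepU.
pose sat A := \big[setU/set0]_(g <- L) (alpha g @^-1` A).
have satP A x : sat A x <-> exists2 g, g \in L & A (alpha g x).
  by rewrite /sat -bigcup_seq; split=> [[g gL]|[g gL]] Ag; exists g.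
have msat A : measurable A -> measurable (sat A).
  by move=> mA; apply: bigsetU_measurable => g _; apply: measurable_translate.
pose fix F n := match n with 0%N => set0 | n'.+1 => F n' `|` ((E `&` B n') `\` sat (F n')) end.
have mF n : measurable (F n).
  elim: n => [|n IH] /=; first exact: measurable0.
  apply: measurableU => //; apply: measurableD; last exact: msat.
  exact: measurableI.
have FE n : F n `<=` E by elim: n => [//|n IH] x [/IH//|[[]]].
have iF n : independent L (F n).
  elim: n => [//|n IH] x g gL /= [Fx|[[Ex Bx] nx]] [Fg|[[Eg Bg] ng]].
  - exact: IH Fx Fg.
  - by case: ng; apply/satP; exists g^-1%g; rewrite ?LV // -pactM mulVg pact1.
  - by case: nx; apply/satP; exists g.
  - exact: iB Bx Bg.
have Fmono m n : (m <= n)%N -> F m `<=` F n.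
  by move/subnK <-; elim: (n - m)%N => [//|k IH] x /IH Fx; left.
pose E' := \bigcup_n F n.
have mE' : measurable E' by apply: bigcup_measurable.
exists E'; split=> //; first by move=> x [n _ /FE].
  move=> x g gL [m _ Fm] [n _ Fn].
  apply: (iF (maxn m n) x g gL).
    exact: (Fmono _ _ (leq_maxl _ _) _ Fm).
  exact: (Fmono _ _ (leq_maxr _ _) _ Fn).
have -> : (size L)%:R * pr E' = \sum_(g <- L) 1 * pr (alpha g @^-1` E').
  rewrite (eq_bigr (fun=> pr E')); last by move=> g _; rewrite mul1r pr_translate.
  by rewrite big_const_seq count_predT iter_addr_0 mulr_natl.
have := @counting_le _ _ _ mu unit G [:: tt] L (fun=> 1) (fun=> 1) (fun=> E)
  (fun g => alpha g @^-1` E').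
rewrite big_seq1 mul1r; apply=> //; first by move=> g; exact: measurable_translate.
apply: filterS free => x fx; rewrite big_seq1 mul1r.
have [xE|] := boolP (x \in E); last first.
  by move=> _; apply: sumr_ge0 => g _; rewrite mul1r.
have [g gL Eg] : exists2 g, g \in L & E' (alpha g x).
  have [n Bn] := cB x fx; have [/satP[g gL Fg]|nF] := pselect (sat (F n) x).
    by exists g => //; exists n.
  exists 1%g => //; rewrite pact1; exists n.+1 => //; right; split=> //.
  by split=> //; exact: set_mem.
rewrite (big_rem g) //= mul1r (mem_set (Eg : (alpha g @^-1` E') x)) lerDl.
by apply: sumr_ge0 => h _; rewrite mul1r.
Qed.

End Markers.

(** * Almost equivariant tilings *)

Section ProbabilityBounds.
Context {R : realType} {d} {X : measurableType d} (mu : probability X R).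
Local Notation pr := (pr mu).

Lemma pr_le A B : measurable A -> measurable B -> A `<=` B -> pr A <= pr B.
Proof. by move=> mA mB AB; rewrite -lee_fin -!prE // le_measure ?inE. Qed.

Lemma prU_le A B : measurable A -> measurable B -> pr (A `|` B) <= pr A + pr B.
Proof.
move=> mA mB; rewrite -lee_fin EFinD -!prE //; last exact: measurableU.
exact: measureU2.
Qed.

Lemma pr_bigsetU_le I (r : seq I) (P : pred I) (A : I -> set X) :
  (forall i, measurable (A i)) ->
  pr (\big[setU/set0]_(i <- r | P i) A i) <= \sum_(i <- r | P i) pr (A i).
Proof.
move=> mA; elim: r => [|i r IH]; first by rewrite !big_nil /pr measure0.
rewrite !big_cons; case: ifP => // _.
apply: (le_trans (prU_le (mA i) _)); last by rewrite lerD2l.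
exact: bigsetU_measurable.
Qed.

Lemma pr_setT : pr setT = 1.
Proof. by rewrite /pr probability_setT. Qed.

Lemma pr_le1 A : measurable A -> pr A <= 1.
Proof. by move=> mA; rewrite -pr_setT; apply: pr_le. Qed.

Lemma pr_setC A : measurable A -> pr (~` A) = 1 - pr A.
Proof.
move=> mA; apply: EFin_inj; rewrite -prE; last exact: measurableC.
by rewrite probability_setC // prE // EFinB.
Qed.

End ProbabilityBounds.

Section Tiling.
Context {R : realType} {d} {X : measurableType d} {mu : probability X R}.
Context {G : groupType} (alpha : pmp_action mu G).
Local Notation pr := (pr mu).
Implicit Types (K : {fset G}) (T : G -> set X) (S : seq G).

(** T encodes a partial labelling of X by elements of K, T g being the set of
    points labelled g. A point x labelled g belongs to the tile K a of its
    base point a = g^-1 x. Where all is well s x is labelled s g, and x and s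
    x belong to the same tile. *)
Definition is_tiling K T := [/\ forall g, measurable (T g),
  forall g x, T g x -> g \in K & forall g h x, T g x -> T h x -> g = h].

Definition tdom T := [set x | exists g, T g x].

Definition broken T s := [set x | ~ exists g, T g x /\ T (s * g)%g (alpha s x)].

(** Only those points x of broken T s are counted for which x or s x has a
    label: where neither has one, the labels can still be chosen well. *)
Definition cut T s := broken T s `&` (tdom T `|` alpha s @^-1` tdom T).

Lemma tdomE K T : is_tiling K T -> tdom T = \big[setU/set0]_(g <- K) T g.
Proof.
move=> [_ TK _]; rewrite -bigcup_seq; apply/seteqP; split=> x.
  by move=> [g Tg]; exists g => //; exact: TK Tg.
by move=> [g _ Tg]; exists g.
Qed.

Lemma measurable_tdom K T : is_tiling K T -> measurable (tdom T).
Proof. by move=> tT; rewrite (tdomE tT); apply: bigsetU_measurable => g _; case: tT. Qed.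

Lemma measurable_broken K T s : is_tiling K T -> measurable (broken T s).
Proof.
move=> [mT TK _]; apply: measurableC.
rewrite [X in measurable X](_ : _ =
  \big[setU/set0]_(g <- K) (T g `&` alpha s @^-1` T (s * g)%g)).
  apply: bigsetU_measurable => g _; apply: measurableI => //.
  exact: measurable_translate.
rewrite -bigcup_seq; apply/seteqP; split=> x.
  by move=> [g [Tg Tsg]]; exists g => //; exact: TK Tg.
by move=> [g _ [Tg Tsg]]; exists g.
Qed.

Lemma measurable_cut K T s : is_tiling K T -> measurable (cut T s).
Proof.
move=> tT; apply: measurableI; first exact: measurable_broken tT.
have mD := measurable_tdom tT.
by apply: measurableU => //; exact: measurable_translate.
Qed.

Section Step.
Context (std : standard_action alpha).
Context (K : {fset G}) (S : seq G) (delta : R).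
Context (K0 : K != fset0).
Context (delta0 : 0 < delta).
Context (SV : forall F : G -> R, \sum_(s <- S) F s^-1%g = \sum_(s <- S) F s).
Context (folnerK :
  \sum_(s <- S) \sum_(g <- K) ((s * g)%g \notin K)%:R <= delta / 2 * #|` K|%:R).

(* The translates by K of a set that is independent for L are disjoint. *)
Let L := [seq (g^-1 * h)%g | g <- K, h <- K].

Let K_gt0 : 0 < #|` K|%:R :> R.
Proof. by rewrite ltr0n cardfs_gt0. Qed.

Definition gain_rate : R := (2 * (size L)%:R)^-1.

Lemma gain_rate_gt0 : 0 < gain_rate.
Proof.
by rewrite /gain_rate invr_gt0 mulr_gt0 // ltr0n size_allpairs muln_gt0 cardfs_gt0 K0.
Qed.

Let L1 : 1%g \in L.
Proof.
have [k kK] : exists k, k \in K by apply/fset0Pn.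
by apply/allpairsP; exists (k, k); rewrite mulVg.
Qed.

Let LV g : g \in L -> g^-1%g \in L.
Proof.
move=> /allpairsP[[a b] /= [aK bK ->]]; apply/allpairsP; exists (b, a).
by rewrite invgM invgK.
Qed.

Context (T : G -> set X) (tT : is_tiling K T).

Let N := ~` tdom T.
Let mN : measurable N.
Proof. by apply: measurableC; exact: measurable_tdom tT. Qed.
Let Nt g := alpha g @^-1` N.
Let mNt g : measurable (Nt g).
Proof. exact: measurable_translate. Qed.
Let prNt g : pr (Nt g) = pr N.
Proof. exact: pr_translate. Qed.
Let C s g := Nt g `&` Nt (s * g)%g.
Let mC s g : measurable (C s g).
Proof. exact: measurableI. Qed.

Let bd := [seq x <- [seq (s, g) | s <- S, g <- K] | (x.1 * x.2)%g \notin K].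

Let sum_bd (F : G -> G -> R) : \sum_(x <- bd) F x.1 x.2 =
  \sum_(s <- S) \sum_(g <- K | (s * g)%g \notin K) F s g.
Proof.
rewrite /bd big_filter big_mkcond big_allpairs /=; apply: eq_bigr => s _.
by rewrite -big_mkcond.
Qed.

(* A tile with base point a would cover n a new points, and it would break the
   tiling at e a pairs of new points. *)
Let n a : R := \sum_(g <- K) (a \in Nt g)%:R.
Let e a : R := \sum_(x <- bd) (a \in C x.1 x.2)%:R.
Let good := [set a | (1 <= n a) && (e a <= delta * n a)].

Let mgood : measurable good.
Proof.
have mn : measurable_fun setT n.
  by apply: measurable_sum => g; exact: measurable_indic.
have me : measurable_fun setT e.
  by apply: measurable_sum => x; exact: measurable_indic.
rewrite (_ : good = setT `&` (fun a => (1 <= n a) && (e a <= delta * n a)) @^-1` [set true]).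
  apply: measurable_and => //; apply: measurable_fun_ler => //.
  exact: measurable_funM.
by rewrite setTI.
Qed.

(** Integrating: n has integral #|K| pr N, and e has at most delta / 2 times
    this integral by the Folner property. Outside the good points delta n <=
    e, and n <= #|K| everywhere. *)
Let pr_good : pr N / 2 <= pr good.
Proof.
have h : \sum_(g <- K) delta * pr (Nt g) <=
    \sum_(j <- Datatypes.None :: map Datatypes.Some bd)
      (if j is Datatypes.Some _ then 1 else delta * #|` K|%:R) *
      pr (if j is Datatypes.Some x then C x.1 x.2 else good).
  apply: counting_le => //.
  - by move=> _; exact: ltW.
  - by case=> // ; rewrite mulr_ge0 // ltW.
  - by case.
  apply: aeW => a; rewrite big_cons big_map -mulr_sumr -/(n a).
  under eq_bigr do rewrite mul1r.
  rewrite -/(e a); have e0 : 0 <= e a by apply: sumr_ge0.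
  have nK : n a <= #|` K|%:R.
    rewrite -sum1_size natr_sum; apply: ler_sum => g _.
    by case: (a \in Nt g).
  have [|] := boolP (a \in good).
    move=> _; rewrite mulr1; apply: ler_wpDr => //.
    by rewrite ler_pM2l.
  rewrite notin_setE /good /= => /negP; rewrite negb_and -!ltNge mulr0 add0r.
  move=> /orP[|/ltW //]; have -> : n a = (\sum_(g <- K) (a \in Nt g))%N%:R.
    by rewrite natr_sum.
  by rewrite (ltr_nat R _ 1) ltnS leqn0 => /eqP ->; rewrite mulr0.
move: h; rewrite big_cons big_map (eq_bigr (fun=> delta * pr N)) => [|g _]; last first.
  by rewrite prNt.
rewrite big_const_seq count_predT iter_addr_0 => h.
have hbd : \sum_(x <- bd) 1 * pr (C x.1 x.2) <= delta / 2 * #|` K|%:R * pr N.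
  apply: le_trans (_ : \sum_(x <- bd) pr N <= _).
    by apply: ler_sum => x _; rewrite mul1r -[leRHS](prNt x.2); apply: pr_le => //; exact: subIsetl.
  rewrite (sum_bd (fun _ _ => pr N)); apply: le_trans (ler_wpM2r (pr_ge0 mu N) folnerK).
  rewrite mulr_suml; apply: ler_sum => s _; rewrite big_mkcond mulr_suml.
  by apply: ler_sum => g _; case: ifP; rewrite ?mul1r ?mul0r.
have {h} h := le_trans h (lerD (lexx _) hbd).
have h2 : (delta * #|` K|%:R) * (pr N / 2) <= (delta * #|` K|%:R) * pr good.
  by move: h; rewrite -mulr_natr; lra.
by move: h2; rewrite ler_pM2l // mulr_gt0.
Qed.

(** New tiles are put at an independent set of good base points of measure at
    least pr good / size L, each reduced to its points without a label. They
    are not empty, which gives the growth of the domain. The tile at a creates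
    at most e a cuts for the elements of S and as many for their inverses, and
    e a is at most delta times the number of points of this tile. *)
Lemma tiling_step : exists T', [/\ is_tiling K T',
  pr (tdom T) + gain_rate * (1 - pr (tdom T)) <= pr (tdom T') &
  \sum_(s <- S) pr (cut T' s) - 2 * delta * pr (tdom T') <=
  \sum_(s <- S) pr (cut T s) - 2 * delta * pr (tdom T)].
Proof.
have [E [mE Egood iE prE]] := independent_subset std mgood L1 LV.
have uE g h x : g \in K -> h \in K -> E (alpha g^-1%g x) -> E (alpha h^-1%g x) -> g = h.
  move=> gK hK Eg Eh; rewrite -[g](mulVKg h) (_ : (h^-1 * g)%g = 1%g) ?mulg1 //.
  apply: (iE (alpha g^-1%g x)) => //; last by rewrite -pactM mulgK.
  by apply/allpairsP; exists (h, g).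
pose M g := if g \in K then N `&` alpha g^-1%g @^-1` E else set0.
have mM g : measurable (M g).
  rewrite /M; case: ifP => // _; apply: measurableI => //; exact: measurable_translate.
pose T' g := T g `|` M g.
have tT' : is_tiling K T'.
  case: tT => mT TK Td; split=> [g|g x [/TK//|]|g h x].
  - exact: measurableU.
  - by rewrite /M; case: ifP.
  - rewrite /T' /M => -[Tg|Mg] [Th|Mh].
    + exact: Td Tg Th.
    + by move: Mh; case: ifP => // _ [nT _]; case: nT; exists g.
    + by move: Mg; case: ifP => // _ [nT _]; case: nT; exists h.
    + move: Mg Mh; case: ifP => // gK [_ Eg]; case: ifP => // hK [_ Eh].
      exact: uE Eg Eh.
pose A g := E `&` Nt g.
have mA g : measurable (A g) by apply: measurableI.
pose gain := \sum_(g <- K) pr (A g).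
have gE : pr E <= gain.
  have := @counting_le _ _ _ mu unit G [:: tt] K (fun=> 1) (fun=> 1) (fun=> E) A.
  rewrite big_seq1 mul1r; under eq_bigr do rewrite mul1r.
  apply=> //; apply: aeW => a; rewrite big_seq1 mul1r.
  under eq_bigr do rewrite mul1r.
  have [aE|_] := boolP (a \in E); last exact: sumr_ge0.
  have /andP[na _] := Egood _ (set_mem aE).
  apply: le_trans na _; apply: ler_sum => g _.
  by rewrite /A in_setI aE.
have gC : \sum_(x <- bd) pr (E `&` C x.1 x.2) <= delta * gain.
  rewrite mulr_sumr; under eq_bigr do rewrite -[pr _]mul1r.
  apply: counting_le => //; first by move=> _; exact: ltW.
    by move=> x; apply: measurableI.
  apply: aeW => a; rewrite -!mulr_sumr mul1r; under eq_bigr do rewrite in_setI.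
  under [in leRHS]eq_bigr do rewrite in_setI.
  have [aE|_] := boolP (a \in E); last by rewrite !big1 // mulr0.
  by have /andP[_] := Egood _ (set_mem aE).
have gT : pr (tdom T) + gain <= pr (tdom T').
  have MA g : g \in K -> pr (A g) = pr (M g).
    move=> gK; rewrite -(pr_translate alpha g^-1%g (mA g)); congr pr.
    rewrite /M gK /A /Nt; apply/seteqP; split=> x /=; last first.
      by move=> [Nx Ex]; split=> //; rewrite -pactM mulgV pact1.
    by move=> [Ex]; rewrite -pactM mulgV pact1.
  have -> : pr (tdom T) + gain = \sum_(j <- Datatypes.None :: map Datatypes.Some K)
      1 * pr (if j is Datatypes.Some g then M g else tdom T).
    rewrite big_cons big_map mul1r; congr (_ + _).
    by rewrite /gain big_seq [RHS]big_seq; apply: eq_bigr => g /MA ->; rewrite mul1r.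
  have -> : pr (tdom T') = \sum_(j <- [:: tt]) 1 * pr (tdom T').
    by rewrite big_seq1 mul1r.
  apply: counting_le => //.
  - by case=> [g|] //; exact: measurable_tdom tT.
  - by move=> _; exact: measurable_tdom tT'.
  apply: aeW => x; rewrite big_seq1 big_cons big_map !mul1r.
  under eq_bigr do rewrite mul1r.
  have [xT|xT] := boolP (x \in tdom T).
    have [g Tg] := set_mem xT.
    rewrite big1 ?addr0 => [|h _].
      have T'x : tdom T' x by exists g; left.
      by rewrite (mem_set T'x) lexx.
    rewrite memNset //; rewrite /M; case: ifP => [hK [nT _]|_ []].
    by apply: nT; exists g.
  rewrite add0r; have [[g Mg]|nM] := pselect (exists g, M g x).
    have T'x : tdom T' x by exists g; right.
    rewrite (mem_set T'x).
    have gK : g \in K by move: Mg; rewrite /M; case: ifP.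
    rewrite (big_fsetD1 g) //= (mem_set Mg) big_seq big1 ?addr0 // => h.
    rewrite !inE => /andP[hg hK]; rewrite memNset //; move: Mg.
    rewrite /M gK hK => -[_ Eg] [_ Eh].
    by move: hg; rewrite (uE _ _ _ hK gK Eh Eg) eqxx.
  rewrite big1 // => g _; rewrite memNset // => Mg; apply: nM; by exists g.
have cT s : pr (cut T' s) <= pr (cut T s) +
    \sum_(g <- K | (s * g)%g \notin K) pr (E `&` C s g) +
    \sum_(g <- K | (s^-1 * g)%g \notin K) pr (E `&` C s^-1%g g).
  have mEC s' g : measurable (E `&` C s' g) by apply: measurableI.
  pose V := \big[setU/set0]_(g <- K | (s * g)%g \notin K)
    (alpha g^-1%g @^-1` (E `&` C s g)).
  pose W := \big[setU/set0]_(g <- K | (s^-1 * g)%g \notin K)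
    (alpha (g^-1 * s)%g @^-1` (E `&` C s^-1%g g)).
  have mV : measurable V.
    by apply: bigsetU_measurable => g _; apply: measurable_translate.
  have mW : measurable W.
    by apply: bigsetU_measurable => g _; apply: measurable_translate.
  have mc := measurable_cut s tT.
  apply: (@le_trans _ _ (pr (cut T s) + pr V + pr W)); last first.
    rewrite -!addrA lerD2l; apply: lerD.
      apply: le_trans (pr_bigsetU_le _ _ _ _) _.
        by move=> g; apply: measurable_translate.
      by apply: ler_sum => g _; rewrite pr_translate.
    apply: le_trans (pr_bigsetU_le _ _ _ _) _.
      by move=> g; apply: measurable_translate.
    by apply: ler_sum => g _; rewrite pr_translate.
  apply: (@le_trans _ _ (pr (cut T s `|` V `|` W))); last first.
    apply: le_trans (prU_le _ _ mW) _; first exact: measurableU.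
    by rewrite lerD2r; apply: prU_le.
  apply: pr_le; first exact: measurable_cut tT'.
    by apply: measurableU => //; apply: measurableU.
  move=> x [brk' dx].
  have [old|new] := pselect (tdom T x \/ tdom T (alpha s x)).
    left; left; split=> // -[g [Tg Tsg]]; apply: brk'.
    by exists g; split; left.
  have Nx : N x by move=> ?; apply: new; left.
  have Nsx : N (alpha s x) by move=> ?; apply: new; right.
  case: dx => -[g [Tg|Mg]].
  - by case: Nx; exists g.
  - move: Mg; rewrite /M; case: ifP => // gK [_ Eg]; left; right.
    rewrite /V -bigcup_seq_cond; exists g; last first.
      by split=> //; split; rewrite /Nt /= -pactM ?mulgV ?pact1 // mulgK.
    rewrite /= gK /=; apply/negP => sgK; apply: brk'; exists g; split; right.
      by rewrite /M gK.
    by rewrite /M sgK; split=> //=; rewrite -pactM invgM mulgVK.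
  - by case: Nsx; exists g.
  - move: Mg; rewrite /M; case: ifP => // gK [_ Eg]; right.
    rewrite /W -bigcup_seq_cond; exists g; last first.
      split=> /=; first by rewrite pactM.
      split; rewrite /Nt /= -!pactM; first by rewrite mulgA mulgV mul1g.
      by rewrite !mulgA mulgK mulVg pact1.
    rewrite /= gK /=; apply/negP => sgK; apply: brk'; exists (s^-1 * g)%g.
    rewrite mulgA mulgV mul1g; split; right; last by rewrite /M gK.
    by rewrite /M sgK; split=> //=; rewrite invgM invgK pactM.
exists T'; split=> //.
  apply: le_trans gT; rewrite lerD2l; apply: le_trans gE.
  have := le_trans pr_good prE; rewrite {1}/N pr_setC; last exact: measurable_tdom tT.
  have L0 : 0 < (size L)%:R :> R.
    by rewrite ltr0n size_allpairs muln_gt0 cardfs_gt0 K0.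
  by rewrite /gain_rate => h; rewrite ler_pdivrMl ?mulr_gt0 //; lra.
have := @ler_sum R G S xpredT _ _ (fun s _ => cT s).
rewrite !big_split /= -(sum_bd (fun s g => pr (E `&` C s g))).
rewrite (SV (fun s => \sum_(g <- K | (s * g)%g \notin K) pr (E `&` C s g))).
rewrite -(sum_bd (fun s g => pr (E `&` C s g))) => h.
have := ler_wpM2l (ltW delta0) gT.
by move: gC h; lra.
Qed.

End Step.
End Tiling.

Section TilingTheorem.
Context {R : realType} {d} {X : measurableType d} {mu : probability X R}.
Context {G : groupType} (alpha : pmp_action mu G).
Local Notation pr := (pr mu).
Context (std : standard_action alpha).
Context (amenG : amenable R G).

Lemma is_tiling0 (K : {fset G}) : is_tiling K (fun=> set0 : set X).
Proof. by split=> // g; exact: measurable0. Qed.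

(** The measure of the domain grows by a definite amount in each tiling_step
    until at most eta is missing. The remaining points get the label 1, which
    at worst breaks the tiling at all of them. *)
Lemma tiling (S : seq G) (eps : R) : 0 < eps ->
  exists (K : {fset G}) T, [/\ is_tiling K T, forall x, tdom T x &
    \sum_(s <- S) pr (broken alpha T s) <= eps].
Proof.
move=> eps0.
(* A tile cuts at s and at the inverse of s, so that S has to be symmetrized. *)
pose S2 := S ++ map (fun s => s^-1)%g S.
have SV (F : G -> R) : \sum_(s <- S2) F s^-1%g = \sum_(s <- S2) F s.
  rewrite /S2 !big_cat /= !big_map addrC; congr (_ + _).
  by apply: eq_bigr => s _; rewrite invgK.
pose delta := eps / 4; have delta0 : 0 < delta by rewrite divr_gt0.
have [K [K0 folnerK]] := folner S2 amenG (divr_gt0 delta0 (ltr0Sn _ 1)).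
pose eta := eps / 2 / (size S).+1%:R.
have eta0 : 0 < eta by rewrite !divr_gt0.
pose c := @gain_rate R G K; have c0 : 0 < c by exact: gain_rate_gt0.
have iter N : exists T, [/\ is_tiling K T,
    \sum_(s <- S2) pr (cut alpha T s) - 2 * delta * pr (tdom T) <= 0 &
    1 - pr (tdom T) <= eta \/ N%:R * (c * eta) <= pr (tdom T)].
  elim: N => [|N [T [tT cutT growT]]].
    exists (fun=> set0); split; [exact: is_tiling0| |by right; rewrite mul0r pr_ge0].
    rewrite big1 => [|s _]; first by rewrite sub0r oppr_le0 mulr_ge0 ?pr_ge0 ?mulr_ge0 // ltW.
    rewrite (_ : cut _ _ _ = set0) ?/pr ?measure0 //.
    by apply/seteqP; split=> // x [_ [[]|[]]].
  have [small|big] := leP (1 - pr (tdom T)) eta; first by exists T; split=> //; left.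
  have [T' [tT' growT' cutT']] := tiling_step std K0 delta0 SV folnerK tT.
  exists T'; split=> //; first exact: le_trans cutT' cutT.
  right; case: growT => [|growT]; first by rewrite leNgt big.
  apply: le_trans growT'; rewrite -addn1 natrD mulrDl mul1r; apply: lerD => //.
  by rewrite ler_pM2l // ltW.
have [T [tT cutT small]] : exists T, [/\ is_tiling K T,
    \sum_(s <- S2) pr (cut alpha T s) - 2 * delta * pr (tdom T) <= 0 &
    1 - pr (tdom T) <= eta].
  have ce0 : 0 < c * eta by rewrite mulr_gt0.
  have /archi_boundP : 0 <= (c * eta)^-1 by rewrite invr_ge0 ltW.
  set N := Num.bound _ => hN; have [T [tT cutT [small|big]]] := iter N.
    by exists T.
  have := le_trans big (pr_le1 mu (measurable_tdom tT)).
  by rewrite leNgt -ltr_pdivrMr // div1r hN.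
have mD := measurable_tdom tT.
pose T' g := T g `|` (if g == 1%g then ~` tdom T else set0).
have tT' : is_tiling (1%g |` K)%fset T'.
  case: tT => mT TK Td; split=> [g|g x|g h x].
  - by apply: measurableU => //; case: ifP => // _; exact: measurableC.
  - by rewrite !inE => -[/TK ->|]; rewrite ?orbT //; case: ifP.
  - move=> [Tg|Mg] [Th|Mh]; first exact: Td Tg Th.
    + by move: Mh; case: ifP => // _ []; exists g.
    + by move: Mg; case: ifP => // _ []; exists h.
    + by move: Mg Mh; case: eqP => // -> _; case: eqP.
exists (1%g |` K)%fset, T'; split=> // [x|].
  have [[g Tg]|nT] := pselect (tdom T x); first by exists g; left.
  by exists 1%g; right; rewrite eqxx.
have brk s : pr (broken alpha T' s) <= pr (cut alpha T s) + pr (~` tdom T).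
  have mc := measurable_cut alpha s tT; have mN : measurable (~` tdom T) by exact: measurableC.
  apply: le_trans (prU_le mu mc mN); apply: pr_le.
  - exact: measurable_broken tT'.
  - exact: measurableU.
  move=> x br; have [Tx|nT] := pselect (tdom T x); last by right.
  left; split; last by left.
  by move=> [g [Tg Tsg]]; apply: br; exists g; split; left.
apply: (le_trans (ler_sum _ (fun s _ => brk s))); rewrite big_split /=.
have h1 : \sum_(s <- S) pr (cut alpha T s) <= 2 * delta.
  apply: (@le_trans _ _ (\sum_(s <- S2) pr (cut alpha T s))).
    by rewrite /S2 big_cat /= lerDl; apply: sumr_ge0 => s _; exact: pr_ge0.
  have := ler_wpM2l (ltW delta0) (pr_le1 mu mD); lra.
have h2 : \sum_(s <- S) pr (~` tdom T) <= eps / 2.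
  rewrite pr_setC // big_const_seq count_predT iter_addr_0 -(mulr_natr (1 - _)).
  apply: (le_trans (ler_wpM2r (ler0n R (size S)) small)).
  by rewrite /eta mulrAC ler_pdivrMr // ler_pM2l ?divr_gt0 // ler_nat.
by move: h1; rewrite /delta; lra.
Qed.

Lemma sum_tiling_le (K : {fset G}) T B : is_tiling K T -> measurable B ->
  \sum_(g <- K) pr (T g `&` B) <= pr B.
Proof.
move=> [mT TK Td] mB.
have := @counting_le _ _ _ mu G unit K [:: tt] (fun=> 1) (fun=> 1) (fun g => T g `&` B) (fun=> B).
rewrite big_seq1 mul1r; under eq_bigr do rewrite mul1r.
apply=> //; first by move=> g; exact: measurableI.
apply: aeW => x; rewrite big_seq1 mul1r; under eq_bigr do rewrite mul1r.
have [[g [Tg Bx]]|nT] := pselect (exists g, (T g `&` B) x); last first.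
  rewrite big1 // => g _; rewrite memNset // => TBg; apply: nT; by exists g.
rewrite (big_fsetD1 g) /=; last exact: TK Tg.
rewrite (mem_set Bx) big1_seq ?addr0 => [|h]; first by case: (_ \in _).
rewrite !inE /= => /andP[hg _]; rewrite memNset // => -[Th _].
by move: hg; rewrite (Td _ _ _ Th Tg) eqxx.
Qed.

(** A is the set of base points. Let g a be a point labelled g that is not
    broken at any s in S0; then the points s g a, in number M, lie over the
    same base point a. Since every point has one base point, M pr A is at most
    1 plus M times the measure of the broken points, with M large since the
    group is infinite. *)
Lemma sparse_tiling (S : seq G) (eps : R) : infinite_set [set: G] -> 0 < eps ->
  exists (K : {fset G}) T A, [/\ is_tiling K T, forall x, tdom T x,
    \sum_(s <- S) pr (broken alpha T s) <= eps,
    measurable A /\ pr A <= eps &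
    forall g x, T g x -> A (alpha g^-1%g x)].
Proof.
move=> infG eps0; have e20 : 0 < eps / 2 by rewrite divr_gt0.
have /archi_boundP : 0 <= (eps / 2)^-1 by rewrite invr_ge0 ltW.
set M := Num.bound _ => hM.
have M0 : 0 < M%:R :> R by apply: le_lt_trans hM; rewrite invr_ge0 ltW.
have [S0 _ MS0] := infinite_set_fset M infG.
have [K [T [tT dT brT]]] := tiling (S ++ S0) e20.
have [mT TK Td] := tT.
have brS : \sum_(s <- S) pr (broken alpha T s) <= eps / 2 /\
    \sum_(s <- S0) pr (broken alpha T s) <= eps / 2.
  move: brT; rewrite big_cat /=.
  have : 0 <= \sum_(s <- S) pr (broken alpha T s) by apply: sumr_ge0 => s _; exact: pr_ge0.
  have : 0 <= \sum_(s <- S0) pr (broken alpha T s) by apply: sumr_ge0 => s _; exact: pr_ge0.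
  by split; lra.
pose A := \big[setU/set0]_(g <- K) (alpha g @^-1` T g).
have AP x : A x <-> exists g, T g (alpha g x).
  rewrite /A -bigcup_seq; split=> [[g _ Tg]|[g Tg]]; exists g => //; exact: TK Tg.
have mA : measurable A.
  by apply: bigsetU_measurable => g _; exact: measurable_translate.
have mb s : measurable (broken alpha T s) by exact: measurable_broken tT.
exists K, T, A; split=> //; first by case: brS; lra.
  split=> //.
  have h : \sum_(t <- [:: tt]) M%:R * pr A <=
    \sum_(j <- map inl K ++ map inr [seq (s, g) | s <- S0, g <- K])
      (if j is inl _ then 1 else M%:R) *
      pr (match j with inl g => alpha g @^-1` T g
          | inr x => alpha x.2 @^-1` (T x.2 `&` broken alpha T x.1) end).
    apply: counting_le => //.
    - by case.
    - case=> [g|[s g]]; apply: measurable_translate => //; exact: measurableI.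
    apply: aeW => a; rewrite big_seq1 big_cat !big_map /=.
    have [aA|_] := boolP (a \in A); last first.
      by rewrite mulr0 addr_ge0 // sumr_ge0.
    have [g Tg] := (AP a).1 (set_mem aA); rewrite mulr1.
    have [[s [sS0 bs]]|nb] := pselect (exists s, s \in S0 /\ broken alpha T s (alpha g a)).
      rewrite addrC; apply: ler_wpDr; first by apply: sumr_ge0 => h _; rewrite mul1r.
      have gs : (s, g) \in [seq (s, g) | s <- S0, g <- K].
        by apply/allpairsP; exists (s, g); split=> //; exact: TK Tg.
      rewrite (big_rem _ gs) /= mem_set // mulr1 lerDl.
      by apply: sumr_ge0.
    apply: ler_wpDr; first by apply: sumr_ge0.
    apply: (@le_trans _ _ (size S0)%:R); first by rewrite ler_nat.
    have sK s : s \in S0 -> T (s * g)%g (alpha (s * g)%g a).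
      move=> sS0; have [h [Th Tsh]] : exists h, T h (alpha g a) /\ T (s * h)%g (alpha s (alpha g a)).
        by apply: contrapT => ns; apply: nb; exists s.
      by move: Tsh; rewrite -(Td _ _ _ Tg Th) -pactM.
    pose r := [seq (s * g)%g | s <- S0].
    have ur : uniq r by rewrite map_inj_uniq ?fset_uniq //; exact: mulIg.
    rewrite -(size_map (fun s => s * g)%g S0) -/r -sum1_size natr_sum.
    rewrite (eq_big_seq (fun h => 1 * (a \in alpha h @^-1` T h)%:R)); last first.
      by move=> _ /mapP[s sS0 ->]; rewrite mul1r mem_set //; exact: sK.
    have rK : {subset r <= K}.
      by move=> _ /mapP[s /sK /TK sgK ->].
    rewrite [leRHS](bigID (mem r)) /=.
    rewrite -[X in _ <= X + _]big_filter.
    rewrite (@perm_big _ _ _ _ [seq i <- K | i \in r] r) ?lerDl //.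
      by apply: sumr_ge0.
    apply: uniq_perm => //; first by rewrite filter_uniq // fset_uniq.
    by move=> x; rewrite mem_filter andb_idr // => /rK.
  move: h; rewrite big_seq1 big_cat !big_map big_allpairs /=.
  have -> : \sum_(g <- K) 1 * pr (alpha g @^-1` T g) = \sum_(g <- K) pr (T g `&` setT).
    by apply: eq_bigr => g _; rewrite mul1r setIT pr_translate.
  have -> : \sum_(s <- S0) \sum_(g <- K) M%:R * pr (alpha g @^-1` (T g `&` broken alpha T s)) =
      M%:R * \sum_(s <- S0) \sum_(g <- K) pr (T g `&` broken alpha T s).
    rewrite mulr_sumr; apply: eq_bigr => s _; rewrite mulr_sumr; apply: eq_bigr => g _.
    by rewrite pr_translate //; exact: measurableI.
  move=> h; have {}h : M%:R * pr A <= 1 + M%:R * (eps / 2).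
    apply: (le_trans h); apply: lerD.
      by rewrite -(pr_setT mu); apply: sum_tiling_le.
    rewrite ler_pM2l //; apply: le_trans brS.2; apply: ler_sum => s _.
    exact: sum_tiling_le.
  have h1 : 1 <= M%:R * (eps / 2) by rewrite -ler_pdivrMr // div1r ltW.
  by rewrite -(ler_pM2l M0); lra.
by move=> g x Tg; apply/AP; exists g; rewrite -pactM mulgV pact1.
Qed.

End TilingTheorem.

(** * The crossed product ring *)

Lemma additive0 (V W : zmodType) (f : V -> W) : {morph f : x y / x + y} -> f 0 = 0.
Proof. by move=> fD; apply: (addIr (f 0)); rewrite -fD addr0 add0r. Qed.

Section FinitelySupportedSums.
Context {G : choiceType} {A : zmodType}.
Implicit Types (x y : malg G A).

Lemma malg_ind (P : malg G A -> Prop) :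
  P 0 -> (forall x y, P x -> P y -> P (x + y)) ->
  (forall a g, P << a *g g >>) -> forall x, P x.
Proof.
by move=> P0 PD PU x; rewrite [x]monalg.monalgE; elim/big_ind : _ => // g _; exact: PU.
Qed.

Context {V : zmodType} (h : G -> A -> V).
Context (hD : forall g, {morph h g : a b / a + b}).

(** The additive map with value h g a at the monomial of coefficient a at g. *)
Definition msum x : V := \sum_(g <- msupp x) h g x@_g.

Let h0 g : h g 0 = 0.
Proof. exact: additive0 (hD g). Qed.

Lemma msumw (D : {fset G}) x : (msupp x `<=` D)%fset ->
  msum x = \sum_(g <- D) h g x@_g.
Proof.
move=> xD; rewrite /msum (big_fset_incl _ xD) //=.
by move=> g _ /monalg.mcoeff_outdom ->; rewrite h0.
Qed.

Lemma msumD : {morph msum : x y / x + y}.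
Proof.
move=> x y /=; rewrite (msumw (fsubsetUl (msupp x) (msupp y))).
rewrite (msumw (fsubsetUr (msupp x) (msupp y))).
rewrite (msumw (monalg.msuppD_le _ _)) -big_split /=.
by apply/eq_bigr => g _; rewrite monalg.mcoeffD hD.
Qed.

Lemma msum0 : msum 0 = 0.
Proof. by rewrite /msum monalg.msupp0 big_seq_fset0. Qed.

Lemma msumU a g : msum << a *g g >> = h g a.
Proof. by rewrite (msumw monalg.msuppU_le) big_seq_fset1 monalg.mcoeffUU. Qed.

End FinitelySupportedSums.

(* Unification would otherwise compare products in the crossed product by
   unfolding them, which is prohibitively slow. *)
#[local] Opaque skew_mul skew_scale skew_map Linf_act.

Lemma gr_scaleU (G : groupType) (A : comNzRingType) (a : A) (g : G) (z : trivial_mod G A) :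
  (<< a *g g >> : group_ring G A) *: z = (a * z : A).
Proof. exact: skew_scaleU. Qed.

Section CrossedProduct.
Context {R : realType} {d} {X : measurableType d} {mu : probability X R}.
Context {G : groupType} (alpha : pmp_action mu G) (Z : coef).
Local Notation CP := (crossed_product alpha Z).
Local Notation ZG := (group_ring G (coef_ring Z)).
Local Notation incl := (group_ring_incl alpha (Z := Z)).
Local Notation mon l g := (<< l *g g >> : CP).
Local Notation chi mA := (cp_indic alpha Z mA).
Implicit Types (x y : CP) (l : Linf mu Z) (g h : G).

Lemma cp_ind (P : CP -> Prop) :
  P 0 -> (forall x y, P x -> P y -> P (x + y)) ->
  (forall l g, P (mon l g)) -> forall x, P x.
Proof. exact: malg_ind. Qed.

Lemma monM l m g h : mon l g * mon m h = mon (l * Linf_act alpha g m) (g * h)%g.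
Proof. exact: skewUU. Qed.

Lemma mon_split l g : mon l g = mon l 1%g * mon 1 g.
Proof. by rewrite monM mul1g rmorph1 mulr1. Qed.

Lemma Linf_indic_ext (A B : set X) (mA : measurable A) (mB : measurable B) :
  A = B -> Linf_indic mu Z mA = Linf_indic mu Z mB.
Proof. by move=> AB; subst B; congr Linf_indic; exact: Prop_irrelevance. Qed.

Lemma chi_ext (A B : set X) (mA : measurable A) (mB : measurable B) :
  A = B -> chi mA = chi mB.
Proof. by move=> AB; rewrite /cp_indic (Linf_indic_ext mA mB AB). Qed.

Lemma Linf_act_indic g (A : set X) (mA : measurable A)
    (mB : measurable (alpha g^-1%g @^-1` A)) :
  Linf_act alpha g (Linf_indic mu Z mA) = Linf_indic mu Z mB.
Proof.
by rewrite /Linf_indic Linf_act_pi; congr \pi; apply: val_inj; apply/funext => x.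
Qed.

Lemma Linf_indic0 (m0 : measurable set0) : Linf_indic mu Z m0 = 0.
Proof.
rewrite -(rmorph0 (\pi_(Linf mu Z))) /Linf_indic; congr \pi; apply: val_inj.
by apply/funext => x /=; rewrite indic0.
Qed.

Lemma chi0 (m0 : measurable set0) : chi m0 = 0.
Proof. by rewrite /cp_indic Linf_indic0 monalg.monalgU0. Qed.

Lemma chi_sub (A B : set X) (mA : measurable A) (mB : measurable B) :
  A `<=` B -> chi mA * chi mB = chi mA /\ chi mB * chi mA = chi mA.
Proof.
move=> AB; rewrite /cp_indic !monM !mulg1 !Linf_act1.
by rewrite [X in _ /\ << X *g _ >> = _]mulrC Linf_indicM.
Qed.

Lemma chiK (A : set X) (mA : measurable A) : chi mA * chi mA = chi mA.
Proof. by case: (chi_sub mA mA). Qed.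

Lemma mon_chi l g (A : set X) (mA : measurable A)
    (mB : measurable (alpha g^-1%g @^-1` A)) :
  mon l g * chi mA = chi mB * mon l g.
Proof.
by rewrite /cp_indic !monM mulg1 mul1g Linf_act1 (Linf_act_indic mA mB) mulrC.
Qed.

(** The indicator function of A depends on a proof that A is measurable;
    quantifying over it makes rewriting with equal sets possible. *)
Definition supp_in (A : set X) x := forall mA : measurable A, chi mA * x = x.

Lemma supp_inS (A B : set X) x : measurable A -> A `<=` B -> supp_in A x -> supp_in B x.
Proof.
by move=> mA AB xA mB; rewrite -(xA mA) mulrA (chi_sub mA mB AB).2.
Qed.

Lemma supp_inM A x y : supp_in A x -> supp_in A (x * y).
Proof. by move=> xA mA; rewrite mulrA xA. Qed.

Lemma supp_in_sum A I (r : seq I) (P : pred I) (F : I -> CP) :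
  (forall i, P i -> supp_in A (F i)) -> supp_in A (\sum_(i <- r | P i) F i).
Proof.
move=> FA mA; rewrite mulr_sumr; apply: eq_bigr => i Pi; exact: FA.
Qed.

Lemma supp_in_mon l g A x : measurable A -> supp_in A x ->
  supp_in (alpha g^-1%g @^-1` A) (mon l g * x).
Proof. by move=> mA xA mB; rewrite mulrA -(mon_chi l mA) -mulrA xA. Qed.

Lemma supp_in_scalar l A x : supp_in A x -> supp_in A (mon l 1%g * x).
Proof.
move=> xA mA; rewrite mulrA.
have -> : chi mA * mon l 1%g = mon l 1%g * chi mA.
  by rewrite /cp_indic !monM mulg1 !Linf_act1 mulrC.
by rewrite -mulrA xA.
Qed.

Lemma inclU (z : coef_ring Z) g : incl << z *g g >> = mon (Linf_cst mu Z z) g.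
Proof. exact: skew_mapU. Qed.

Lemma inclE (m : ZG) : incl m = \sum_(g <- msupp m) mon (Linf_cst mu Z m@_g) g.
Proof. by []. Qed.

Lemma cp_coefD x y h : (x + y)@_h = x@_h + y@_h.
Proof. exact: monalg.mcoeffD. Qed.

Lemma cp_coefU l g h : (mon l g)@_h = l *+ (g == h).
Proof. exact: monalg.mcoeffU. Qed.

Lemma cp_coef0 h : (0 : CP)@_h = 0.
Proof. exact: monalg.mcoeff0. Qed.

Lemma mcoeff_monM l g x h :
  (mon l g * x)@_h = l * Linf_act alpha g (x@_(g^-1 * h)%g).
Proof.
elim/cp_ind: x => [|x y IHx IHy|m k].
- by rewrite mulr0 !cp_coef0 rmorph0 mulr0.
- rewrite mulrDr !cp_coefD rmorphD mulrDr.
  exact: (congr2 +%R IHx IHy).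
- rewrite monM !cp_coefU.
  have -> : (g * k == h)%g = (k == g^-1 * h)%g.
    by apply/eqP/eqP => [<-|->]; rewrite ?mulKg ?mulVKg.
  by case: (_ == _); rewrite ?mulr1n ?mulr0n ?rmorph0 ?mulr0.
Qed.

Lemma cp_scale_mon l g (a : Linf_mod alpha Z) : mon l g *: a = l * Linf_act alpha g a.
Proof. exact: skew_scaleU. Qed.

Lemma Linf_act_cst g (z : coef_ring Z) : Linf_act alpha g (Linf_cst mu Z z) = Linf_cst mu Z z.
Proof. exact: (esym (Linf_cst_equivariant alpha g z)). Qed.

Lemma incl_scale_cst (m : ZG) (z : trivial_mod G (coef_ring Z)) :
  incl m *: (Linf_cst mu Z z : Linf_mod alpha Z) = Linf_cst mu Z (m *: z).
Proof.
move: m; apply: malg_ind => [|m n IHm IHn|a g].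
- by rewrite rmorph0 !scale0r rmorph0.
- by rewrite rmorphD !scalerDl IHm IHn rmorphD.
- by rewrite inclU cp_scale_mon Linf_act_cst -rmorphM gr_scaleU.
Qed.

End CrossedProduct.

(** * Bounds for right multiplications *)

Section LinfNorm.
Context {R : realType} {d} {X : measurableType d} (mu : probability X R) (Z : coef).
Local Notation Linf := (Linf mu Z).
Local Notation bfun := (bfun mu Z).
Local Notation pi := (\pi_Linf).
Local Notation nrm f x := ((coef_norm (bfun_val f x))%:R : R).

Lemma coef_norm1 : coef_norm (1 : coef_ring Z) = 1%N.
Proof. by case: Z => [|F] //=; rewrite oner_eq0. Qed.

Implicit Types (f g : bfun) (l m : Linf).

Lemma bfun_measurable f (h : coef_ring Z -> R) :
  measurable_fun setT (fun x => h (bfun_val f x)).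
Proof.
move=> _ B mB; rewrite setTI; have /asboolP[mf _] := valP f.
exact: (mf (h @^-1` B)).
Qed.

Lemma measurable_nrm f : measurable_fun setT (fun x => (nrm f x)%:E).
Proof. by apply/measurable_EFinP; exact: (bfun_measurable f (fun z => (coef_norm z)%:R)). Qed.

Lemma Linf_norm1E f : (Linf_norm1 (pi f))%:E = (\int[mu]_x (nrm f x)%:E)%E.
Proof.
have e : {ae mu, forall x, bfun_val (repr (pi f)) x = bfun_val f x}.
  by apply/LinfP; rewrite reprK.
have -> : (\int[mu]_x (nrm f x)%:E = \int[mu]_x (nrm (repr (pi f)) x)%:E)%E.
  apply: ge0_ae_eq_integral => //; try exact: measurable_nrm.
  by apply: filterS e => x -> _.
rewrite /Linf_norm1 fineK //; set g := repr _.
have /asboolP[_ [c gc]] := valP g.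
rewrite ge0_fin_numE; last by apply: integral_ge0 => x _; rewrite lee_fin.
apply: (@le_lt_trans _ _ (\int[mu]_x (cst (c%:R : R)%:E x))%E).
  apply: ae_ge0_le_integral => //; first exact: measurable_nrm.
    by move=> x _; rewrite lee_fin.
  by apply: filterS gc => x gx _; rewrite lee_fin ler_nat.
by rewrite integral_cst // [_ setT](probability_setT mu) mule1 ltry.
Qed.

Lemma Linf_norm1_le (I J : Type) (r : seq I) (s : seq J) (f : I -> bfun)
    (c : J -> R) (g : J -> bfun) : (forall j, 0 <= c j) ->
  (forall x, \sum_(i <- r) nrm (f i) x <= \sum_(j <- s) c j * nrm (g j) x) ->
  \sum_(i <- r) Linf_norm1 (pi (f i)) <= \sum_(j <- s) c j * Linf_norm1 (pi (g j)).
Proof.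
move=> c0 fg; rewrite -lee_fin -!sumEFin.
under eq_bigr do rewrite Linf_norm1E.
under [leRHS]eq_bigr do rewrite EFinM Linf_norm1E.
rewrite -ge0_integral_sum //; last by move=> i; exact: measurable_nrm.
have mc j : measurable_fun setT (fun x => ((c j)%:E * (nrm (g j) x)%:E)%E).
  by apply/measurable_EFinP; apply: measurable_funM => //;
    exact: (bfun_measurable (g j) (fun z => (coef_norm z)%:R)).
under [leRHS]eq_bigr => j _.
  rewrite -ge0_integralZl_EFin //; last exact: measurable_nrm.
  over.
rewrite -ge0_integral_sum //; last by move=> j x _; rewrite -EFinM lee_fin mulr_ge0.
apply: ge0_le_integral => //.
- by move=> x _; apply: sume_ge0.
- under eq_fun do rewrite sumEFin; apply/measurable_EFinP; apply: measurable_sum => i.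
  exact: (bfun_measurable (f i) (fun z => (coef_norm z)%:R)).
- under eq_fun => x do under eq_bigr do rewrite -EFinM.
  under eq_fun do rewrite sumEFin; apply/measurable_EFinP; apply: measurable_sum => j.
  apply: measurable_funM => //.
  exact: (bfun_measurable (g j) (fun z => (coef_norm z)%:R)).
by move=> x _; rewrite sumEFin; under [leRHS]eq_bigr do rewrite -EFinM; rewrite sumEFin lee_fin.
Qed.

Lemma Linf_norm1_ge0 l : 0 <= Linf_norm1 l.
Proof.
rewrite -[l]reprK -lee_fin Linf_norm1E.
by apply: integral_ge0 => x _; rewrite lee_fin.
Qed.

Lemma Linf_norm1_0 : Linf_norm1 (0 : Linf) = 0.
Proof.
rewrite -(rmorph0 (\pi_(Linf))); apply: EFin_inj; rewrite Linf_norm1E.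
by apply: integral0_eq => x _; rewrite coef_norm0.
Qed.

Lemma Linf_norm1D l m : Linf_norm1 (l + m) <= Linf_norm1 l + Linf_norm1 m.
Proof.
rewrite -[l]reprK -[m]reprK -rmorphD; set f := repr l; set g := repr m.
have := @Linf_norm1_le unit bool [:: tt] [:: true; false] (fun=> f + g) (fun=> 1)
  (fun b => if b then f else g).
rewrite big_seq1 !big_cons big_nil addr0 !mul1r; apply=> // x.
rewrite big_seq1 !big_cons big_nil addr0 !mul1r -natrD ler_nat.
exact: coef_normD.
Qed.

Lemma Linf_norm1_cst (z : coef_ring Z) l :
  Linf_norm1 (l * Linf_cst mu Z z) <= (coef_norm z)%:R * Linf_norm1 l.
Proof.
rewrite -[l]reprK /Linf_cst -rmorphM; set f := repr l.
have := @Linf_norm1_le unit unit [:: tt] [:: tt] (fun=> f * bfun_cst mu z)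
  (fun=> (coef_norm z)%:R) (fun=> f).
rewrite !big_seq1; apply=> // x.
by rewrite !big_seq1 -natrM ler_nat coef_normM mulnC.
Qed.

Lemma Linf_norm1_disjoint (I : eqType) (r : seq I) (A : I -> set X)
    (mA : forall i, measurable (A i)) l : uniq r ->
  (forall i j x, A i x -> A j x -> i = j) ->
  \sum_(i <- r) Linf_norm1 (l * Linf_indic mu Z (mA i)) <= Linf_norm1 l.
Proof.
move=> ur dA; rewrite -[l]reprK; set f := repr l.
have := @Linf_norm1_le I unit r [:: tt]
  (fun i => f * BFun (bfun_indic_subproof mu Z (mA i))) (fun=> 1) (fun=> f).
rewrite big_seq1 mul1r => h.
under eq_bigr do rewrite /Linf_indic -rmorphM.
apply: h => // x; rewrite big_seq1 mul1r.
have e i : nrm (f * BFun (bfun_indic_subproof mu Z (mA i))) x = nrm f x * (x \in A i)%:R.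
  rewrite -natrM; congr _%:R; rewrite [LHS]coef_normM /= indicE.
  by case: (x \in A i); rewrite ?muln0 ?muln1 ?mulr1n ?mulr0n ?coef_norm0 ?muln0 // coef_norm1 muln1.
under eq_bigr do rewrite e.
have [[i [ir Ai]]|nA] := pselect (exists i, i \in r /\ A i x); last first.
  rewrite big_seq big1 // => i ir; rewrite memNset ?mulr0 // => Ai; apply: nA; by exists i.
rewrite (bigD1_seq i) //= (mem_set Ai) mulr1 big1 ?addr0 // => j ji.
rewrite memNset ?mulr0 // => Aj; by rewrite (dA _ _ _ Aj Ai) eqxx in ji.
Qed.

End LinfNorm.

Section RightMultiplicationBounds.
Context {R : realType} {d} {X : measurableType d} {mu : probability X R}.
Context {G : groupType} (alpha : pmp_action mu G) (Z : coef).
Local Notation CP := (crossed_product alpha Z).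
Local Notation ZG := (group_ring G (coef_ring Z)).
Local Notation incl := (group_ring_incl alpha (Z := Z)).
Local Notation mon l g := (<< l *g g >> : CP).
Local Notation chi mA := (cp_indic alpha Z mA).
Local Notation norm x := (cp_norm1 (alpha := alpha) (Z := Z) x).
Implicit Types (x y : CP) (l : Linf mu Z) (g h : G) (c : R).

Lemma cp_norm1w (D : {fset G}) x : (msupp x `<=` D)%fset ->
  norm x = \sum_(g <- D) Linf_norm1 x@_g.
Proof.
move=> xD; rewrite /cp_norm1 (big_fset_incl _ xD) //=.
by move=> g _ /monalg.mcoeff_outdom ->; rewrite Linf_norm1_0.
Qed.

Lemma cp_norm1_ge0 x : 0 <= norm x.
Proof. by apply: sumr_ge0 => g _; exact: Linf_norm1_ge0. Qed.

Lemma cp_norm1D x y : norm (x + y) <= norm x + norm y.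
Proof.
rewrite (cp_norm1w (fsubsetUl (msupp x) (msupp y))).
rewrite (cp_norm1w (fsubsetUr (msupp x) (msupp y))).
rewrite (cp_norm1w (monalg.msuppD_le _ _)) -big_split /=.
by apply: ler_sum => g _; rewrite cp_coefD; exact: Linf_norm1D.
Qed.

Lemma cp_norm1_0 : norm 0 = 0.
Proof. by rewrite /cp_norm1 monalg.msupp0 big_seq_fset0. Qed.

Lemma cp_norm1_sum (I : Type) (r : seq I) (F : I -> CP) :
  norm (\sum_(i <- r) F i) <= \sum_(i <- r) norm (F i).
Proof.
elim/big_ind2 : _ => [|a b a' b' h h'|//]; first by rewrite cp_norm1_0.
by apply: (le_trans (cp_norm1D _ _)); apply: lerD.
Qed.

Lemma cp_norm1U l g : norm (mon l g) = Linf_norm1 l.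
Proof. by rewrite (cp_norm1w monalg.msuppU_le) big_seq_fset1 monalg.mcoeffUU. Qed.

Lemma cp_norm1N x : norm (- x) = norm x.
Proof.
rewrite /cp_norm1 monalg.msuppN; apply: eq_bigr => g _.
rewrite monalg.mcoeffN; move: (x@_g) => l; rewrite -[l]reprK -rmorphN.
by apply: EFin_inj; rewrite !Linf_norm1E; apply: eq_integral => z _; rewrite coef_normN.
Qed.

(** Homomorphisms of marked modules are given by matrices acting by right
    multiplication, so that this is a bound for their norms. *)
Definition rbound c x := forall y, norm (y * x) <= c * norm y.

Lemma rbound_mon c x :
  (forall l g, norm (mon l g * x) <= c * Linf_norm1 l) -> rbound c x.
Proof.
move=> h y; have -> : y = \sum_(g <- msupp y) mon y@_g g by exact: monalg.monalgE.
rewrite mulr_suml; apply: (le_trans (cp_norm1_sum _ _)).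
have -> : norm (\sum_(g <- msupp y) mon y@_g g) = \sum_(g <- msupp y) Linf_norm1 y@_g.
  by rewrite -[X in norm X](monalg.monalgE y).
by rewrite mulr_sumr; apply: ler_sum => g _; exact: h.
Qed.

Lemma rbound0 : rbound 0 0.
Proof. by move=> y; rewrite mulr0 cp_norm1_0 mul0r. Qed.

Lemma rboundD c1 c2 x1 x2 : rbound c1 x1 -> rbound c2 x2 -> rbound (c1 + c2) (x1 + x2).
Proof.
move=> h1 h2 y; rewrite mulrDr mulrDl.
by apply: (le_trans (cp_norm1D _ _)); apply: lerD.
Qed.

Lemma rboundN c x : rbound c x -> rbound c (- x).
Proof. by move=> h y; rewrite mulrN cp_norm1N. Qed.

Lemma rboundM c1 c2 x1 x2 : 0 <= c2 ->
  rbound c1 x1 -> rbound c2 x2 -> rbound (c1 * c2) (x1 * x2).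
Proof.
move=> c20 h1 h2 y; rewrite mulrA; apply: (le_trans (h2 _)).
by rewrite [c1 * c2]mulrC -mulrA ler_wpM2l.
Qed.

Lemma rbound_sum (I : Type) (r : seq I) (c : I -> R) (F : I -> CP) :
  (forall i, rbound (c i) (F i)) -> rbound (\sum_(i <- r) c i) (\sum_(i <- r) F i).
Proof.
move=> h; elim/big_ind2 : _ => [|a b a' b'|//]; [exact: rbound0|exact: rboundD].
Qed.

Definition gr_norm1 (m : ZG) : R := \sum_(g <- msupp m) (coef_norm m@_g)%:R.

Lemma gr_norm1_ge0 m : 0 <= gr_norm1 m.
Proof. exact: sumr_ge0. Qed.

Lemma rbound_incl (m : ZG) : rbound (gr_norm1 m) (incl m).
Proof.
rewrite inclE; apply: rbound_sum => g; apply: rbound_mon => l h.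
rewrite monM Linf_act_cst cp_norm1U; exact: Linf_norm1_cst.
Qed.

(** A function l times such a sum has coefficients the restrictions of l to
    disjoint sets. Left translation by a group element preserves this. *)
Lemma rbound_disjoint (I : eqType) (r : seq I) (A : I -> set X)
    (mA : forall i, measurable (A i)) (j : I -> G) : uniq r ->
  (forall i i' w, A i w -> A i' w -> i = i') ->
  rbound 1 (\sum_(i <- r) mon (Linf_indic mu Z (mA i)) (j i)).
Proof.
move=> ur dA; apply: rbound_mon => l g; rewrite mul1r mulr_sumr.
apply: (le_trans (cp_norm1_sum _ _)).
have mB i : measurable (alpha g^-1%g @^-1` A i).
  by rewrite -[X in measurable X]setTI; apply: measurable_pact.
under eq_bigr do rewrite monM (Linf_act_indic Z (mA _) (mB _)) cp_norm1U.
by apply: Linf_norm1_disjoint => // i i' x; exact: dA.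
Qed.

Lemma rbound_chi (A : set X) (mA : measurable A) : rbound 1 (chi mA).
Proof.
have := @rbound_disjoint unit [:: tt] (fun=> A) (fun=> mA) (fun=> 1%g).
by rewrite big_seq1; apply=> // -[] [].
Qed.

End RightMultiplicationBounds.

(** * The element theta of a tiling *)

Lemma commutator_split (S : pzRingType) (c a b t : S) :
  b * t = t * b -> c * t = t * c -> c * (a * b) * t - t * (c * b) = c * ((a * t - t) * b).
Proof.
move=> bt ct; rewrite mulrBl mulrBr; congr (_ - _); last by rewrite mulrA -ct mulrA.
by rewrite -!mulrA bt.
Qed.

Section Vertical.
Context {G1 G2 : groupType} {A : comNzRingType}.
Local Notation AG := (group_ring (G1 * G2)%type A).

(** The endomorphism induced by the retraction of G1 * G2 onto its second
    factor. *)
Definition vert (m : AG) : AG := msum (fun g a => << a *g (1%g, g.2) >> : AG) m.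

Lemma vertD : {morph vert : m n / m + n}.
Proof. by apply: msumD => g a b /=; rewrite monalg.monalgUD. Qed.

Lemma vertU a g : vert << a *g g >> = << a *g (1%g, g.2) >>.
Proof. by apply: (msumU (h := fun g a => _)) => h b c /=; rewrite monalg.monalgUD. Qed.

Lemma vert0 : vert 0 = 0.
Proof. exact: msum0. Qed.

Lemma vert_scale (m : AG) (z : trivial_mod (G1 * G2)%type A) : vert m *: z = m *: z.
Proof.
move: m; apply: malg_ind => [|m n IHm IHn|a g]; first by rewrite vert0.
- by rewrite vertD !scalerDl IHm IHn.
- by rewrite vertU !gr_scaleU.
Qed.

End Vertical.

Section Theta.
Context {R : realType} {d1 d2} {X1 : measurableType d1} {X2 : measurableType d2}.
Context {mu1 : probability X1 R} {mu2 : probability X2 R} {G1 G2 : groupType}.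
Context (a1 : pmp_action mu1 G1) (a2 : pmp_action mu2 G2) (Z : coef).
Local Notation G := (G1 * G2)%type.
Local Notation X := (X1 * X2)%type.
Local Notation mu := (mu1 \x mu2)%E.
Local Notation alpha := (prod_action a1 a2).
Local Notation CP := (crossed_product alpha Z).
Local Notation ZG := (group_ring G (coef_ring Z)).
Local Notation incl := (group_ring_incl alpha (Z := Z)).
Local Notation mon l g := (<< l *g g >> : CP).
Local Notation chi mA := (cp_indic alpha Z mA).
Local Notation cst z := (Linf_cst mu Z z).

Lemma measurable_cyl (A : set X1) : measurable A -> measurable (A `*` [set: X2]).
Proof. by move=> mA; apply: measurableX. Qed.

Lemma pr_cyl (A : set X1) : measurable A -> pr mu (A `*` [set: X2]) = pr mu1 A.
Proof.
move=> mA; rewrite /pr; congr fine.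
transitivity (mu1 A * mu2 [set: X2])%E; first by rewrite -product_measure1E.
by rewrite probability_setT mule1.
Qed.

Lemma cst_central z (y : CP) : mon (cst z) 1%g * y = y * mon (cst z) 1%g.
Proof.
move: y; apply: (cp_ind (alpha := alpha)) => [|x y IHx IHy|l g]; first by rewrite mulr0 mul0r.
- by rewrite mulrDr mulrDl; exact: (congr2 +%R IHx IHy).
- by rewrite !monM mul1g mulg1 Linf_act1 Linf_act_cst mulrC.
Qed.

Lemma incl_vert (m : ZG) :
  incl (vert m) = \sum_(g <- msupp m) mon (cst m@_g) (1%g, g.2).
Proof.
rewrite /vert /msum rmorph_sum; apply: eq_bigr => g _; exact: inclU.
Qed.

Lemma chi_cyl_vert (A : set X1) (mA : measurable (A `*` [set: X2])) (m : ZG) :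
  chi mA * incl (vert m) = incl (vert m) * chi mA.
Proof.
rewrite incl_vert mulr_sumr mulr_suml; apply: eq_bigr => g _.
have mB : measurable (alpha (1%g, g.2)^-1%g @^-1` (A `*` [set: X2])).
  exact: measurable_translate.
rewrite (mon_chi _ mA mB) (chi_ext alpha Z mB mA) //.
apply/seteqP; split=> -[x y] [/= Ax _]; split=> //=; move: Ax;
  by rewrite invg1 pact1.
Qed.

Context (K : {fset G1}) (T : G1 -> set X1).
Context (tT : is_tiling K T).

Let mT t : measurable (T t). Proof. by case: tT. Qed.
Let mTX t := measurable_cyl (mT t).

(** The element through which amenability of G1 enters the algebra. On the
    right it absorbs the indicator of the base points (theta_chi); it commutes
    with G2 (theta_vert), fixes the constants (theta_scale), and on its left
    absorbs G1 outside the broken points (theta_shift). *)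
Definition theta : CP :=
  \sum_(t <- K) mon (Linf_indic mu Z (mTX t)) (t, 1%g).

Lemma theta_chi (A : set X1) (mA : measurable (A `*` [set: X2])) :
  (forall t x, T t x -> A (a1 t^-1%g x)) -> theta * chi mA = theta.
Proof.
move=> TA; rewrite /theta mulr_suml; apply: eq_bigr => t _.
have mB : measurable (alpha (t, 1%g)^-1%g @^-1` (A `*` [set: X2])).
  exact: measurable_translate.
rewrite /cp_indic monM mulg1 (Linf_act_indic Z mA mB) Linf_indicM //.
by move=> -[x y] [/= Tx _]; split=> //=; exact: TA.
Qed.

Lemma theta_vert (h : G2) l : (forall g, Linf_act alpha g l = l) ->
  mon l (1%g, h) * theta = theta * mon l (1%g, h).
Proof.
move=> lc; rewrite /theta mulr_sumr mulr_suml; apply: eq_bigr => t _.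
have mB : measurable (alpha (1%g, h)^-1%g @^-1` (T t `*` [set: X2])).
  exact: measurable_translate.
rewrite !monM lc (Linf_act_indic Z (mTX t) mB) mulrC.
have -> : ((1%g, h) * (t, 1%g))%g = ((t, 1%g) * (1%g, h))%g :> G.
  by congr pair; rewrite /= ?mul1g ?mulg1.
rewrite (Linf_indic_ext Z mB (mTX t)) //.
apply/seteqP; split=> -[x y] [/= Ax _]; split=> //=; move: Ax;
  by rewrite invg1 pact1.
Qed.

Context (dT : forall x, tdom T x).

Lemma theta_scale (z : coef_ring Z) : theta *: (cst z : Linf_mod alpha Z) = cst z.
Proof.
rewrite /theta scaler_suml; under eq_bigr do rewrite cp_scale_mon Linf_act_cst.
rewrite -mulr_suml; set s := (X in X * _); suff -> : s = 1 by rewrite mul1r.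
rewrite /s /Linf_indic -(rmorph_sum (\pi_(Linf mu Z))) /= -(rmorph1 (\pi_(Linf mu Z))).
congr \pi; apply: val_inj; apply/funext => -[x y].
rewrite (raddf_sum val) fct_sumE /=.
have [t Tt] := dT x; case: tT => _ TK Td.
rewrite (big_fsetD1 t) /=; last exact: TK Tt.
rewrite indicE mem_set // big1_seq ?addr0 // => t' /=; rewrite !inE => /andP[t't _].
rewrite indicE memNset // => -[/= Tt' _].
by rewrite (Td _ _ _ Tt' Tt) eqxx in t't.
Qed.

Lemma rbound_theta : rbound 1 theta.
Proof.
apply: rbound_disjoint; first exact: fset_uniq.
move=> t t' [x y] [/= Tt _] [/= Tt' _]; case: tT => _ _; apply; [exact: Tt|exact: Tt'].
Qed.

Lemma theta_coef (g : G) : theta@_g =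
  if g.2 == 1%g then Linf_indic mu Z (mTX g.1) else 0.
Proof.
case: g => g1 g2 /=; rewrite /theta raddf_sum.
transitivity (\sum_(t <- K) (Linf_indic mu Z (mTX t) *+ ((t == g1) && (1%g == g2)))).
  by apply: eq_bigr => t _ /=; rewrite (cp_coefU alpha).
have [_|_] := eqVneq g2 1%g; last by rewrite big1 // => t _; rewrite andbF.
under eq_bigr do rewrite andbT.
have [gK|gK] := boolP (g1 \in K).
  rewrite (big_fsetD1 g1) //= eqxx mulr1n big1_seq ?addr0 // => t /=.
  by rewrite !inE => /andP[/negbTE -> _]; rewrite mulr0n.
rewrite big1_seq => [|t /= tK]; last first.
  by case: eqP => // tg; move: gK; rewrite -tg tK.
have T0 : T g1 `*` [set: X2] = set0.
  apply/seteqP; split=> // -[x y] [/= Tg _]; case: tT => _ TK _.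
  by rewrite (TK _ _ Tg) in gK.
by rewrite (Linf_indic_ext _ _ measurable0 T0) Linf_indic0.
Qed.

Lemma Linf_indic_diff (A B C : set X) (mA : measurable A) (mB : measurable B)
    (mC : measurable C) : (forall x, ~ C x -> A x <-> B x) ->
  Linf_indic mu Z mC * (Linf_indic mu Z mA - Linf_indic mu Z mB) =
  Linf_indic mu Z mA - Linf_indic mu Z mB.
Proof.
move=> h; rewrite /Linf_indic -raddfB -rmorphM; congr \pi; apply: val_inj.
apply/funext => x; rewrite /= !fctE !indicE.
have [_|] := boolP (x \in C); first by rewrite mul1r.
rewrite notin_setE mul0r => /h ABx.
have -> : (x \in A) = (x \in B) by apply/idP/idP => /set_mem /ABx /mem_set.
by rewrite subrr.
Qed.

(** The coefficients at (t, 1) are the indicators of s T_(s^-1 t) and of T_t,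
    which agree at the points where the tiling is not broken. *)
Lemma theta_shift (s : G1) :
  supp_in (broken a1 T s^-1%g `*` [set: X2]) (mon 1 (s, 1%g) * theta - theta).
Proof.
move=> mB; apply/monalg.malgP => g.
rewrite (mcoeff_monM (alpha := alpha)) invg1 mul1g Linf_act1 monalg.mcoeffB.
have -> : (mon 1 (s, 1%g) * theta)@_g = Linf_act alpha (s, 1%g) (theta@_((s, 1%g)^-1 * g)%g).
  by rewrite (mcoeff_monM (alpha := alpha)) mul1r.
rewrite !theta_coef; case: g => g1 g2; rewrite /= invg1 mul1g.
case: (g2 == 1%g); last by rewrite rmorph0 subrr mulr0.
have mS : measurable (alpha (s, 1%g)^-1%g @^-1` (T (s^-1 * g1)%g `*` [set: X2])).
  exact: measurable_translate.
rewrite (Linf_act_indic Z (mTX _) mS); apply: Linf_indic_diff => -[x y] nB.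
have [h [Th Tsh]] : exists h, T h x /\ T (s^-1 * h)%g (a1 s^-1%g x).
  by apply: contrapT => h; apply: nB; split.
case: tT => _ _ Td; split=> [[/= Tx _]|[/= Tx _]]; split=> //=.
  by have /(congr1 (fun h => s * h)%g) := Td _ _ _ Tx Tsh; rewrite !mulVKg => ->.
by rewrite (Td _ _ _ Tx Th).
Qed.

(** For a monomial (g1, g2) = (g1, 1) (1, g2) the second factor commutes with
    theta, and the first one is absorbed outside a set of broken points. *)
Lemma theta_commutator (m : ZG) (B : set X1) : measurable B ->
  (forall g, g \in msupp m -> broken a1 T g.1^-1%g `<=` B) ->
  supp_in (B `*` [set: X2]) (incl m * theta - theta * incl (vert m)).
Proof.
move=> mB Bm.
rewrite incl_vert inclE mulr_suml mulr_sumr -sumrB big_seq.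
apply: supp_in_sum => g gm.
have -> : mon (cst m@_g) g * theta - theta * mon (cst m@_g) (1%g, g.2) =
    mon (cst m@_g) 1%g * ((mon 1 (g.1, 1%g) * theta - theta) * mon 1 (1%g, g.2)).
  have eg : ((g.1, 1%g) * (1%g, g.2))%g = g.
    by case: g gm => g1 g2 _; congr pair; rewrite /= ?mul1g ?mulg1.
  have eM : mon 1 (g.1, 1%g) * mon 1 (1%g, g.2) = mon 1 g.
    by rewrite monM mul1r eg (rmorph1 (Linf_act alpha _)).
  have e1 : mon (cst m@_g) g = mon (cst m@_g) 1%g * (mon 1 (g.1, 1%g) * mon 1 (1%g, g.2)).
    by rewrite eM; exact: mon_split.
  rewrite e1 (mon_split alpha (cst _) (1%g, g.2)).
  apply: commutator_split; last exact: cst_central.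
  by apply: theta_vert => h; exact: (rmorph1 (Linf_act alpha h)).
apply: supp_in_scalar; apply: supp_inM.
have mBX := measurable_cyl mB.
apply: (supp_inS (A := broken a1 T g.1^-1%g `*` [set: X2])); last exact: theta_shift.
  by apply: measurable_cyl; exact: measurable_broken tT.
by move=> -[x y] [/= bx _]; split=> //=; exact: Bm bx.
Qed.

End Theta.

(** * Correcting an almost chain map *)

Section CylinderMatrix.
Context {S : pzRingType} {p q : nat}.
Context (M : 'M[S]_p) (N : 'M[S]_q) (Phi : 'M[S]_(p, q)) (E : 'M[S]_p).

(** Let M and N be the boundaries of two complexes, with maps acting on rows
    from the right. The map Phi between them is a chain map up to the error M
    Phi - Phi N. As in a mapping cylinder, the target is enlarged by a copy of
    the source, but only by the part E of it that is needed to absorb the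
    error. *)
Definition cyl_map : 'M[S]_(p, q + p) := row_mx Phi E.

Definition cyl_err : 'M[S]_(p, q + p) := row_mx (M *m Phi - Phi *m N) (M *m E).

Definition cyl_diff : 'M[S]_(q + p) := col_mx (row_mx N 0) cyl_err.

Context (MM : M *m M = 0).
Context (NN : N *m N = 0).
Context (Eerr : E *m cyl_err = cyl_err).

Lemma cyl_map_diff : cyl_map *m cyl_diff = M *m cyl_map.
Proof.
rewrite /cyl_map /cyl_diff mul_row_col Eerr /cyl_err !mul_mx_row mulmx0 add_row_mx add0r.
by rewrite addrC subrK.
Qed.

Lemma cyl_diff_diff : cyl_diff *m cyl_diff = 0.
Proof.
have errE : cyl_err = M *m cyl_map - Phi *m row_mx N 0.
  by rewrite /cyl_err /cyl_map !mul_mx_row mulmx0 opp_row_mx add_row_mx oppr0 addr0.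
have NZ : row_mx N 0 *m cyl_diff = 0.
  by rewrite /cyl_diff mul_row_col mul0mx addr0 mul_mx_row NN mulmx0 row_mx0.
rewrite {1}/cyl_diff mul_col_mx NZ errE mulmxBl -!mulmxA NZ cyl_map_diff.
by rewrite mulmxA MM mul0mx mulmx0 subrr col_mx0.
Qed.

End CylinderMatrix.

(** Entrywise criterion for right multiplication by y to send the module of
    the idempotent c to that of b. *)
Lemma absorb_between (S : pzRingType) (a c y b : S) :
  a * c = a -> c * y * b = c * y -> a * y * b = a * y.
Proof. by move=> ac cyb; rewrite -ac -!mulrA (mulrA c) cyb. Qed.

Section MarkedMatrix.
Context {R : realType} {d} {X : measurableType d} {mu : probability X R}.
Context {G : groupType} (alpha : pmp_action mu G) (Z : coef).
Local Notation CP := (crossed_product alpha Z).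
Local Notation chi mA := (cp_indic alpha Z mA).

Lemma marked_predE p (A : mfamily X p) (v : 'rV[CP]_p) :
  v \in marked_pred alpha Z A <-> forall i, v 0 i * chi (measurable_mfam A i) = v 0 i.
Proof.
split=> [/marked_predP vA i|vA]; last first.
  by apply/marked_predP => i; exists (v 0 i).
by have [x ->] := vA i; rewrite -mulrA chiK.
Qed.

Lemma marked_mulmx p q (A : mfamily X p) (B : mfamily X q) (Y : 'M[CP]_(p, q)) :
  (forall i j, chi (measurable_mfam A i) * Y i j * chi (measurable_mfam B j) =
               chi (measurable_mfam A i) * Y i j) ->
  forall v, v \in marked_pred alpha Z A -> v *m Y \in marked_pred alpha Z B.
Proof.
move=> AYB v /marked_predE vA; apply/marked_predE => j.
rewrite !mxE mulr_suml; apply: eq_bigr => i _.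
exact: (absorb_between (vA i)).
Qed.

Section Map.
Context {p q : nat} {A : mfamily X p} {B : mfamily X q} (Y : 'M[CP]_(p, q)).
Context (AYB : forall i j,
  chi (measurable_mfam A i) * Y i j * chi (measurable_mfam B j) =
  chi (measurable_mfam A i) * Y i j).

Definition marked_map (v : marked_mod alpha Z A) : marked_mod alpha Z B :=
  MarkedMod (marked_mulmx AYB (valP v)).

Lemma marked_map_linear : linear marked_map.
Proof. by move=> x u v; apply: val_inj; rewrite /= mulmxDl scalemxAl. Qed.

HB.instance Definition _ := GRing.isLinear.Build _ _ _ _ marked_map marked_map_linear.

Lemma marked_map_norm (c : 'I_p -> 'I_q -> R) (v : marked_mod alpha Z A) :
  (forall i j, 0 <= c i j) -> (forall i j, rbound (c i j) (Y i j)) ->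
  marked_norm1 (marked_map v) <= (\sum_i \sum_j c i j) * marked_norm1 v.
Proof.
move=> c0 cY; rewrite /marked_norm1 mulr_sumr.
apply: (@le_trans _ _ (\sum_j \sum_i c i j * cp_norm1 (marked_val v 0 i))).
  apply: ler_sum => j _; rewrite mxE; apply: (le_trans (cp_norm1_sum _ _)).
  by apply: ler_sum => i _; exact: cY.
rewrite exchange_big; apply: ler_sum => i _; rewrite -mulr_suml.
apply: ler_wpM2r; first exact: cp_norm1_ge0.
rewrite (bigD1 i) //= lerDl; apply: sumr_ge0 => i' _; exact: sumr_ge0.
Qed.

End Map.

Section Aug.
Context {p : nat} {A : mfamily X p} (w : 'I_p -> Linf_mod alpha Z).

Definition marked_aug (v : marked_mod alpha Z A) : Linf_mod alpha Z :=
  \sum_i marked_val v 0 i *: w i.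

Lemma marked_aug_linear : linear marked_aug.
Proof.
move=> x u v; rewrite /marked_aug scaler_sumr -big_split; apply: eq_bigr => i _.
by rewrite /= !mxE scalerDl scalerA.
Qed.

HB.instance Definition _ := GRing.isLinear.Build _ _ _ _ marked_aug marked_aug_linear.

End Aug.
End MarkedMatrix.

(** * The small complex *)

(** A finite complex of free modules over the group ring of G1 * G2, and its
    collapse along G1. All degrees are put together into one free module of
    rows, the basis vector i having degree sm_deg i. The second complex is
    defined over the group ring of G2, and sm_map commutes with the boundaries
    once G1 is sent to 1 in the first one. The row sm_unit lifts 1 along the
    augmentation. *)
Record split_model (G1 G2 : groupType) (A : comNzRingType) := SplitModel {
  sm_p : nat;
  sm_q : nat;
  sm_deg : 'I_sm_p -> nat;
  sm_vdeg : 'I_sm_q -> nat;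
  sm_diff : 'M[group_ring (G1 * G2)%type A]_sm_p;
  sm_vdiff : 'M[group_ring (G1 * G2)%type A]_sm_q;
  sm_map : 'M[group_ring (G1 * G2)%type A]_(sm_p, sm_q);
  sm_aug : 'I_sm_q -> trivial_mod (G1 * G2)%type A;
  sm_unit : 'rV[group_ring (G1 * G2)%type A]_sm_q;
  sm_diff_diff : sm_diff *m sm_diff = 0;
  sm_vdiff_vdiff : sm_vdiff *m sm_vdiff = 0;
  sm_map_diff : map_mx vert sm_diff *m sm_map = sm_map *m sm_vdiff;
  sm_diff_deg : forall i i', sm_deg i != (sm_deg i').+1 -> sm_diff i i' = 0;
  sm_vdiff_deg : forall j j', sm_vdeg j != (sm_vdeg j').+1 -> sm_vdiff j j' = 0;
  sm_map_deg : forall i j, sm_deg i != sm_vdeg j -> sm_map i j = 0;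
  sm_unit_deg : forall j, sm_vdeg j != 0%N -> sm_unit 0 j = 0;
  sm_vdiff_vert : forall j j', vert (sm_vdiff j j') = sm_vdiff j j';
  sm_map_vert : forall i j, vert (sm_map i j) = sm_map i j;
  sm_unit_vert : forall j, vert (sm_unit 0 j) = sm_unit 0 j;
  sm_aug_vdiff : forall j, \sum_j' sm_vdiff j j' *: sm_aug j' = 0;
  sm_aug_unit : \sum_j sm_unit 0 j *: sm_aug j = 1 }.

Lemma absorb_left0 (S : pzRingType) (a y b : S) : a = 0 -> a * y * b = a * y.
Proof. by move=> ->; rewrite !mul0r. Qed.

Lemma absorb_mid0 (S : pzRingType) (a y b : S) : y = 0 -> a * y * b = a * y.
Proof. by move=> ->; rewrite mulr0 mul0r. Qed.

Lemma absorb_right (S : pzRingType) (a y b : S) : y * b = y -> a * y * b = a * y.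
Proof. by move=> yb; rewrite -mulrA yb. Qed.

Lemma mulrB_absorb (S : pzRingType) (x y b : S) :
  x * b = x -> y * b = y -> (x - y) * b = x - y.
Proof. by move=> xb yb; rewrite mulrBl xb yb. Qed.

Lemma sum_absorb (S : pzRingType) (I : finType) (F G : I -> S) (b : S) :
  (forall i, F i * G i * b = F i * G i) ->
  (\sum_i F i * G i) * b = \sum_i F i * G i.
Proof. by move=> h; rewrite mulr_suml; apply: eq_bigr => i _. Qed.

Lemma sum_zero (S : pzRingType) (I : finType) (F G : I -> S) :
  (forall i, F i = 0 \/ G i = 0) -> \sum_i F i * G i = 0.
Proof. by move=> h; apply: big1 => i _; have [->|->] := h i; rewrite ?mul0r ?mulr0. Qed.

Lemma mulrBl_assoc (S : pzRingType) (a b c t : S) :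
  a * (t * c) - t * (b * c) = (a * t - t * b) * c.
Proof. by rewrite mulrBl !mulrA. Qed.

Lemma absorb_commute (S : pzRingType) (t m c : S) :
  c * m = m * c -> t * c = t -> t * m * c = t * m.
Proof. by move=> cm tc; rewrite -mulrA -cm mulrA tc. Qed.

Section Constants.
Context {G1 G2 : groupType} {A : comNzRingType} (E : split_model G1 G2 A).

Definition sm_weight : nat := \sum_i \sum_i' #|` msupp (sm_diff E i i')|.

(** The growth of the measure of defect k along the degrees, in units of the
    measure of the broken points. *)
Fixpoint defect_rate (k : nat) : nat :=
  if k is k'.+1 then (sm_weight * (1 + defect_rate k'))%N else 0%N.

Definition dim_const : nat := (sm_q E + \sum_(i < sm_p E) defect_rate (sm_deg i))%N.

End Constants.

Section NormConstant.
Context {G1 G2 : groupType} {Z : coef} (R : realType).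
Context (E : split_model G1 G2 (coef_ring Z)).
Local Notation n := (gr_norm1 (R := R)).

Definition diff_bound (i j : 'I_(sm_q E + sm_p E)) : R :=
  match fintype.split i, fintype.split j with
  | inl j, inl j' => n (sm_vdiff E j j')
  | inl j, inr i => 0
  | inr i, inl j => \sum_i' n (sm_diff E i i') * (1 * n (sm_map E i' j)) +
                    \sum_j' (1 * n (sm_map E i j')) * n (sm_vdiff E j' j)
  | inr i, inr i' => n (sm_diff E i i') * 1
  end.

Lemma diff_bound_ge0 i j : 0 <= diff_bound i j.
Proof.
rewrite /diff_bound; case: fintype.split => {}i; case: fintype.split => {}j //;
  rewrite ?mulr1 ?gr_norm1_ge0 //.
by apply: addr_ge0; apply: sumr_ge0 => k _; rewrite mul1r mulr_ge0 ?gr_norm1_ge0.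
Qed.

(** This bounds the boundary maps of the small complex. It does not depend on
    the tiling, hence logarithmic norms tend to zero with the dimensions. *)
Definition norm_const : R := \sum_i \sum_j diff_bound i j.

Lemma norm_const_ge0 : 0 <= norm_const.
Proof. by apply: sumr_ge0 => i _; apply: sumr_ge0 => j _; exact: diff_bound_ge0. Qed.

End NormConstant.

Lemma sum_mulmx_scale (S : pzRingType) (U : lmodType S) (l m n : nat)
    (Y : 'M[S]_(l, m)) (Y' : 'M[S]_(m, n)) (w : 'I_n -> U) i :
  \sum_k Y i k *: (\sum_j Y' k j *: w j) = \sum_j (Y *m Y') i j *: w j.
Proof.
under eq_bigr do rewrite scaler_sumr.
rewrite exchange_big; apply: eq_bigr => j _; rewrite mxE scaler_suml.
by apply: eq_bigr => k _; rewrite scalerA.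
Qed.

Section SmallComplex.
Context {R : realType} {d1 d2} {X1 : measurableType d1} {X2 : measurableType d2}.
Context {mu1 : probability X1 R} {mu2 : probability X2 R} {G1 G2 : groupType}.
Context (a1 : pmp_action mu1 G1) (a2 : pmp_action mu2 G2) (Z : coef).
Local Notation G := (G1 * G2)%type.
Local Notation X := (X1 * X2)%type.
Local Notation mu := (mu1 \x mu2)%E.
Local Notation alpha := (prod_action a1 a2).
Local Notation CP := (crossed_product alpha Z).
Local Notation ZG := (group_ring G (coef_ring Z)).
Local Notation incl := (group_ring_incl alpha (Z := Z)).
Local Notation mon l g := (<< l *g g >> : CP).
Local Notation chi mA := (cp_indic alpha Z mA).
Local Notation cst z := (Linf_cst mu Z z).

Context (E : split_model G1 G2 (coef_ring Z)).
Local Notation p := (sm_p E).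
Local Notation q := (sm_q E).
Local Notation deg := (@sm_deg _ _ _ E).
Local Notation vdeg := (@sm_vdeg _ _ _ E).

Context (K : {fset G1}) (T : G1 -> set X1) (A : set X1).
Context (tT : is_tiling K T).
Context (dT : forall x, tdom T x).
Context (mA : measurable A).
Context (TA : forall t x, T t x -> A (a1 t^-1%g x)).

Let mAX : measurable (A `*` [set: X2]) := measurable_cyl mA.
Let th : CP := theta a1 a2 Z tT.

(** The part of the basis vector i of degree k that has to be kept in the
    target. It contains the error made by theta at the boundary of i, and the
    translates by which the boundary of i meets the defects of degree k - 1;
    with both, the indicators of the defects absorb the error of the cylinder
    (Chi_err). *)
Fixpoint defect (k : nat) (i : 'I_p) : set X :=
  if k is k'.+1 then
    \big[setU/set0]_(i' < p) \big[setU/set0]_(g <- msupp (sm_diff E i i'))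
      ((broken a1 T g.1^-1%g `*` [set: X2]) `|` (alpha g^-1%g @^-1` defect k' i'))
  else set0.

Lemma measurable_defect k i : measurable (defect k i).
Proof.
elim: k i => [|k IH] i; first exact: measurable0.
rewrite /defect -/defect; apply: bigsetU_measurable => i' _; apply: bigsetU_measurable => g _.
apply: measurableU; last exact: (measurable_translate alpha).
by apply: measurable_cyl; exact: measurable_broken tT.
Qed.

Lemma defectS k i i' g : g \in msupp (sm_diff E i i') ->
  (broken a1 T g.1^-1%g `*` [set: X2]) `|` (alpha g^-1%g @^-1` defect k i') `<=` defect k.+1 i.
Proof.
move=> gm x hx; rewrite /= -bigcup_seq; exists i'; first exact: mem_index_enum.
by rewrite -bigcup_seq; exists g.
Qed.

Definition bad i := defect (deg i) i.

Let mbad i : measurable (bad i). Proof. exact: measurable_defect. Qed.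

Let iM : 'M[CP]_p := map_mx incl (sm_diff E).
Let iN : 'M[CP]_q := map_mx incl (sm_vdiff E).
Let Phi : 'M[CP]_(p, q) := \matrix_(i, j) (th * incl (sm_map E i j)).
Let Chi : 'M[CP]_p := diag_mx (\row_i chi (mbad i)).

Lemma incl_sum (I : finType) (F : I -> ZG) : incl (\sum_i F i) = \sum_i incl (F i).
Proof. exact: rmorph_sum. Qed.

Lemma inclM (m n : ZG) : incl (m * n) = incl m * incl n.
Proof. exact: rmorphM. Qed.

Lemma incl_zero (m : ZG) : m = 0 -> incl m = 0.
Proof. by move=> ->; rewrite rmorph0. Qed.

Lemma Phi_deg i j : deg i != vdeg j -> Phi i j = 0.
Proof. by move=> h; rewrite mxE sm_map_deg // rmorph0 mulr0. Qed.

Lemma supp_in0 (B : set X) : supp_in (alpha := alpha) (Z := Z) B 0.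
Proof. by move=> mB; rewrite mulr0. Qed.

Lemma incl_chi_supp k i i' :
  supp_in (defect k.+1 i) (incl (sm_diff E i i') * chi (measurable_defect k i')).
Proof.
rewrite inclE mulr_suml big_seq; apply: supp_in_sum => g gm.
apply: (supp_inS (A := alpha g^-1%g @^-1` defect k i')).
- by apply: (measurable_translate alpha); exact: measurable_defect.
- by move=> x hx; apply: (defectS gm); right.
- apply: (supp_in_mon (alpha := alpha)); first exact: measurable_defect.
  move=> mD'.
  by rewrite (chi_ext alpha Z mD' (measurable_defect k i')) // chiK.
Qed.

Lemma commutator_supp k i i' : supp_in (defect k.+1 i)
  (incl (sm_diff E i i') * th - th * incl (vert (sm_diff E i i'))).
Proof.
pose B := \big[setU/set0]_(g <- msupp (sm_diff E i i')) broken a1 T g.1^-1%g.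
have mB : measurable B.
  by apply: bigsetU_measurable => g _; exact: measurable_broken tT.
apply: (supp_inS (A := B `*` [set: X2])); first exact: measurable_cyl.
  move=> -[x y] [/= Bx _]; move: Bx; rewrite /B -bigcup_seq => -[g gm bx].
  by apply: (defectS gm); left.
apply: theta_commutator => // g gm x bx; rewrite /B -bigcup_seq; by exists g.
Qed.

Local Notation err := (cyl_err iM iN Phi Chi).

Lemma errE_l i j : (iM *m Phi - Phi *m iN) i j =
  \sum_i' ((incl (sm_diff E i i') * th - th * incl (vert (sm_diff E i i'))) * incl (sm_map E i' j)).
Proof.
rewrite [LHS]mxE [X in _ + X]mxE.
have -> : (Phi *m iN) i j = th * incl ((sm_map E *m sm_vdiff E) i j) .
  rewrite !mxE incl_sum mulr_sumr; apply: eq_bigr => j' _.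
  by rewrite !mxE inclM mulrA.
rewrite -sm_map_diff [X in X - _]mxE [X in incl X]mxE incl_sum mulr_sumr -sumrB.
apply: eq_bigr => i' _.
have -> : iM i i' = incl (sm_diff E i i') by rewrite mxE.
have -> : Phi i' j = th * incl (sm_map E i' j) by rewrite mxE.
have -> : incl (map_mx vert (sm_diff E) i i' * sm_map E i' j) =
    incl (vert (sm_diff E i i')) * incl (sm_map E i' j) by rewrite mxE inclM.
exact: mulrBl_assoc.
Qed.

Lemma sm_diff_deg0 i i' : deg i = 0%N -> sm_diff E i i' = 0.
Proof. by move=> di; apply: sm_diff_deg; rewrite di. Qed.

Lemma sm_diff_degS k i i' : deg i = k.+1 -> deg i' <> k -> sm_diff E i i' = 0.
Proof.
by move=> di di'; apply: sm_diff_deg; rewrite di eqSS; apply/eqP => e; apply: di'.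
Qed.

Lemma err_supp i j : supp_in (bad i) (err i j).
Proof.
case: (split_ordP j) => [j' ->|i' ->].
  rewrite row_mxEl errE_l; apply: supp_in_sum => i' _; apply: supp_inM.
  rewrite /bad; case e: (deg i) => [|k]; last exact: commutator_supp.
  by rewrite sm_diff_deg0 // vert0 !rmorph0 mulr0 mul0r subrr; exact: supp_in0.
rewrite row_mxEr; have -> : (iM *m Chi) i i' = incl (sm_diff E i i') * chi (mbad i').
  by rewrite mul_mx_diag !mxE.
rewrite /bad; case e: (deg i) => [|k].
  apply: supp_inM; rewrite (incl_zero (sm_diff_deg0 _ e)); exact: supp_in0.
have [ei'|ni'] := eqVneq (deg i') k; last first.
  apply: supp_inM; rewrite incl_zero; first exact: supp_in0.
  by apply: (sm_diff_degS e); apply/eqP.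
have -> : chi (mbad i') = chi (measurable_defect k i').
  by apply: chi_ext; rewrite /bad ei'.
exact: incl_chi_supp.
Qed.

Lemma Chi_err : Chi *m err = err.
Proof.
apply/matrixP => i j; rewrite mul_diag_mx [LHS]mxE [X in X * _]mxE.
exact: err_supp.
Qed.

Local Notation D := (cyl_diff iM iN Phi Chi).
Local Notation F := (cyl_map Phi Chi).

Lemma iMM : iM *m iM = 0.
Proof. by rewrite -map_mxM sm_diff_diff map_mx0. Qed.

Lemma iNN : iN *m iN = 0.
Proof. by rewrite -map_mxM sm_vdiff_vdiff map_mx0. Qed.

Lemma FD : F *m D = iM *m F.
Proof. exact: (cyl_map_diff Chi_err). Qed.

Lemma DD : D *m D = 0.
Proof. exact: (cyl_diff_diff iMM iNN Chi_err). Qed.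

(** The complex has the same basis vectors in all degrees. A vector is cut
    down to the empty set in the degrees other than its own. The collapsed
    complex lives over the base points, since theta does, and the source over
    its defects. *)
Definition fam_set (k : nat) (j : 'I_(q + p)) : set X :=
  match fintype.split j with
  | inl j => if vdeg j == k then A `*` [set: X2] else set0
  | inr i => if deg i == k then bad i else set0
  end.

Lemma measurable_fam_set k j : measurable (fam_set k j).
Proof.
by rewrite /fam_set; case: (fintype.split j) => i; case: ifP => // _; exact: measurable0.
Qed.

Definition fam k : mfamily X (q + p) := MFamily (measurable_fam_set k).

Lemma fam_l k j : chi (measurable_mfam (fam k) (lshift p j)) =
  if vdeg j == k then chi mAX else 0.
Proof.
have e : fam k (lshift p j) = if vdeg j == k then A `*` [set: X2] else set0.
  by rewrite /= /fam_set (unsplitK (inl j)).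
case: ifP e => _ e; first exact: chi_ext.
by rewrite (chi_ext alpha Z _ measurable0 e) chi0.
Qed.

Lemma fam_r k i : chi (measurable_mfam (fam k) (rshift q i)) =
  if deg i == k then chi (mbad i) else 0.
Proof.
have e : fam k (rshift q i) = if deg i == k then bad i else set0.
  by rewrite /= /fam_set (unsplitK (inr i)).
case: ifP e => _ e; first exact: chi_ext.
by rewrite (chi_ext alpha Z _ measurable0 e) chi0.
Qed.

Lemma chi_vert (m : ZG) : vert m = m -> chi mAX * incl m = incl m * chi mAX.
Proof. by move=> <-; exact: chi_cyl_vert. Qed.

Lemma Phi_chi i j : Phi i j * chi mAX = Phi i j.
Proof.
rewrite mxE; apply: absorb_commute (chi_vert (sm_map_vert _ _)) _.
exact: theta_chi.
Qed.

Lemma D_ll j j' : D (lshift p j) (lshift p j') = incl (sm_vdiff E j j').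
Proof. by rewrite col_mxEu row_mxEl mxE. Qed.

Lemma D_lr j i : D (lshift p j) (rshift q i) = 0.
Proof. by rewrite col_mxEu row_mxEr mxE. Qed.

Lemma D_rl i j : D (rshift q i) (lshift p j) = (iM *m Phi) i j - (Phi *m iN) i j.
Proof. by rewrite col_mxEd row_mxEl [LHS]mxE [X in _ + X]mxE. Qed.

Lemma D_rr i i' : D (rshift q i) (rshift q i') = incl (sm_diff E i i') * chi (mbad i').
Proof. by rewrite col_mxEd row_mxEr mul_mx_diag !mxE. Qed.

(** Over the collapsed basis vectors this follows from two facts: vertical
    elements commute with the indicator of the base points, which theta
    absorbs. *)
Lemma D_fam k i j :
  chi (measurable_mfam (fam k.+1) i) * D i j * chi (measurable_mfam (fam k) j) =
  chi (measurable_mfam (fam k.+1) i) * D i j.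
Proof.
case: (split_ordP i) => {}i ->; case: (split_ordP j) => {}j ->.
- rewrite !fam_l D_ll; case: eqP => di; last exact: absorb_left0.
  case: eqP => dj; first exact: absorb_commute (chi_vert (sm_vdiff_vert _ _)) (chiK _ _ _).
  apply/absorb_mid0/incl_zero/sm_vdiff_deg; rewrite di eqSS eq_sym; exact/eqP.
- by apply: absorb_mid0; exact: D_lr.
- rewrite fam_l fam_r D_rl; case: eqP => di; last exact: absorb_left0.
  case: eqP => dj; last first.
    apply: absorb_mid0; rewrite [X in X - _]mxE [X in _ - X]mxE.
    have iM0 i' : iM i i' = 0 \/ Phi i' j = 0.
      have [di'|ni'] := eqVneq (deg i') k.
        by right; apply: Phi_deg; rewrite di' eq_sym; apply/eqP.
      by left; rewrite mxE; apply/incl_zero/(sm_diff_degS di)/eqP.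
    have iN0 j' : Phi i j' = 0 \/ iN j' j = 0.
      have [dj'|nj'] := eqVneq (vdeg j') k.+1.
        right; rewrite mxE; apply/incl_zero/sm_vdiff_deg; rewrite dj' eqSS eq_sym.
        exact/eqP.
      by left; apply: Phi_deg; rewrite di eq_sym.
    by rewrite (sum_zero iM0) (sum_zero iN0) subrr.
  apply/absorb_right/mulrB_absorb; rewrite [X in X * _]mxE [RHS]mxE; apply: sum_absorb => l.
    by apply: absorb_right; exact: Phi_chi.
  rewrite [X in _ * X * _]mxE [X in _ = _ * X]mxE.
  exact: absorb_commute (chi_vert (sm_vdiff_vert _ _)) (Phi_chi _ _).
- rewrite !fam_r D_rr; case: eqP => di; last exact: absorb_left0.
  case: eqP => dj; first by apply/absorb_right/absorb_right; exact: chiK.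
  apply: absorb_mid0; rewrite (incl_zero (sm_diff_degS di dj)); exact: mul0r.
Qed.

Definition aug_weight (j : 'I_(q + p)) : Linf_mod alpha Z :=
  match fintype.split j with inl j => cst (sm_aug j) | inr _ => 0 end.

Lemma aug_weight_l j : aug_weight (lshift p j) = cst (sm_aug j).
Proof. by rewrite /aug_weight (unsplitK (inl j)). Qed.

Lemma aug_weight_r i : aug_weight (rshift q i) = 0.
Proof. by rewrite /aug_weight (unsplitK (inr i)). Qed.

Lemma sum_aug_weight (x : 'I_(q + p) -> CP) :
  \sum_j x j *: aug_weight j = \sum_j x (lshift p j) *: (cst (sm_aug j) : Linf_mod alpha Z).
Proof.
rewrite big_split_ord /= [X in _ + X]big1 ?addr0 => [|i _].
  by apply: eq_bigr => j _; rewrite aug_weight_l.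
by rewrite aug_weight_r scaler0.
Qed.

(** The augmentation of the source, obtained through its collapse. *)
Definition total_aug i : trivial_mod G (coef_ring Z) := \sum_j sm_map E i j *: sm_aug j.

Lemma sum_incl_cst (I : finType) (x : I -> ZG) (z : I -> trivial_mod G (coef_ring Z)) :
  \sum_i incl (x i) *: (cst (z i) : Linf_mod alpha Z) = cst (\sum_i x i *: z i).
Proof. by rewrite rmorph_sum; apply: eq_bigr => i _; exact: incl_scale_cst. Qed.

Lemma Phi_aug i :
  \sum_j Phi i j *: (cst (sm_aug j) : Linf_mod alpha Z) = cst (total_aug i).
Proof.
have -> : \sum_j Phi i j *: (cst (sm_aug j) : Linf_mod alpha Z) =
    th *: \sum_j incl (sm_map E i j) *: (cst (sm_aug j) : Linf_mod alpha Z).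
  rewrite scaler_sumr; apply: eq_bigr => j _; rewrite mxE; exact: esym (scalerA _ _ _).
by rewrite sum_incl_cst; exact: theta_scale.
Qed.

Lemma total_aug_diff i : \sum_i' sm_diff E i i' *: total_aug i' = 0.
Proof.
have -> : \sum_i' sm_diff E i i' *: total_aug i' =
    \sum_j (map_mx vert (sm_diff E) *m sm_map E) i j *: sm_aug j.
  rewrite -(sum_mulmx_scale _ _ _ i); apply: eq_bigr => i' _.
  by rewrite mxE vert_scale.
rewrite sm_map_diff -sum_mulmx_scale; apply: big1 => j _.
by rewrite sm_aug_vdiff scaler0.
Qed.

Lemma D_aug i : \sum_j D i j *: aug_weight j = 0.
Proof.
rewrite sum_aug_weight; case: (split_ordP i) => {}i ->.
  under eq_bigr do rewrite D_ll.
  by rewrite sum_incl_cst sm_aug_vdiff rmorph0.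
under eq_bigr do rewrite D_rl scalerBl.
rewrite sumrB -!(sum_mulmx_scale _ _ _ i).
under eq_bigr do rewrite Phi_aug.
under [X in _ - X]eq_bigr => j _.
  have -> : \sum_j' iN j j' *: (cst (sm_aug j') : Linf_mod alpha Z) = 0.
    under eq_bigr do rewrite mxE.
    by rewrite sum_incl_cst sm_aug_vdiff rmorph0.
  rewrite scaler0; over.
rewrite [X in _ - X]big1 // subr0.
under eq_bigr do rewrite mxE.
by rewrite sum_incl_cst total_aug_diff rmorph0.
Qed.

Definition small_diff k :
    {linear marked_mod alpha Z (fam k.+1) -> marked_mod alpha Z (fam k)} :=
  marked_map (@D_fam k).

Definition small_aug : {linear marked_mod alpha Z (fam 0) -> Linf_mod alpha Z} :=
  marked_aug aug_weight.

Lemma small_diff_diff k v : small_diff k (small_diff k.+1 v) = 0.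
Proof. by apply: val_inj; rewrite /= -mulmxA DD mulmx0. Qed.

Lemma small_aug_mulmx (r : nat) (v : 'rV[CP]_r) (Y : 'M[CP]_(r, q + p)) :
  \sum_j (v *m Y) 0 j *: aug_weight j = \sum_i v 0 i *: \sum_j Y i j *: aug_weight j.
Proof. by rewrite -sum_mulmx_scale. Qed.

Lemma small_aug_diff v : small_aug (small_diff 0 v) = 0.
Proof.
rewrite /small_aug /= /marked_aug /= small_aug_mulmx; apply: big1 => i _.
by rewrite D_aug scaler0.
Qed.

(** As theta fixes constants, l is the image of l theta sm_unit. *)
Lemma small_aug_surj l : exists v, small_aug v = l.
Proof.
pose v : 'rV[CP]_(q + p) := row_mx (\row_j (mon l 1%g * th * incl (sm_unit E 0 j))) 0.
have vl j : v 0 (lshift p j) = mon l 1%g * th * incl (sm_unit E 0 j).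
  by rewrite row_mxEl mxE.
have vr i : v 0 (rshift q i) = 0 by rewrite row_mxEr mxE.
have vP : v \in marked_pred alpha Z (fam 0).
  apply/marked_predE => j; case: (split_ordP j) => {}j ->; last by rewrite vr mul0r.
  rewrite vl fam_l; case: eqP => dj.
    apply: absorb_commute (chi_vert (sm_unit_vert _)) _; apply: absorb_right.
    exact: theta_chi.
  by apply: absorb_mid0; apply/incl_zero/sm_unit_deg/eqP.
exists (MarkedMod vP); rewrite /small_aug /= /marked_aug /= sum_aug_weight.
transitivity (mon l 1%g *: (th *: \sum_j incl (sm_unit E 0 j) *: (cst (sm_aug j) : Linf_mod alpha Z))).
  rewrite !scaler_sumr; apply: eq_bigr => j _; rewrite vl.
  by rewrite [RHS]scalerA [RHS]scalerA.
rewrite sum_incl_cst sm_aug_unit; set c := cst 1.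
have -> : th *: (c : Linf_mod alpha Z) = c by exact: theta_scale.
by rewrite cp_scale_mon Linf_act1 /c rmorph1 mulr1.
Qed.

Definition small_complex : marked_complex alpha Z :=
  MarkedComplex (mc_obj := fun k => Marked (fam k)) small_diff_diff small_aug_diff small_aug_surj.

Lemma F_fam k (u : 'rV[ZG]_p) : (forall i, deg i != k -> u 0 i = 0) ->
  map_mx incl u *m F \in marked_pred alpha Z (fam k).
Proof.
move=> uk; apply/marked_predE => j; rewrite mxE.
have u0 i : deg i != k -> (map_mx incl u) 0 i = 0.
  by move=> di; rewrite mxE; apply/incl_zero/uk.
case: (split_ordP j) => {}j ->.
  rewrite fam_l; case: eqP => dj.
    apply: sum_absorb => i; apply: absorb_right; rewrite row_mxEl; exact: Phi_chi.
  rewrite mulr0; apply/esym/sum_zero => i.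
  have [di|/u0] := eqVneq (deg i) k; last by left.
  by right; rewrite row_mxEl; apply: Phi_deg; rewrite di eq_sym; apply/eqP.
have FC i : F i (rshift q j) = if i == j then chi (mbad j) else 0.
  by rewrite row_mxEr !mxE; case: eqP => [->|_].
rewrite fam_r; case: eqP => dj.
  apply: sum_absorb => i; apply: absorb_right; rewrite FC.
  by case: eqP => _; [exact: chiK|exact: mul0r].
rewrite mulr0; apply/esym/sum_zero => i; rewrite FC; case: eqP => [->|_]; last by right.
by left; apply: u0; apply/eqP.
Qed.

Section Push.
Context {C : lmodType ZG} (k : nat) (f : {linear C -> 'rV[ZG]_p}).
Context (fk : forall c i, deg i != k -> f c 0 i = 0).

(** The embedding: rows are multiplied by the matrix F of the cylinder, into
    the summands of their degree. *)
Definition push (c : C) : marked_mod alpha Z (fam k) := MarkedMod (F_fam (fk c)).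

Lemma push_linear : linear_for (group_ring_incl alpha (Z := Z) \; *:%R) push.
Proof.
move=> x u v; apply: val_inj; rewrite /= linearP /=.
have -> : map_mx incl (x *: f u + f v) = incl x *: map_mx incl (f u) + map_mx incl (f v).
  by apply/matrixP => i j; rewrite !mxE rmorphD rmorphM.
by rewrite mulmxDl -scalemxAl.
Qed.

HB.instance Definition _ := GRing.isLinear.Build _ _ _ _ push push_linear.

End Push.

Lemma small_complex_embedding (C : resolution (trivial_mod G (coef_ring Z))) (n : nat)
    (f : forall k, {linear C k -> 'rV[ZG]_p}) :
  (forall k c i, deg i != k -> f k c 0 i = 0) ->
  (forall k c, (k <= n)%N -> f k (res_diff C k c) = f k.+1 c *m sm_diff E) ->
  (forall c, \sum_i f 0%N c 0 i *: total_aug i = res_aug C c) ->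
  forall r, (r <= n)%N -> embedding_target C r small_complex.
Proof.
move=> fk fd fa r rn.
exists (fun k => push (fk k)); split=> [k kr c|c].
  apply: val_inj; rewrite /= fd ?(leq_trans kr) // map_mxM.
  by rewrite -!mulmxA -FD.
rewrite /= /marked_aug /= small_aug_mulmx.
transitivity (\sum_i incl (f 0%N c 0 i) *: (cst (total_aug i) : Linf_mod alpha Z)).
  apply: eq_bigr => i _.
  have -> : \sum_j F i j *: aug_weight j = cst (total_aug i).
    rewrite sum_aug_weight -[RHS]Phi_aug; apply: eq_bigr => j _.
    by rewrite row_mxEl.
  by rewrite mxE.
by rewrite sum_incl_cst fa.
Qed.

Lemma rbound_D i j : rbound (diff_bound R i j) (D i j).
Proof.
rewrite /diff_bound; case: (split_ordP i) => {}i ->; case: (split_ordP j) => {}j ->.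
- by rewrite D_ll; exact: rbound_incl.
- by rewrite D_lr; exact: rbound0.
- have rPhi i' j' : rbound (1 * gr_norm1 (sm_map E i' j')) (Phi i' j').
    rewrite mxE; apply: rboundM; first exact: gr_norm1_ge0.
      exact: rbound_theta.
    exact: rbound_incl.
  have riM i' l : rbound (gr_norm1 (sm_diff E i' l)) (iM i' l).
    by rewrite mxE; exact: rbound_incl.
  have riN j' l : rbound (gr_norm1 (sm_vdiff E j' l)) (iN j' l).
    by rewrite mxE; exact: rbound_incl.
  rewrite D_rl; apply: rboundD; last apply: rboundN; rewrite mxE; apply: rbound_sum => l.
    apply: rboundM; [by rewrite mul1r gr_norm1_ge0|exact: riM|exact: rPhi].
  by apply: rboundM; [exact: gr_norm1_ge0|exact: rPhi|exact: riN].
- rewrite D_rr; apply: rboundM => //; [exact: rbound_incl|exact: rbound_chi].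
Qed.

Lemma small_diff_norm k v :
  marked_norm1 (small_diff k v) <= norm_const R E * marked_norm1 v.
Proof. by apply: marked_map_norm; [exact: diff_bound_ge0|exact: rbound_D]. Qed.

Section Dimension.
Context (eps : R).
Context (eps0 : 0 <= eps).
Context (brk : forall i i' g, g \in msupp (sm_diff E i i') ->
  pr mu1 (broken a1 T g.1^-1%g) <= eps).
Context (prA : pr mu1 A <= eps).

Lemma pr_defect k i : pr mu (defect k i) <= eps * (defect_rate E k)%:R.
Proof.
elim: k i => [|k IH] i; first by rewrite /pr measure0 mulr0.
rewrite [defect _ _]/defect -/defect.
have mb (g : G) : measurable (broken a1 T g.1^-1%g `*` [set: X2]).
  by apply: measurable_cyl; exact: measurable_broken tT.
have md (g : G) i' : measurable (alpha g^-1%g @^-1` defect k i').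
  by apply: (measurable_translate alpha); exact: measurable_defect.
have mU g i' : measurable ((broken a1 T g.1^-1%g `*` [set: X2]) `|`
    (alpha g^-1%g @^-1` defect k i')) by apply: measurableU.
apply: le_trans (pr_bigsetU_le _ _ _ _) _.
  by move=> i'; apply: bigsetU_measurable => g _.
apply: (@le_trans _ _ (\sum_i' (#|` msupp (sm_diff E i i')|)%:R *
    (eps * (1 + defect_rate E k)%:R))); last first.
  rewrite -mulr_suml -natr_sum /= natrM mulrCA; apply: ler_wpM2l => //.
  apply: ler_wpM2r => //; rewrite ler_nat /sm_weight [leqRHS](bigD1 i) //=.
  exact: leq_addr.
apply: ler_sum => i' _; apply: le_trans (pr_bigsetU_le _ _ _ _) _.
  by move=> g.
rewrite mulr_natl -[X in _ *+ X]count_predT -iter_addr_0 -big_const_seq.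
rewrite big_seq [leRHS]big_seq; apply: ler_sum => g gm.
apply: (le_trans (prU_le _ (mb g) (md g i'))).
rewrite natrD mulrDr mulr1 pr_cyl; last exact: measurable_broken tT.
apply: lerD; first exact: brk gm.
rewrite (pr_translate alpha); last exact: measurable_defect.
exact: IH.
Qed.

Lemma small_dim k : marked_dim mu (fam k) <= eps * (dim_const E)%:R.
Proof.
rewrite /marked_dim big_split_ord /= /dim_const natrD mulrDr natr_sum mulr_sumr.
apply: lerD.
  rewrite mulr_natr -[X in _ *+ X]card_ord -sumr_const; apply: ler_sum => j _.
  rewrite /fam_set (unsplitK (inl j)); case: ifP => _; last by rewrite measure0.
  by rewrite -/(pr mu _) pr_cyl.
apply: ler_sum => i _; rewrite /fam_set (unsplitK (inr i)).
case: ifP => _; first exact: pr_defect.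
by rewrite measure0 mulr_ge0.
Qed.

End Dimension.

End SmallComplex.

(** * Logarithmic norms *)

Lemma inf_ge0 (R : realType) (S : set R) : lbound S 0 -> 0 <= inf S.
Proof.
move=> S0; have [->|/set0P Sn] := eqVneq S set0; first by rewrite inf0.
exact: lb_le_inf.
Qed.

Section LogNormBound.
Context {R : realType} {d} {X : measurableType d} {mu : probability X R}.
Context {G : groupType} {alpha : pmp_action mu G} {Z : coef}.
Local Notation mod := (marked_mod alpha Z).
Context {p q : nat} {M : mfamily X p} {N : mfamily X q}.

Lemma marked_dim_ge0 r (A : mfamily X r) : 0 <= marked_dim mu A.
Proof. by apply: sumr_ge0 => i _; exact: fine_ge0. Qed.

Lemma log_plus_ge0 (t : R) : 0 <= log_plus t.
Proof. by rewrite /log_plus le_max lexx orbT. Qed.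

Lemma log_plus_le (s t : R) : 0 <= s -> s <= t -> log_plus s <= log_plus t.
Proof.
move=> s0 st; rewrite /log_plus ge_max; apply/andP; split; last by rewrite le_max lexx orbT.
move: s0; rewrite le_eqVlt => /predU1P[<-|s0]; first by rewrite ln0 // le_max lexx orbT.
by rewrite le_max ler_ln ?posrE ?st // (lt_le_trans s0).
Qed.

Lemma op_norm_ge0 (f : {linear mod M -> mod N}) : 0 <= op_norm f.
Proof. by apply: inf_ge0 => c []. Qed.

Lemma op_norm_le (f : {linear mod M -> mod N}) (c : R) : 0 <= c ->
  (forall z, marked_norm1 (f z) <= c * marked_norm1 z) -> op_norm f <= c.
Proof. by move=> c0 fc; apply: ge_inf => //; exists 0 => b []. Qed.

Lemma marked_rank_ge0 (f : {linear mod M -> mod N}) : 0 <= marked_rank f.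
Proof. by apply: inf_ge0 => _ [N' [_ _ ->]]; exact: marked_dim_ge0. Qed.

Lemma lognorm'_ge0 (f : {linear mod M -> mod N}) : 0 <= lognorm' f.
Proof.
rewrite /lognorm' le_min !mulr_ge0 ?log_plus_ge0 ?marked_dim_ge0 //.
exact: marked_rank_ge0.
Qed.

End LogNormBound.

Section LogNorm.
Context {R : realType} {d} {X : measurableType d} {mu : probability X R}.
Context {G : groupType} {alpha : pmp_action mu G} {Z : coef}.
Local Notation mod := (marked_mod alpha Z).
Context {p q : nat} {M : mfamily X p} {N : mfamily X q}.

Lemma lognorm_ge0 (f : {linear mod M -> mod N}) : 0 <= lognorm f.
Proof.
by apply: inf_ge0 => _ [D ->]; apply: sumr_ge0 => k _; exact: lognorm'_ge0.
Qed.

(** Bound by the trivial decomposition. *)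
Lemma lognorm_le (f : {linear mod M -> mod N}) (c : R) : 0 <= c ->
  (forall z, marked_norm1 (f z) <= c * marked_norm1 z) ->
  lognorm f <= marked_dim mu M * log_plus c.
Proof.
move=> c0 fc.
have tr (i : 'I_p) : trivIset setT (fun _ : 'I_1 => M i).
  by move=> k l _ _ _; rewrite (ord1 k) (ord1 l).
have co (i : 'I_p) : \bigcup_(_ in [set: 'I_1]) M i = M i.
  by apply/seteqP; split=> [x [_ _ //]|x Mx]; exists ord0.
pose D : mdecomp M := @MDecomp _ _ _ M 1 (fun=> M) tr co.
apply: (@le_trans _ _ (\sum_k lognorm' (f \o marked_incl (mdecomp_sub D k)))).
  apply: ge_inf; last by exists D.
  by exists 0 => _ [D' ->]; apply: sumr_ge0 => k _; exact: lognorm'_ge0.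
rewrite big_ord1 /lognorm' ge_min; apply/orP; left.
apply: ler_wpM2l; first exact: marked_dim_ge0.
apply: log_plus_le; first exact: op_norm_ge0.
by apply: op_norm_le => // z; exact: fc.
Qed.

End LogNorm.

Section Vanishing.
Context {R : realType} {d1 d2} {X1 : measurableType d1} {X2 : measurableType d2}.
Context {mu1 : probability X1 R} {mu2 : probability X2 R} {G1 G2 : groupType}.
Context (a1 : pmp_action mu1 G1) (a2 : pmp_action mu2 G2) (Z : coef).
Local Notation G := (G1 * G2)%type.
Local Notation mu := (mu1 \x mu2)%E.
Local Notation alpha := (prod_action a1 a2).
Local Notation ZG := (group_ring G (coef_ring Z)).
Context (infG : infinite_set [set: G1]).
Context (amenG : amenable R G1).
Context (std : standard_action a1).
Context (E : split_model G1 G2 (coef_ring Z)).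
Context (C : resolution (trivial_mod G (coef_ring Z))) (n : nat).
Context (f : forall k, {linear C k -> 'rV[ZG]_(sm_p E)}).
Context (f_deg : forall k c i, sm_deg i != k -> f k c 0 i = 0).
Context (f_diff : forall k c, (k <= n)%N ->
  f k (res_diff C k c) = f k.+1 c *m sm_diff E).
Context (f_aug : forall c, \sum_i f 0%N c 0 i *: total_aug i = res_aug C c).

(** Dimensions of the small complex are at most e dim_const and norms at most
    norm_const; a tiling with e small compared with these constants will do. *)
Lemma small_embedding (eps : R) : 0 < eps ->
  exists D : marked_complex alpha Z,
  [/\ forall r, (r <= n)%N -> embedding_target C r D,
      forall k, marked_dim mu (D k) <= eps &
      forall k, lognorm (mc_diff D k) <= eps].
Proof.
move=> eps0.
pose c := (dim_const E)%:R * (1 + log_plus (norm_const R E)).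
have l0 : 0 <= log_plus (norm_const R E) by exact: log_plus_ge0.
have c0 : 0 <= c by apply: mulr_ge0 => //; exact: addr_ge0.
pose e := eps / (1 + c).
have c10 : 0 < 1 + c by rewrite ltr_pwDl.
have e0 : 0 < e by rewrite divr_gt0.
have ece : e * c <= eps.
  by rewrite /e mulrAC ler_pdivrMr // ler_pM2l // lerDr.
pose S := flatten [seq [seq g.1^-1%g | g <- msupp (sm_diff E x.1 x.2)] |
                   x <- enum {: 'I_(sm_p E) * 'I_(sm_p E)}].
have [K [T [A [tT dT brT [mA prA] TA]]]] := sparse_tiling std amenG S infG e0.
have brk i i' g : g \in msupp (sm_diff E i i') -> pr mu1 (broken a1 T g.1^-1%g) <= e.
  move=> gm; apply: le_trans brT.
  have gS : g.1^-1%g \in S.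
    apply/flatten_mapP; exists (i, i'); first by rewrite mem_enum.
    by apply/mapP; exists g.
  rewrite (big_rem _ gS) /= lerDl; apply: sumr_ge0 => s _; exact: pr_ge0.
pose D := small_complex a2 E tT dT mA TA.
have dimD k : marked_dim mu (D k) <= e * (dim_const E)%:R.
  by apply: small_dim => //; exact: ltW.
have d0 : 0 <= e * (dim_const E)%:R by rewrite mulr_ge0 // ltW.
exists D; split=> [r rn|k|k].
- exact: (@small_complex_embedding _ _ _ _ _ _ _ _ _ a1 a2 Z E K T A tT dT mA TA C n f f_deg f_diff f_aug r rn).
- apply: (le_trans (dimD k)); apply: le_trans ece.
  rewrite /c mulrDr mulr1 mulrDr lerDl; apply: mulr_ge0; [exact: ltW|exact: mulr_ge0].
- have h : lognorm (mc_diff D k) <= marked_dim mu (D k.+1) * log_plus (norm_const R E).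
    by apply: lognorm_le; [exact: norm_const_ge0|exact: small_diff_norm].
  apply: (le_trans h); apply: (le_trans (ler_wpM2r l0 (dimD k.+1))); apply: le_trans ece.
  by rewrite /c mulrDr mulr1 mulrDr -mulrA lerDr.
Qed.

End Vanishing.

(** * Contracted models of resolutions *)

Section IntegralRows.
Context {G : groupType}.
Local Notation ZG := (group_ring G int).
Implicit Types (V : zmodType).

Definition basis_row p (i : 'I_p) (g : G) : 'rV[ZG]_p := (<< 1 *g g >> : ZG) *: delta_mx 0 i.

Lemma mon_mulz (z : int) g : (<< z *g g >> : ZG) = (<< 1 *g g >> : ZG) *~ z.
Proof.
have e : (<< 1 *~ z *g g >> : ZG) = (<< 1 *g g >> : ZG) *~ z.
  exact: (raddfMz (monalg.mkmalgU g) z 1).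
by rewrite -e intz.
Qed.

Lemma basis_row_ind p (P : 'rV[ZG]_p -> Prop) :
  P 0 -> (forall x y, P x -> P y -> P (x - y)) ->
  (forall i g, P (basis_row i g)) -> forall x, P x.
Proof.
move=> P0 PB Pb x.
have PN y : P y -> P (- y) by move=> Py; rewrite -sub0r; apply: PB.
have PD y z : P y -> P z -> P (y + z) by move=> Py Pz; rewrite -[z]opprK; apply: PB => //; apply: PN.
rewrite [x]row_sum_delta; elim/big_ind : _ => // i _.
move: (x 0 i); apply: malg_ind => [|a b Pa Pb'|z g].
- by rewrite scale0r.
- by rewrite scalerDl; apply: PD.
rewrite mon_mulz -scalerMzl; have Pn k : P (basis_row i g *+ k).
  by elim: k => [//|k IH]; rewrite mulrS; apply: PD.
by case: z => k; [exact: Pn|rewrite NegzE mulrNz; apply/PN/Pn].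
Qed.

Lemma additive_row_ext p V (f h : 'rV[ZG]_p -> V) :
  {morph f : x y / x - y} -> {morph h : x y / x - y} ->
  (forall i g, f (basis_row i g) = h (basis_row i g)) -> forall x, f x = h x.
Proof.
move=> fB hB fh; apply: basis_row_ind => [|x y e1 e2|//].
  by have := fB 0 0; have := hB 0 0; rewrite subr0 !subrr => -> ->.
by rewrite fB hB e1 e2.
Qed.

(** The additive map with values y i g on the rows basis_row i g, which are a
    basis over the integers. *)
Definition zlin p V (y : 'I_p -> G -> V) (v : 'rV[ZG]_p) : V :=
  \sum_i msum (fun g (z : int) => y i g *~ z) (v 0 i : malg G int).

Lemma zlinD p V (y : 'I_p -> G -> V) : {morph zlin y : u v / u + v}.
Proof.
move=> u v; rewrite /zlin -big_split; apply: eq_bigr => i _ /=.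
by rewrite !mxE msumD // => g a b; rewrite mulrzDr.
Qed.

Lemma zlinB p V (y : 'I_p -> G -> V) : {morph zlin y : u v / u - v}.
Proof.
move=> u v; apply/eqP; rewrite eq_sym subr_eq -zlinD subrK; exact/eqP.
Qed.

Lemma zlin_basis p V (y : 'I_p -> G -> V) i g : zlin y (basis_row i g) = y i g.
Proof.
rewrite /zlin (bigD1 i) //= big1 ?addr0 => [|j ji].
  rewrite !mxE !eqxx mulr1 msumU // => h a b; exact: mulrzDr.
by rewrite !mxE eqxx (negbTE ji) mulr0 msum0.
Qed.

End IntegralRows.

Section SplitGenerators.
Context {S : nzRingType} {M : lmodType S} {m : nat} (t : 'I_m -> M).

Definition row_comb (v : 'rV[S]_m) : M := \sum_a v 0 a *: t a.

Lemma row_comb_linear : linear row_comb.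
Proof.
move=> x u v; rewrite /row_comb scaler_sumr -big_split; apply: eq_bigr => a _.
by rewrite /= !mxE scalerDl scalerA.
Qed.

HB.instance Definition _ := GRing.isLinear.Build _ _ _ _ row_comb row_comb_linear.

End SplitGenerators.

Lemma fg_projective_split (S : nzRingType) (M : lmodType S) :
  is_fg M -> is_projective M -> exists m0, forall m, (m0 <= m)%N ->
  exists (g : {linear 'rV[S]_m -> M}) (s : {linear M -> 'rV[S]_m}), forall x, g (s x) = x.
Proof.
move=> [t tP] projM; exists (size t) => m tm.
pose g : {linear 'rV[S]_m -> M} := row_comb (fun a : 'I_m => nth 0 t a).
have gsurj x : exists v, g v = x.
  have [c ->] := tP x; exists (\row_a if (a < size t)%N then c (nth 0 t a) else 0).
  rewrite /g /= /row_comb (big_nth 0) big_mkord.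
  rewrite (big_ord_widen m (fun a => c (nth 0 t a) *: nth 0 t a) tm) [RHS]big_mkcond.
  apply: eq_bigr => a _; rewrite mxE; case: ifP => // at'.
  by rewrite scale0r.
have [s sP] := projM _ _ g idfun gsurj.
by exists g, s => x; rewrite sP.
Qed.

Section Contraction.
Context {G : groupType} (P : resolution (trivial_mod G int)) (N m : nat).
Local Notation ZG := (group_ring G int).
Local Notation bd := (@res_diff _ _ P).
Local Notation aug := (res_aug P).
Context (g : forall k, {linear 'rV[ZG]_m -> P k}) (s : forall k, {linear P k -> 'rV[ZG]_m}).
Context (gs : forall k, (k <= N)%N -> forall x, g k (s k x) = x).
Context (x0 : P 0%N).
Context (aug_x0 : aug x0 = 1).

Lemma bd_bd k x : bd k (bd k.+1 x) = 0.
Proof. by apply/res_exact; exists x. Qed.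

Lemma aug_bd x : aug (bd 0 x) = 0.
Proof. by apply/res_exact0; exists x. Qed.

Definition preim k (y : P k) : P k.+1 := xget 0 [set b | bd k b = y].

Lemma preimK k y : (exists b, y = bd k b) -> bd k (preim y) = y.
Proof. by move=> [b yb]; rewrite /preim; case: xgetP => [c _ //|/(_ b)]; case. Qed.

(** A contracting homotopy, additive but not linear over the group ring. It is
    prescribed on an integral basis of a free module and restricted to P k by
    the splitting s. *)
Fixpoint contr (k : nat) : P k -> P k.+1 :=
  match k return P k -> P k.+1 with
  | 0%N => fun x => zlin (fun a h => preim
      (g 0 (basis_row a h) - x0 *~ (aug (g 0 (basis_row a h)) : int))) (s 0 x)
  | k.+1 => fun x => zlin (fun a h => preim
      (g k.+1 (basis_row a h) - contr (bd k (g k.+1 (basis_row a h))))) (s k.+1 x)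
  end.

Definition low (k : nat) : P k -> P k :=
  match k return P k -> P k with
  | 0%N => fun x => x0 *~ (aug x : int)
  | k.+1 => fun x => contr (bd k x)
  end.

Lemma contrE k x :
  contr x = zlin (fun a h => preim (g k (basis_row a h) - low (g k (basis_row a h)))) (s k x).
Proof. by case: k x. Qed.

Lemma contrB k : {morph @contr k : x y / x - y}.
Proof. by move=> x y; rewrite !contrE linearB; exact: zlinB. Qed.

Lemma contr0 k : contr (0 : P k) = 0.
Proof. by rewrite -(subrr 0) contrB subrr. Qed.

Lemma lowB k : {morph @low k : x y / x - y}.
Proof.
case: k => [|k] x y /=; last by rewrite linearB; exact: contrB.
by rewrite linearB; exact: mulrzBr.
Qed.

Lemma low_bd k x : low (bd k x) = 0.
Proof.
case: k x => [|k] x /=; last by rewrite bd_bd; exact: contr0.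
by rewrite aug_bd mulr0z.
Qed.

(** The equation for all x follows from its validity on the integral basis, as
    both sides are additive. *)
Lemma contr_step k : (k <= N)%N -> (forall y : P k, exists b, y - low y = bd k b) ->
  forall x, bd k (contr x) = x - low x.
Proof.
move=> kN imk x; rewrite contrE.
set y := (fun a h => _).
have e v : bd k (zlin y v) = g k v - low (g k v).
  apply: (additive_row_ext (f := fun v => bd k (zlin y v))
    (h := fun v => g k v - low (g k v))) => [u w|u w|a h].
  - by rewrite zlinB linearB.
  - rewrite linearB lowB !opprB addrACA [RHS]addrACA; congr (_ + _); exact: addrC.
  - by rewrite zlin_basis preimK.
by rewrite e gs.
Qed.

(** By induction: x - low x is a cycle, since the equation holds one degree
    lower, hence it is a boundary. *)
Lemma contrP k : (k <= N)%N -> forall x, bd k (contr x) = x - low x.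
Proof.
elim: k => [|k IH] kN x; apply: contr_step => // y.
  apply/res_exact0; rewrite linearB /=.
  have -> : aug (x0 *~ (aug y : int)) = aug y.
    exact: (etrans (raddfMz aug _ x0) (etrans (congr1 (fun z => z *~ _) aug_x0) (intz _))).
  exact: subrr.
by apply/res_exact; rewrite linearB /= IH ?low_bd ?subr0 ?subrr // ltnW.
Qed.

End Contraction.

Definition sign_mx (S : pzRingType) p (deg : 'I_p -> nat) : 'M[S]_p :=
  diag_mx (\row_i (-1) ^+ deg i).

(** A finitely generated projective resolution up to degree n + 1 in terms of
    matrices. All degrees are put together into one free module of rows; cm_e
    is the idempotent whose image is the resolution. In degrees at most n the
    additive map cm_h is a homotopy from cm_e to the retraction v -> aug v
    base. Since cm_h has degree one, it anticommutes with the sign of the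
    degree. *)
Record contracted_model (G : groupType) (n : nat) := ContractedModel {
  cm_p : nat;
  cm_deg : 'I_cm_p -> nat;
  cm_d : 'M[group_ring G int]_cm_p;
  cm_e : 'M[group_ring G int]_cm_p;
  cm_aug : 'I_cm_p -> trivial_mod G int;
  cm_base : 'rV[group_ring G int]_cm_p;
  cm_h : 'rV[group_ring G int]_cm_p -> 'rV[group_ring G int]_cm_p;
  cm_dd : cm_d *m cm_d = 0;
  cm_ed : cm_e *m cm_d = cm_d;
  cm_de : cm_d *m cm_e = cm_d;
  cm_ee : cm_e *m cm_e = cm_e;
  cm_d_deg : forall i j, cm_deg i != (cm_deg j).+1 -> cm_d i j = 0;
  cm_e_deg : forall i j, cm_deg i != cm_deg j -> cm_e i j = 0;
  cm_base_deg : forall j, cm_deg j != 0%N -> cm_base 0 j = 0;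
  cm_aug_deg : forall j, cm_deg j != 0%N -> cm_aug j = 0;
  cm_aug_d : forall i, \sum_j cm_d i j *: cm_aug j = 0;
  cm_base_e : cm_base *m cm_e = cm_base;
  cm_aug_base : \sum_j cm_base 0 j *: cm_aug j = 1;
  cm_hB : {morph cm_h : u v / u - v};
  cm_h_sign : forall v : 'rV[group_ring G int]_cm_p, cm_h (v *m sign_mx _ cm_deg) = - (cm_h v *m sign_mx _ cm_deg);
  cm_contr : forall v : 'rV[group_ring G int]_cm_p, (forall i, (n < cm_deg i)%N -> v 0 i = 0) ->
    cm_h v *m cm_d + cm_h (v *m cm_d) =
    v *m cm_e - cm_base *~ (\sum_i v 0 i *: cm_aug i : int) }.

Section Assembly.
Context {S : nzRingType} {N m : nat}.
Local Notation p := #|{: 'I_N.+1 * 'I_m}|.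

Definition row_deg (i : 'I_p) : nat := (enum_val i).1.

Definition assemble (F : nat -> 'rV[S]_m) : 'rV[S]_p :=
  \row_i F (row_deg i) 0 (enum_val i).2.

Definition slice (l : nat) (v : 'rV[S]_p) : 'rV[S]_m :=
  \row_a v 0 (enum_rank (inord l : 'I_N.+1, a)).

Lemma slice_linear l : linear (slice l).
Proof. by move=> x u v; apply/rowP => a; rewrite !mxE. Qed.

HB.instance Definition _ l := GRing.isLinear.Build _ _ _ _ (slice l) (slice_linear l).

Lemma row_deg_le i : (row_deg i <= N)%N.
Proof. by rewrite -ltnS; exact: ltn_ord. Qed.

Lemma slice_assemble l F : (l <= N)%N -> slice l (assemble F) = F l.
Proof.
by move=> lN; apply/rowP => a; rewrite !mxE /row_deg enum_rankK /= inordK.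
Qed.

Lemma slice_ext u v : (forall l, (l <= N)%N -> slice l u = slice l v) -> u = v.
Proof.
move=> uv; apply/rowP => i; have := uv _ (row_deg_le i).
move=> /rowP /(_ (enum_val i).2); rewrite !mxE /row_deg inord_val.
by rewrite -surjective_pairing enum_valK.
Qed.

Lemma slice_delta l i : (l <= N)%N -> row_deg i != l -> slice l (delta_mx 0 i) = 0.
Proof.
move=> lN il; apply/rowP => a; rewrite !mxE eqxx /=; case: eqP => // e.
by move: il; rewrite -e /row_deg enum_rankK /= inordK ?eqxx.
Qed.

Lemma slice_eq0 l (v : 'rV[S]_p) : (l <= N)%N -> (forall i, row_deg i = l -> v 0 i = 0) -> slice l v = 0.
Proof.
move=> lN v0; apply/rowP => a; rewrite !mxE v0 //.
by rewrite /row_deg enum_rankK /= inordK.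
Qed.

End Assembly.

Section ModelOfResolution.
Context {G : groupType} (P : resolution (trivial_mod G int)) (n m : nat).
Local Notation N := n.+1.
Local Notation ZG := (group_ring G int).
Local Notation bd := (@res_diff _ _ P).
Local Notation aug := (res_aug P).
Context (g : forall k, {linear 'rV[ZG]_m -> P k}) (s : forall k, {linear P k -> 'rV[ZG]_m}).
Context (gs : forall k, (k <= N)%N -> forall x, g k (s k x) = x).
Context (x0 : P 0%N).
Context (aug_x0 : aug x0 = 1).
Local Notation p := #|{: 'I_N.+1 * 'I_m}|.
Local Notation W := 'rV[ZG]_p.
Local Notation sl := (slice (N := N) (m := m)).
Local Notation c := (contr g s x0).

Definition tot_d (v : W) : W := assemble (fun k =>
  if (k < N)%N then s k (bd k (g k.+1 (sl k.+1 v))) else 0).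

Definition tot_e (v : W) : W := assemble (fun k => s k (g k (sl k v))).

Definition tot_h (v : W) : W := assemble (fun k =>
  if k is k'.+1 then s k'.+1 (c (g k' (sl k' v))) else 0).

Definition tot_base : W := assemble (fun k =>
  match k return 'rV[ZG]_m with 0%N => s 0 x0 | _ => 0 end).

Lemma tot_d_linear : linear tot_d.
Proof.
move=> x u v; apply: slice_ext => l lN; rewrite linearP /= !slice_assemble //.
by case: (l < N)%N; [rewrite !linearP|rewrite scaler0 addr0].
Qed.

Lemma tot_e_linear : linear tot_e.
Proof.
move=> x u v; apply: slice_ext => l lN; rewrite [RHS]linearP /= !slice_assemble //.
by rewrite !linearP /=.
Qed.

HB.instance Definition _ := GRing.isLinear.Build _ _ _ _ tot_d tot_d_linear.
HB.instance Definition _ := GRing.isLinear.Build _ _ _ _ tot_e tot_e_linear.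

Definition tot_aug (i : 'I_p) : trivial_mod G int := aug (g 0 (sl 0 (delta_mx 0 i))).

Lemma sum_tot_aug (v : W) : \sum_i v 0 i *: tot_aug i = aug (g 0 (sl 0 v)).
Proof.
rewrite [in RHS](row_sum_delta v) !linear_sum; apply: eq_bigr => i _.
by rewrite !linearZ.
Qed.

Lemma slice_d l v : (l <= N)%N ->
  sl l (tot_d v) = if (l < N)%N then s l (bd l (g l.+1 (sl l.+1 v))) else 0.
Proof. exact: slice_assemble. Qed.

Lemma slice_e l v : (l <= N)%N -> sl l (tot_e v) = s l (g l (sl l v)).
Proof. exact: slice_assemble. Qed.

Lemma slice_h l v : (l < N)%N -> sl l.+1 (tot_h v) = s l.+1 (c (g l (sl l v))).
Proof. exact: slice_assemble. Qed.

Lemma slice_h0 v : sl 0 (tot_h v) = 0.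
Proof. exact: slice_assemble. Qed.

Lemma tot_dd v : tot_d (tot_d v) = 0.
Proof.
apply: slice_ext => l lN; rewrite slice_d // linear0; case: ifP => // l1.
rewrite slice_d //; case: ifP => l2; last by rewrite !linear0.
by rewrite gs // bd_bd linear0.
Qed.

Lemma tot_de v : tot_e (tot_d v) = tot_d v.
Proof.
apply: slice_ext => l lN; rewrite slice_e // slice_d //.
by case: ifP => _; rewrite ?gs // !linear0.
Qed.

Lemma tot_ed v : tot_d (tot_e v) = tot_d v.
Proof.
apply: slice_ext => l lN; rewrite !slice_d //; case: ifP => // l1.
by rewrite slice_e // gs.
Qed.

Lemma tot_ee v : tot_e (tot_e v) = tot_e v.
Proof. by apply: slice_ext => l lN; rewrite !slice_e // gs. Qed.

Lemma tot_hB : {morph tot_h : u v / u - v}.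
Proof.
move=> u v; apply: slice_ext => -[|l] lN; rewrite [RHS]linearB /=.
  by rewrite !slice_h0 subrr.
by rewrite !slice_h // -linearB -(contrB g s x0) -!linearB.
Qed.

Lemma tot_contr v : sl N v = 0 ->
  tot_d (tot_h v) + tot_h (tot_d v) = tot_e v - tot_base *~ (aug (g 0 (sl 0 v)) : int).
Proof.
move=> vN; apply: slice_ext => l lN; rewrite linearD linearB /= slice_d // slice_e //.
have slz (w : W) (z : int) k : sl k (w *~ z) = sl k w *~ z by exact: raddfMz.
rewrite slz.
have [lN'|] := ltnP l N; last first.
  move=> Nl; have e : l = N by apply/eqP; rewrite eqn_leq lN Nl.
  subst l; rewrite vN !linear0 slice_h // slice_d // leqnn vN !linear0 (contr0 g s x0) linear0.
  by rewrite slice_assemble // mul0rz subrr addr0.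
rewrite (slice_h v lN').
rewrite (gs lN').
rewrite (contrP gs aug_x0 lN).
case: l lN lN' => [|l] lN lN'.
  by rewrite slice_h0 addr0 /= linearB slice_assemble // raddfMz.
rewrite (slice_h _ lN) slice_d ?(ltnW lN) // lN.
rewrite (gs (ltnW lN)) linearB.
by rewrite subrK [sl _ tot_base]slice_assemble // mul0rz subr0.
Qed.

Lemma slice_sign l (v : W) : (l <= N)%N ->
  sl l (v *m sign_mx ZG row_deg) = if odd l then - sl l v else sl l v.
Proof.
move=> lN; apply/rowP => a; rewrite mxE mul_mx_diag !mxE.
rewrite {1}/row_deg enum_rankK /= inordK // -signr_odd.
by case: (odd l); rewrite ?mxE ?expr1 ?expr0 ?mulr1 ?mulrN1.
Qed.

Lemma contrN k (x : P k) : c (- x) = - c x.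
Proof. by rewrite -sub0r contrB contr0 sub0r. Qed.

Lemma tot_h_sign (v : W) : tot_h (v *m sign_mx ZG row_deg) = - (tot_h v *m sign_mx ZG row_deg).
Proof.
apply: slice_ext => -[|l] lN; rewrite [RHS]linearN /= [in RHS](slice_sign _ lN).
  by rewrite !slice_h0 oppr0.
rewrite !(slice_h _ lN) (slice_sign _ (ltnW lN)) /=.
by case: (odd l) => /=; [rewrite linearN contrN linearN|rewrite opprK].
Qed.

Lemma mul_tot_d (v : W) : v *m lin1_mx tot_d = tot_d v.
Proof. exact: mul_rV_lin1. Qed.

Lemma mul_tot_e (v : W) : v *m lin1_mx tot_e = tot_e v.
Proof. exact: mul_rV_lin1. Qed.

Lemma mx_ext (A B : 'M[ZG]_p) : (forall v : W, v *m A = v *m B) -> A = B.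
Proof. by move=> AB; apply/row_matrixP => i; rewrite !rowE. Qed.

Definition tot_model : contracted_model G n.
Proof.
apply: (@ContractedModel G n p row_deg (lin1_mx tot_d) (lin1_mx tot_e) tot_aug
  tot_base tot_h).
- by apply: mx_ext => v; rewrite mulmxA !mul_tot_d tot_dd mulmx0.
- by apply: mx_ext => v; rewrite mulmxA mul_tot_e !mul_tot_d tot_ed.
- by apply: mx_ext => v; rewrite mulmxA mul_tot_d mul_tot_e tot_de.
- by apply: mx_ext => v; rewrite mulmxA !mul_tot_e tot_ee.
- move=> i j ij; rewrite !mxE /=; case: ifP => jN; last by rewrite mxE.
  by rewrite slice_delta // !linear0 mxE.
- move=> i j ij; rewrite !mxE /=.
  by rewrite slice_delta ?row_deg_le // !linear0 mxE.
- by move=> j; rewrite mxE; case: (row_deg j) => // k _; rewrite mxE.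
- by move=> j j0; rewrite /tot_aug slice_delta // !linear0.
- move=> i; transitivity (\sum_j (tot_d (delta_mx 0 i)) 0 j *: tot_aug j).
    by apply: eq_bigr => j _; rewrite mxE.
  by rewrite sum_tot_aug slice_d // gs // aug_bd.
- rewrite mul_tot_e; apply: slice_ext => l lN; rewrite slice_e // slice_assemble //.
  by case: l lN => [|l] lN; rewrite ?gs // !linear0.
- by rewrite sum_tot_aug slice_assemble // gs.
- exact: tot_hB.
- exact: tot_h_sign.
- move=> v v0; rewrite !mul_tot_d mul_tot_e sum_tot_aug; apply: tot_contr.
  by apply: slice_eq0 => // i iN; apply: v0; rewrite iN.
Defined.

End ModelOfResolution.

(** Choosing the same large number m of generators in all degrees up to n + 1
    makes the total module one of rows of fixed length. *)
Lemma contracted_model_exists (G : groupType) n :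
  type_FP n.+1 G -> inhabited (contracted_model G n).
Proof.
move=> [P [projP fgP]].
have /choice[m0 m0P] : forall k, exists m0, (k <= n.+1)%N -> forall m, (m0 <= m)%N ->
    exists (g : {linear 'rV[group_ring G int]_m -> P k})
           (s : {linear P k -> 'rV[group_ring G int]_m}), forall x, g (s x) = x.
  move=> k; case: (leqP k n.+1) => [kn|]; last by exists 0%N.
  by have [m0 h] := fg_projective_split (fgP _ kn) (projP k); exists m0.
pose m := (\max_(k < n.+2) m0 k)%N.
have /cid2[x0 _ aug_x0] : exists2 x0, True & res_aug P x0 = 1.
  by have [x0 e] := res_aug_surj P 1; exists x0.
have split k : exists gs : {linear 'rV[group_ring G int]_m -> P k} *
    {linear P k -> 'rV[group_ring G int]_m}, (k <= n.+1)%N ->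
    forall x, gs.1 (gs.2 x) = x.
  case: (leqP k n.+1) => [kn|]; last first.
    by exists ((\0 : {linear 'rV[group_ring G int]_m -> P k}),
             (\0 : {linear P k -> 'rV[group_ring G int]_m})).
  have [|g [s gs]] := m0P k kn m; last by exists (g, s).
  exact: (leq_bigmax (Ordinal (kn : (k < n.+2)%N))).
pose gs k := projT1 (cid (split k)).
have gsP k : (k <= n.+1)%N -> forall x, (gs k).1 ((gs k).2 x) = x.
  exact: (projT2 (cid (split k))).
by constructor; apply: (tot_model (g := fun k => (gs k).1) (s := fun k => (gs k).2) gsP aug_x0).
Qed.

(** * The tensor product of two models *)

Lemma malg_additive_ext (K : choiceType) (A V : zmodType) (f h : malg K A -> V) :
  {morph f : x y / x + y} -> {morph h : x y / x + y} ->
  (forall a g, f << a *g g >> = h << a *g g >>) -> forall x, f x = h x.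
Proof.
move=> fD hD fh; apply: malg_ind => [|x y ex ey|//]; last by rewrite fD hD ex ey.
by rewrite (additive0 fD) (additive0 hD).
Qed.

Lemma mulr_shuffle (S : pzRingType) (a b c d : S) :
  b * c = c * b -> (a * b) * (c * d) = (a * c) * (b * d).
Proof. by move=> bc; rewrite -!mulrA; congr (_ * _); rewrite !mulrA bc. Qed.

Section GroupRingMorphism.
Context {H G : groupType} {A : comNzRingType} (f : H -> G).
Local Notation ZH := (group_ring H int).
Local Notation AG := (group_ring G A).

(** Induced by a map f of groups and by the map from the integers to A. *)
Definition gr_map (x : ZH) : AG := msum (fun h (a : int) => << a%:~R *g f h >> : AG) x.

Let hD h : {morph (fun a : int => << a%:~R *g f h >> : AG) : a b / a + b}.
Proof. by move=> a b /=; rewrite rmorphD monalg.monalgUD. Qed.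

Lemma gr_mapD : {morph gr_map : x y / x + y}.
Proof. exact: msumD. Qed.

Lemma gr_map0 : gr_map 0 = 0.
Proof. exact: msum0. Qed.

Lemma gr_mapU a h : gr_map << a *g h >> = << a%:~R *g f h >>.
Proof. exact: msumU. Qed.

Lemma gr_map_zmod : zmod_morphism gr_map.
Proof.
by move=> x y; apply/eqP; rewrite eq_sym subr_eq -gr_mapD subrK.
Qed.

Context (fM : {morph f : x y / (x * y)%g}) (f1 : f 1%g = 1%g).

Lemma gr_map_monoid : monoid_morphism gr_map.
Proof.
split=> [|x y]; first by rewrite gr_mapU f1.
move: x; apply: malg_ind => [|x x' IH IH'|a g].
- by rewrite mul0r gr_map0 mul0r.
- by rewrite mulrDl !gr_mapD mulrDl IH IH'.
move: y; apply: malg_ind => [|y y' IH IH'|b h].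
- by rewrite mulr0 gr_map0 mulr0.
- by rewrite mulrDr !gr_mapD mulrDr IH IH'.
by rewrite skewUU !gr_mapU skewUU fM rmorphM.
Qed.

End GroupRingMorphism.

Lemma additive_mulz (U V : zmodType) (f : U -> V) : zmod_morphism f ->
  forall x m, f (x *~ m) = f x *~ m.
Proof.
move=> fB x m; pose F := GRing.isZmodMorphism.Build U V f fB.
by pose f' : {additive U -> V} := HB.pack f F; exact: (raddfMz f').
Qed.

Lemma pair_mul (G1 G2 : groupType) (g g' : G1) (h h' : G2) :
  (((g, h) : (G1 * G2)%type) * (g', h') = (g * g', h * h'))%g.
Proof. by []. Qed.

Section ExternalProduct.
Context {G1 G2 : groupType} {A : comNzRingType}.
Local Notation Z1 := (group_ring G1 int).
Local Notation Z2 := (group_ring G2 int).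
Local Notation AG := (group_ring (G1 * G2)%type A).

Definition ginl : Z1 -> AG := gr_map (fun g : G1 => (g, 1%g) : (G1 * G2)%type).
Definition ginr : Z2 -> AG := gr_map (fun h : G2 => (1%g, h) : (G1 * G2)%type).

HB.instance Definition _ := GRing.isZmodMorphism.Build _ _ ginl (gr_map_zmod _).
HB.instance Definition _ := GRing.isZmodMorphism.Build _ _ ginr (gr_map_zmod _).

Lemma ginl_monoid : monoid_morphism ginl.
Proof.
apply: gr_map_monoid => // g h; rewrite -[in LHS](mulg1 (1%g : G2)) //.
Qed.

Lemma ginr_monoid : monoid_morphism ginr.
Proof.
apply: gr_map_monoid => // g h; rewrite -[in LHS](mulg1 (1%g : G1)) //.
Qed.

HB.instance Definition _ := GRing.isMonoidMorphism.Build _ _ ginl ginl_monoid.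
HB.instance Definition _ := GRing.isMonoidMorphism.Build _ _ ginr ginr_monoid.

Lemma ginlU a g : ginl << a *g g >> = << a%:~R *g (g, 1%g) >>.
Proof. exact: gr_mapU. Qed.

Lemma ginrU a g : ginr << a *g g >> = << a%:~R *g (1%g, g) >>.
Proof. exact: gr_mapU. Qed.

Lemma ginl_ginrU (a : int) g (b : int) h :
  ginl << a *g g >> * ginr << b *g h >> = << (a * b)%:~R *g (g, h) >>.
Proof.
rewrite ginlU ginrU skewUU rmorphM pair_mul.
by rewrite mulg1 mul1g.
Qed.

Lemma ginr_ginlU (a : int) g (b : int) h :
  ginr << b *g h >> * ginl << a *g g >> = << (a * b)%:~R *g (g, h) >>.
Proof.
rewrite ginlU ginrU skewUU rmorphM mulrC pair_mul.
by rewrite mulg1 mul1g.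
Qed.

Lemma ginl_ginrC x y : ginl x * ginr y = ginr y * ginl x.
Proof.
apply: (malg_additive_ext (f := fun x => ginl x * ginr y) (h := fun x => ginr y * ginl x)).
- by move=> x1 x2; rewrite raddfD; exact: mulrDl.
- by move=> x1 x2; rewrite raddfD; exact: mulrDr.
move=> a g; apply: (malg_additive_ext (f := fun y => ginl _ * ginr y)
  (h := fun y => ginr y * ginl _)).
- by move=> y1 y2; rewrite raddfD; exact: mulrDr.
- by move=> y1 y2; rewrite raddfD; exact: mulrDl.
by move=> b h; rewrite ginl_ginrU ginr_ginlU.
Qed.

Lemma ginl_ginrM x y x' y' :
  (ginl x * ginr y) * (ginl x' * ginr y') = ginl (x * x') * ginr (y * y').
Proof.
rewrite (rmorphM ginl) (rmorphM ginr); apply: mulr_shuffle; exact/esym/ginl_ginrC.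
Qed.

Definition scal (a : A) : AG := << a *g 1%g >>.

Lemma scalD : {morph scal : a b / a + b}.
Proof. by move=> a b; rewrite /scal monalg.monalgUD. Qed.

Lemma scal0 : scal 0 = 0.
Proof. exact: monalg.monalgU0. Qed.

Lemma scalM a b : scal a * scal b = scal (a * b).
Proof. by rewrite /scal skewUU mulg1. Qed.

Lemma scalMU a b g : scal a * << b *g g >> = << a * b *g g >>.
Proof. by rewrite /scal skewUU mul1g. Qed.

Lemma scal_int (m : int) : scal m%:~R = 1 *~ m.
Proof. exact: (raddfMz (monalg.mkmalgU (1%g : (G1 * G2)%type)) m (1 : A)). Qed.

Lemma vert_ginl_ginr x y :
  vert (ginl x * ginr y) = scal (x *: (1 : trivial_mod G1 int) : int)%:~R * ginr y.
Proof.
apply: (malg_additive_ext (f := fun x => vert (ginl x * ginr y))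
  (h := fun x : Z1 => scal (x *: (1 : trivial_mod G1 int) : int)%:~R * ginr y)).
- by move=> x1 x2; rewrite raddfD mulrDl; exact: vertD.
- by move=> x1 x2; rewrite scalerDl rmorphD scalD; exact: mulrDl.
move=> a g; apply: (malg_additive_ext (f := fun y => vert (ginl _ * ginr y))
  (h := fun y => scal _ * ginr y)).
- by move=> y1 y2; rewrite raddfD mulrDr; exact: vertD.
- by move=> y1 y2; rewrite raddfD; exact: mulrDr.
by move=> b h; rewrite ginl_ginrU vertU ginrU gr_scaleU mulr1 scalMU -rmorphM.
Qed.

Lemma ginl_ginr_scale x y (s : trivial_mod G1 int) (t : trivial_mod G2 int) :
  (ginl x * ginr y) *: ((s * t : int)%:~R : trivial_mod (G1 * G2)%type A) =
  ((x *: s : int) * (y *: t : int))%:~R.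
Proof.
apply: (malg_additive_ext
  (f := fun x => (ginl x * ginr y) *: ((s * t : int)%:~R : trivial_mod (G1 * G2)%type A))
  (h := fun x : Z1 => ((x *: s : int) * (y *: t : int))%:~R : trivial_mod (G1 * G2)%type A)).
- by move=> x1 x2; rewrite raddfD mulrDl; exact: scalerDl.
- by move=> x1 x2; rewrite scalerDl mulrDl; exact: rmorphD.
move=> a g; apply: (malg_additive_ext
  (f := fun y => (ginl _ * ginr y) *: (_ : trivial_mod (G1 * G2)%type A))
  (h := fun y : Z2 => (_ * (y *: t : int))%:~R : trivial_mod (G1 * G2)%type A)).
- by move=> y1 y2; rewrite raddfD mulrDr; exact: scalerDl.
- by move=> y1 y2; rewrite scalerDl mulrDr; exact: rmorphD.
move=> b h; rewrite ginl_ginrU !gr_scaleU -rmorphM; congr (_ %:~R).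
by rewrite mulrACA.
Qed.

End ExternalProduct.

Section Kronecker.
Context {S1 S2 S : nzRingType} (l : {rmorphism S1 -> S}) (r : {rmorphism S2 -> S}).
Context (lrM : forall x y x' y', (l x * r y) * (l x' * r y') = l (x * x') * r (y * y')).
Context {p q : nat}.
Local Notation I := #|{: 'I_p * 'I_q}|.

Definition kron_row (x : 'rV[S1]_p) (y : 'rV[S2]_q) : 'rV[S]_I :=
  \row_k (l (x 0 (enum_val k).1) * r (y 0 (enum_val k).2)).

Definition kron (u : 'M[S1]_p) (v : 'M[S2]_q) : 'M[S]_I :=
  \matrix_(k, k') (l (u (enum_val k).1 (enum_val k').1) * r (v (enum_val k).2 (enum_val k').2)).

Lemma sum_enum_pair (V : zmodType) (F : 'I_p -> 'I_q -> V) :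
  \sum_(k < I) F (enum_val k).1 (enum_val k).2 = \sum_i \sum_j F i j.
Proof.
rewrite pair_bigA /= [RHS](reindex (enum_val : 'I_I -> 'I_p * 'I_q)) //=.
exact/onW_bij/enum_val_bij.
Qed.

Lemma sum_kron (x : 'I_p -> S1) (y : 'I_q -> S2) (x' : 'I_p -> S1) (y' : 'I_q -> S2) :
  \sum_(k < I) (l (x (enum_val k).1) * r (y (enum_val k).2)) *
               (l (x' (enum_val k).1) * r (y' (enum_val k).2)) =
  l (\sum_i x i * x' i) * r (\sum_j y j * y' j).
Proof.
rewrite (sum_enum_pair (fun i j => (l (x i) * r (y j)) * (l (x' i) * r (y' j)))).
rewrite !rmorph_sum mulr_suml; apply: eq_bigr => i _.
by rewrite mulr_sumr; apply: eq_bigr => j _; exact: lrM.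
Qed.

Lemma kron_row_mul x y u v : kron_row x y *m kron u v = kron_row (x *m u) (y *m v).
Proof.
apply/rowP => k; rewrite !mxE -sum_kron.
by apply: eq_bigr => k' _; rewrite !mxE.
Qed.

Lemma kron_mul u v u' v' : kron u v *m kron u' v' = kron (u *m u') (v *m v').
Proof.
apply/matrixP => k k'; rewrite !mxE -sum_kron.
by apply: eq_bigr => k'' _; rewrite !mxE.
Qed.

Lemma kronDl u u' v : kron (u + u') v = kron u v + kron u' v.
Proof. by apply/matrixP => k k'; rewrite !mxE rmorphD mulrDl. Qed.

Lemma kron0l v : kron 0 v = 0.
Proof. by apply/matrixP => k k'; rewrite !mxE rmorph0 mul0r. Qed.

Lemma kron0r u : kron u 0 = 0.
Proof. by apply/matrixP => k k'; rewrite !mxE rmorph0 mulr0. Qed.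

Lemma kron_rowBl y : {morph kron_row^~ y : x x' / x - x'}.
Proof. by move=> x x'; apply/rowP => k; rewrite !mxE rmorphB mulrBl. Qed.

Lemma kron_rowBr x : {morph kron_row x : y y' / y - y'}.
Proof. by move=> y y'; apply/rowP => k; rewrite !mxE rmorphB mulrBr. Qed.

Lemma kron_rowDl y : {morph kron_row^~ y : x x' / x + x'}.
Proof. by move=> x x'; apply/rowP => k; rewrite !mxE rmorphD mulrDl. Qed.

Lemma kron_row0l y : kron_row 0 y = 0.
Proof. by have := kron_rowBl y 0 0; rewrite /= !subrr. Qed.

Lemma kron_rowDr x : {morph kron_row x : y y' / y + y'}.
Proof. by move=> y y'; apply/rowP => k; rewrite !mxE rmorphD mulrDr. Qed.

(** Bilinearity in the form in which the contraction identities of two factors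
    combine to that of their tensor product. *)
Lemma kron_row_collect a b c u y z w v : a + b = u - c -> z + w = y - v ->
  (kron_row a y + kron_row b y) + (kron_row c z + kron_row c w) =
  kron_row u y - kron_row c v.
Proof.
move=> ab zw; rewrite -kron_rowDl -kron_rowDr ab zw kron_rowBl kron_rowBr.
by rewrite addrA subrK.
Qed.

Lemma kron_rowZ x y (s t : int) : kron_row (x *~ s) (y *~ t) = kron_row x y *~ (s * t).
Proof.
rewrite (additive_mulz (kron_rowBr (x *~ s))).
by rewrite (additive_mulz (f := kron_row^~ y) (kron_rowBl y)) mulrzA.
Qed.

Lemma kron_row_delta s t (k : 'I_I) :
  kron_row (s *: delta_mx 0 (enum_val k).1) (t *: delta_mx 0 (enum_val k).2) =
  (l s * r t) *: delta_mx 0 k.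
Proof.
apply/rowP => k'; rewrite !mxE !eqxx /=.
have [->|kk'] := eqVneq k' k; first by rewrite !eqxx !mulr1.
rewrite [RHS]mulr0.
have [e1|_] := eqVneq (enum_val k').1 (enum_val k).1; last first.
  by rewrite mulr0 rmorph0 mul0r.
have [e2|_] := eqVneq (enum_val k').2 (enum_val k).2; last first.
  by rewrite mulr0 rmorph0 mulr0.
case/eqP: kk'; apply: enum_val_inj; rewrite [LHS]surjective_pairing [RHS]surjective_pairing.
by rewrite e1 e2.
Qed.

End Kronecker.

Section SignsAndDegrees.
Context {S : nzRingType} {p : nat} (deg : 'I_p -> nat).

Lemma mul_sign_mxE m (v : 'M[S]_(m, p)) i j : (v *m sign_mx S deg) i j = v i j * (-1) ^+ deg j.
Proof. by rewrite mul_mx_diag !mxE. Qed.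

Lemma sign_mx_mulE (v : 'M[S]_p) i j : (sign_mx S deg *m v) i j = (-1) ^+ deg i * v i j.
Proof. by rewrite mul_diag_mx !mxE. Qed.

(** Right multiplication by u lowers degrees by s. *)
Definition graded (s : nat) (u : 'M[S]_p) := forall i j, deg i != (deg j + s)%N -> u i j = 0.

Lemma sign_mx_graded1 u : graded 1 u -> sign_mx S deg *m u = - (u *m sign_mx S deg).
Proof.
move=> ud; apply/matrixP => i j; rewrite sign_mx_mulE mxE mul_sign_mxE.
have [e|/ud->] := eqVneq (deg i) (deg j + 1)%N; last by rewrite mulr0 mul0r oppr0.
by rewrite e addn1 exprS mulN1r mulNr -signr_odd (commr_sign (u i j)).
Qed.

Lemma sign_mx_graded0 u : graded 0 u -> sign_mx S deg *m u = u *m sign_mx S deg.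
Proof.
move=> ud; apply/matrixP => i j; rewrite sign_mx_mulE mul_sign_mxE.
have [e|/ud->] := eqVneq (deg i) (deg j + 0)%N; last by rewrite mulr0 mul0r.
by rewrite e addn0 -signr_odd (commr_sign (u i j)).
Qed.

Definition proj_deg (k : nat) (v : 'rV[S]_p) : 'rV[S]_p :=
  \row_i if deg i == k then v 0 i else 0.

Lemma proj_deg_mul s u k v : graded s u ->
  proj_deg (k + s) v *m u = proj_deg k (v *m u).
Proof.
move=> ud; apply/rowP => j; rewrite !mxE; have [e|e] := eqVneq (deg j) k.
  apply: eq_bigr => i _; rewrite mxE; case: eqP => // /eqP ne.
  by rewrite mul0r ud ?mulr0 // e.
apply: big1 => i _; rewrite mxE; case: eqP => [ne|]; last by rewrite mul0r.
by rewrite ud ?mulr0 // ne eqn_add2r eq_sym.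
Qed.

Lemma proj_deg_id k (v : 'rV[S]_p) : (forall i, deg i != k -> v 0 i = 0) -> proj_deg k v = v.
Proof.
by move=> v0; apply/rowP => i; rewrite mxE; case: eqP => // /eqP /v0.
Qed.

Lemma proj_deg_out k (v : 'rV[S]_p) i : deg i != k -> proj_deg k v 0 i = 0.
Proof. by move=> ik; rewrite mxE (negbTE ik). Qed.

End SignsAndDegrees.

Section TensorComplex.
Context {S1 S2 S : nzRingType} (l : {rmorphism S1 -> S}) (r : {rmorphism S2 -> S}).
Context (lrM : forall x y x' y', (l x * r y) * (l x' * r y') = l (x * x') * r (y * y')).
Context {p q : nat} (deg1 : 'I_p -> nat) (deg2 : 'I_q -> nat).
Context {d1 e1 : 'M[S1]_p} {d2 e2 : 'M[S2]_q}.
Context (d1_graded : graded deg1 1 d1) (d2_graded : graded deg2 1 d2).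
Context (e1_graded : graded deg1 0 e1) (e2_graded : graded deg2 0 e2).
Context (d1d1 : d1 *m d1 = 0) (d2d2 : d2 *m d2 = 0).
Context (d1e1 : d1 *m e1 = d1) (e1d1 : e1 *m d1 = d1).
Context (d2e2 : d2 *m e2 = d2) (e2d2 : e2 *m d2 = d2).
Local Notation I := #|{: 'I_p * 'I_q}|.

Definition tdeg (k : 'I_I) : nat := (deg1 (enum_val k).1 + deg2 (enum_val k).2)%N.

(** The second summand carries the Koszul sign of the first factor. *)
Definition tdiff (d : 'M[S1]_p) (d' : 'M[S2]_q) : 'M[S]_I :=
  kron l r d 1%:M + kron l r (sign_mx S1 deg1) d'.

Lemma tdiffE d d' k k' : tdiff d d' k k' =
  l (d (enum_val k).1 (enum_val k').1) *
    r ((1%:M : 'M[S2]_q) (enum_val k).2 (enum_val k').2) +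
  l (sign_mx S1 deg1 (enum_val k).1 (enum_val k').1) *
    r (d' (enum_val k).2 (enum_val k').2).
Proof. by rewrite /tdiff mxE; congr (_ + _); rewrite mxE. Qed.

Lemma kron_row_tdiff u v : kron_row l r u v *m tdiff d1 d2 =
  kron_row l r (u *m d1) v + kron_row l r (u *m sign_mx S1 deg1) (v *m d2).
Proof. by rewrite mulmxDr !(kron_row_mul lrM) mulmx1. Qed.

Lemma tdiff_tdiff : tdiff d1 d2 *m tdiff d1 d2 = 0.
Proof.
rewrite mulmxDr !mulmxDl !(kron_mul lrM) !mulmx1 !mul1mx d1d1 d2d2.
rewrite kron0l kron0r add0r addr0 (sign_mx_graded1 d1_graded).
by rewrite -kronDl addNr kron0l.
Qed.

Lemma tdiff_kron : tdiff d1 d2 *m kron l r e1 e2 = kron l r e1 e2 *m tdiff d1 d2.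
Proof.
rewrite mulmxDr mulmxDl !(kron_mul lrM) !mulmx1 !mul1mx d1e1 e1d1 d2e2 e2d2.
by rewrite (sign_mx_graded0 e1_graded).
Qed.

Lemma tdiff_graded : graded tdeg 1 (tdiff d1 d2).
Proof.
move=> k k' kk'; rewrite !mxE; move: kk'; rewrite /tdeg.
set i := (enum_val k).1; set j := (enum_val k).2.
set i' := (enum_val k').1; set j' := (enum_val k').2 => kk'.
have [e|ij] := eqVneq (deg1 i) (deg1 i' + 1)%N.
  have jj' : j != j'.
    by apply: contra_neq kk' => ->; rewrite e; lia.
  have ii' : i != i' by apply: contra_eq_neq e => ->; lia.
  by rewrite (negbTE ii') (negbTE jj') mulr0n rmorph0 mulr0 add0r mulr0n rmorph0 mul0r.
rewrite (d1_graded ij) rmorph0 mul0r add0r.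
have [ii'|ii'] := eqVneq i i'; last by rewrite mulr0n rmorph0 mul0r.
rewrite (d2_graded (i := j) (j := j')) ?rmorph0 ?mulr0 //.
by apply: contra kk' => /eqP ->; rewrite ii' addnA.
Qed.

Lemma kron_graded : graded tdeg 0 (kron l r e1 e2).
Proof.
move=> k k'; rewrite addn0 /tdeg !mxE => kk'.
have [e|ij] := eqVneq (deg1 (enum_val k).1) (deg1 (enum_val k').1); last first.
  by rewrite e1_graded ?addn0 // rmorph0 mul0r.
rewrite e2_graded ?addn0 ?rmorph0 ?mulr0 //.
by apply: contra kk' => /eqP ->; rewrite e.
Qed.

Lemma kron_row_deg (u : 'rV[S1]_p) (v : 'rV[S2]_q) k : (forall i, deg1 i != 0%N -> u 0 i = 0) ->
  (forall j, deg2 j != 0%N -> v 0 j = 0) -> tdeg k != 0%N -> kron_row l r u v 0 k = 0.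
Proof.
move=> u0 v0; rewrite /tdeg addn_eq0 negb_and mxE => /orP[/u0|/v0] ->.
  by rewrite rmorph0 mul0r.
by rewrite rmorph0 mulr0.
Qed.

End TensorComplex.

Lemma cm_d_graded (G : groupType) n (M : contracted_model G n) :
  graded (@cm_deg _ _ M) 1 (cm_d M).
Proof. by move=> i j; rewrite addn1; exact: cm_d_deg. Qed.

Lemma cm_e_graded (G : groupType) n (M : contracted_model G n) :
  graded (@cm_deg _ _ M) 0 (cm_e M).
Proof. by move=> i j; rewrite addn0; exact: cm_e_deg. Qed.

Section ProductContraction.
Context {G1 G2 : groupType} (A : comNzRingType) {n : nat}.
Context (M1 : contracted_model G1 n) (M2 : contracted_model G2 n).
Local Notation Z1 := (group_ring G1 int).
Local Notation Z2 := (group_ring G2 int).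
Local Notation AG := (group_ring (G1 * G2)%type A).
Local Notation l := (ginl : {rmorphism Z1 -> AG}).
Local Notation r := (ginr : {rmorphism Z2 -> AG}).
Local Notation p1 := (cm_p M1).
Local Notation p2 := (cm_p M2).
Local Notation I := #|{: 'I_p1 * 'I_p2}|.
Local Notation deg1 := (@cm_deg _ _ M1).
Local Notation deg2 := (@cm_deg _ _ M2).
Local Notation sg := (sign_mx Z1 deg1).
Local Notation ext := (kron_row l r).
Local Notation d1 := (cm_d M1).
Local Notation d2 := (cm_d M2).
Local Notation e1 := (cm_e M1).
Local Notation e2 := (cm_e M2).
Local Notation D := (tdiff l r deg1 d1 d2).
Local Notation E := (kron l r e1 e2).
Local Notation deg := (tdeg deg1 deg2).
Local Notation base := (ext (cm_base M1) (cm_base M2)).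

Definition taug (k : 'I_I) : trivial_mod (G1 * G2)%type A :=
  (cm_aug (enum_val k).1 * cm_aug (enum_val k).2 : int)%:~R.

Definition augv (G : groupType) (B : comNzRingType) p (w : 'I_p -> trivial_mod G B)
  (u : 'rV[group_ring G B]_p) : B := \sum_i u 0 i *: w i.

Lemma ext_diff u v : ext u v *m D = ext (u *m d1) v + ext (u *m sg) (v *m d2).
Proof. exact: (kron_row_tdiff ginl_ginrM). Qed.

Lemma ext_idem u v : ext u v *m E = ext (u *m e1) (v *m e2).
Proof. exact: (kron_row_mul ginl_ginrM). Qed.

Lemma tensor_diff_diff : D *m D = 0.
Proof. exact: (tdiff_tdiff ginl_ginrM (@cm_d_graded _ _ M1) (cm_dd M1) (cm_dd M2)). Qed.

Lemma tensor_diff_idem : D *m E = E *m D.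
Proof.
exact: (tdiff_kron ginl_ginrM (@cm_e_graded _ _ M1) (cm_de M1) (cm_ed M1) (cm_de M2) (cm_ed M2)).
Qed.

Lemma tensor_idem_idem : E *m E = E.
Proof. by apply: etrans (kron_mul ginl_ginrM _ _ _ _) _; congr kron; exact: cm_ee. Qed.

Lemma base_idem : base *m E = base.
Proof. by apply: etrans (ext_idem _ _) _; congr kron_row; exact: cm_base_e. Qed.

Lemma tensor_diff_graded : graded deg 1 D.
Proof. exact: (tdiff_graded _ _ (@cm_d_graded _ _ M1) (@cm_d_graded _ _ M2)). Qed.

Lemma tensor_idem_graded : graded deg 0 E.
Proof. exact: (kron_graded _ _ (@cm_e_graded _ _ M1) (@cm_e_graded _ _ M2)). Qed.

Lemma base_deg k : deg k != 0%N -> base 0 k = 0.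
Proof. exact: (kron_row_deg _ _ (@cm_base_deg _ _ M1) (@cm_base_deg _ _ M2)). Qed.

Lemma taug_deg k : deg k != 0%N -> taug k = 0.
Proof.
rewrite /tdeg /taug addn_eq0 negb_and => /orP[h|h].
  by rewrite cm_aug_deg // mul0r.
by rewrite [X in _ * X]cm_aug_deg // mulr0.
Qed.

Lemma augv_ext u v :
  augv taug (ext u v) = (augv (@cm_aug _ _ M1) u * augv (@cm_aug _ _ M2) v)%:~R.
Proof.
transitivity (\sum_(k < I) ((u 0 (enum_val k).1 *: cm_aug (enum_val k).1 : int) *
    (v 0 (enum_val k).2 *: cm_aug (enum_val k).2 : int))%:~R : A).
  by apply: eq_bigr => k _; rewrite mxE; exact: ginl_ginr_scale.
rewrite (sum_enum_pair (fun i j =>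
  ((u 0 i *: cm_aug i : int) * (v 0 j *: cm_aug j : int))%:~R : A)).
rewrite /augv mulr_suml rmorph_sum; apply: eq_bigr => i _.
by rewrite mulr_sumr rmorph_sum.
Qed.

Lemma augv_base : augv taug base = 1.
Proof.
apply: etrans (augv_ext _ _) _.
by rewrite [augv _ (cm_base M1)]cm_aug_base [augv _ (cm_base M2)]cm_aug_base.
Qed.

Implicit Types (x : 'rV[AG]_I).

Definition base_part (u : 'rV[Z1]_p1) : 'rV[Z1]_p1 := cm_base M1 *~ augv (@cm_aug _ _ M1) u.

(** The usual contraction h1 (x) e2 + p1 (x) h2 of a tensor product, where p1
    is base_part. As h1 and h2 are additive only, it extends to all rows from
    their monomials, linearly over A: see tcontr. *)
Definition tcontr0 u v : 'rV[AG]_I :=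
  ext (cm_h u) (v *m e2) + ext (base_part u) (cm_h v).

Definition tcontr x : 'rV[AG]_I :=
  \sum_k msum (fun (g : (G1 * G2)%type) (a : A) => (scal a : AG) *:
    tcontr0 (basis_row (enum_val k).1 g.1) (basis_row (enum_val k).2 g.2)) (x 0 k).

Lemma augvB (G : groupType) (B : comNzRingType) p (w : 'I_p -> trivial_mod G B) :
  zmod_morphism (augv w).
Proof.
move=> u v; rewrite /augv -sumrB; apply: eq_bigr => i _.
by rewrite !mxE scalerBl.
Qed.

Lemma base_partB : zmod_morphism base_part.
Proof. by move=> u v; rewrite /base_part (augvB _ u v) mulrzBr. Qed.

Lemma tcontr0Bl v : zmod_morphism (tcontr0^~ v).
Proof.
move=> u u'; rewrite /tcontr0 cm_hB base_partB.
rewrite (kron_rowBl l r _ (cm_h u)) (kron_rowBl l r _ (base_part u)).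
by rewrite addrACA -opprD.
Qed.

Lemma tcontr0Br u : zmod_morphism (tcontr0 u).
Proof.
move=> v v'; rewrite /tcontr0 cm_hB mulmxBl.
rewrite (kron_rowBr l r _ (v *m e2)) (kron_rowBr l r _ (cm_h v)).
by rewrite addrACA -opprD.
Qed.

Let summandD i j : forall g : (G1 * G2)%type,
  {morph (fun a : A => (scal a : AG) *: tcontr0 (basis_row i g.1) (basis_row j g.2)) :
    a b / a + b}.
Proof. by move=> g a b /=; rewrite scalD; exact: scalerDl. Qed.

Lemma tcontrD : {morph tcontr : x y / x + y}.
Proof.
move=> x y; rewrite /tcontr -big_split; apply: eq_bigr => k _.
rewrite mxE; exact: msumD.
Qed.

Lemma tcontrB : zmod_morphism tcontr.
Proof. by move=> x y; apply/eqP; rewrite eq_sym subr_eq -tcontrD subrK. Qed.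

Lemma tcontr_delta a (g : G1) (h : G2) (k : 'I_I) :
  tcontr ((<< a *g (g, h) >> : AG) *: delta_mx 0 k) =
  (scal a : AG) *: tcontr0 (basis_row (enum_val k).1 g) (basis_row (enum_val k).2 h).
Proof.
rewrite /tcontr (bigD1 k) //= big1 ?addr0 => [|k' k'k].
  by rewrite !mxE !eqxx mulr1 msumU //; exact: summandD.
by rewrite !mxE eqxx (negbTE k'k) mulr0 msum0.
Qed.

Lemma mon_ext (a : A) (g : G1) (h : G2) (k : 'I_I) :
  (<< a *g (g, h) >> : AG) *: delta_mx 0 k =
  (scal a : AG) *: ext (basis_row (enum_val k).1 g) (basis_row (enum_val k).2 h).
Proof.
have e : << a *g (g, h) >> = (scal a : AG) * (ginl << 1 *g g >> * ginr << 1 *g h >>).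
  by rewrite ginl_ginrU mulr1 rmorph1 scalMU mulr1.
rewrite e -scalerA; congr (_ *: _); exact/esym/kron_row_delta.
Qed.

Lemma tcontr_ext (a : A) u v : tcontr ((scal a : AG) *: ext u v) = (scal a : AG) *: tcontr0 u v.
Proof.
apply: (additive_row_ext (f := fun u => tcontr ((scal a : AG) *: ext u v))
  (h := fun u => (scal a : AG) *: tcontr0 u v)) => [u1 u2|u1 u2|i g].
- by rewrite (kron_rowBl l r v u1 u2) scalerBr tcontrB.
- by rewrite (tcontr0Bl v u1 u2) scalerBr.
apply: (additive_row_ext (f := fun v => tcontr ((scal a : AG) *: ext _ v))
  (h := fun v => (scal a : AG) *: tcontr0 _ v)) => [v1 v2|v1 v2|j h].
- by rewrite (kron_rowBr l r _ v1 v2) scalerBr tcontrB.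
- by rewrite (tcontr0Br _ v1 v2) scalerBr.
have := tcontr_delta a g h (enum_rank (i, j)); rewrite mon_ext enum_rankK.
exact.
Qed.

Lemma base_part_diff u : base_part (u *m d1) = 0.
Proof.
rewrite /base_part; suff -> : augv (@cm_aug _ _ M1) (u *m d1) = 0 by exact: mulr0z.
rewrite /augv -(sum_mulmx_scale u d1 (@cm_aug _ _ M1)) big1 // => i _.
by rewrite cm_aug_d scaler0.
Qed.

Lemma base_diff0 : cm_base M1 *m d1 = 0.
Proof.
apply/rowP => j; rewrite !mxE; apply: big1 => i _.
have [i0|i0] := eqVneq (deg1 i) 0%N; last by rewrite cm_base_deg // mul0r.
by rewrite cm_d_deg ?mulr0 // i0.
Qed.

Lemma base_part_mul_diff u : base_part u *m d1 = 0.
Proof.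
rewrite /base_part (additive_mulz (f := mulmx^~ d1) (fun a b => mulmxBl a b d1)).
by rewrite base_diff0 mul0rz.
Qed.

Lemma base_sign : cm_base M1 *m sg = cm_base M1.
Proof.
apply/rowP => j; rewrite mul_sign_mxE.
have [->|i0] := eqVneq (deg1 j) 0%N; first by rewrite mulr1.
by rewrite cm_base_deg // mul0r.
Qed.

Lemma base_part_mul_sign u : base_part u *m sg = base_part u.
Proof.
rewrite /base_part (additive_mulz (f := mulmx^~ sg) (fun a b => mulmxBl a b sg)).
by rewrite base_sign.
Qed.

Lemma base_part_sign u : base_part (u *m sg) = base_part u.
Proof.
rewrite /base_part /augv; congr (_ *~ _); apply: eq_bigr => i _.
rewrite mul_sign_mxE; have [->|i0] := eqVneq (deg1 i) 0%N; first by rewrite mulr1.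
by rewrite cm_aug_deg // !scaler0.
Qed.

Lemma tcontr0_diff u v : tcontr0 u v *m D =
  (ext (cm_h u *m d1) (v *m e2) + ext (cm_h u *m sg) (v *m d2)) +
  ext (base_part u) (cm_h v *m d2).
Proof.
rewrite mulmxDl; congr (_ + _); apply: etrans (ext_diff _ _) _.
  by rewrite -mulmxA cm_ed.
by rewrite base_part_mul_diff base_part_mul_sign kron_row0l add0r.
Qed.

Lemma tcontr0_diff1 u v : tcontr0 (u *m d1) v = ext (cm_h (u *m d1)) (v *m e2).
Proof. by rewrite /tcontr0 base_part_diff kron_row0l addr0. Qed.

Lemma tcontr0_diff2 u v : tcontr0 (u *m sg) (v *m d2) =
  - ext (cm_h u *m sg) (v *m d2) + ext (base_part u) (cm_h (v *m d2)).
Proof.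
rewrite /tcontr0 base_part_sign -mulmxA cm_de cm_h_sign; congr (_ + _).
by rewrite -[- (_ *m _)]sub0r (kron_rowBl l r _ 0) kron_row0l sub0r.
Qed.

Lemma add_cancel4 (V : zmodType) (a b c a' c' : V) :
  (a + b + c) + (a' + (- b + c')) = (a + a') + (c + c').
Proof.
by rewrite [a + b + c]addrAC [a' + _]addrCA [LHS]addrA addrK addrACA.
Qed.

(** The mixed terms cancel because cm_h anticommutes with the sign. The rest
    is (h1 d1 + d1 h1) (x) e2 + p1 (x) (h2 d2 + d2 h2), that is (e1 - p1) (x)
    e2 + p1 (x) (e2 - p2). *)
Lemma tcontr0P (u : 'rV[Z1]_p1) (v : 'rV[Z2]_p2) : (forall i, (n < deg1 i)%N -> u 0 i = 0) ->
  (forall j, (n < deg2 j)%N -> v 0 j = 0) ->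
  tcontr0 u v *m D + (tcontr0 (u *m d1) v + tcontr0 (u *m sg) (v *m d2)) =
  ext u v *m E - base *~ (augv (@cm_aug _ _ M1) u * augv (@cm_aug _ _ M2) v).
Proof.
move=> un vn; rewrite tcontr0_diff tcontr0_diff1 tcontr0_diff2 add_cancel4.
apply: etrans (kron_row_collect l r (cm_contr un) (cm_contr vn)) _.
congr (_ - _); first exact/esym/ext_idem.
exact: (kron_rowZ l r).
Qed.

Lemma augvD (G : groupType) (B : comNzRingType) p (w : 'I_p -> trivial_mod G B) :
  {morph augv w : u v / u + v}.
Proof.
move=> u v; rewrite /augv -big_split; apply: eq_bigr => i _.
by rewrite !mxE scalerDl.
Qed.

Lemma augvZ (G : groupType) (B : comNzRingType) p (w : 'I_p -> trivial_mod G B) c u :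
  augv w (c *: u) = c *: (augv w u : trivial_mod G B).
Proof.
rewrite /augv scaler_sumr; apply: eq_bigr => i _.
by rewrite mxE scalerA.
Qed.

Lemma basis_row_out (G : groupType) p (deg' : 'I_p -> nat) i (g : G) :
  (deg' i <= n)%N -> forall j, (n < deg' j)%N -> basis_row i g 0 j = 0.
Proof.
move=> i_n j j_n; rewrite !mxE eqxx /=; case: eqP => [ij|_]; last by rewrite mulr0.
by move: j_n; rewrite ij ltnNge i_n.
Qed.

Lemma scal_mulz (a : A) (m : int) (w : 'rV[AG]_I) :
  (scal (a * m%:~R) : AG) *: w = (scal a : AG) *: (w *~ m).
Proof.
rewrite -scalM -scalerA; congr (_ *: _); rewrite scal_int.
by rewrite -scalerMzl scale1r.
Qed.

Lemma tcontrP_mon (a : A) (u : 'rV[Z1]_p1) (v : 'rV[Z2]_p2) : (forall i, (n < deg1 i)%N -> u 0 i = 0) ->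
  (forall j, (n < deg2 j)%N -> v 0 j = 0) ->
  let x := (scal a : AG) *: ext u v in
  tcontr x *m D + tcontr (x *m D) = x *m E - (scal (augv taug x) : AG) *: base.
Proof.
move=> un vn x.
have e1 : tcontr x *m D = (scal a : AG) *: (tcontr0 u v *m D).
  by rewrite /x tcontr_ext; exact/esym/scalemxAl.
have e2 : x *m D = (scal a : AG) *: ext (u *m d1) v + (scal a : AG) *: ext (u *m sg) (v *m d2).
  apply: etrans (esym (scalemxAl _ _ _)) _.
  by apply: etrans (congr1 _ (ext_diff u v)) _; exact: scalerDr.
have e3 : tcontr (x *m D) = (scal a : AG) *:
    (tcontr0 (u *m d1) v + tcontr0 (u *m sg) (v *m d2)).
  rewrite e2; apply: etrans (tcontrD _ _) _.
  apply: etrans (congr2 _ (tcontr_ext _ _ _) (tcontr_ext _ _ _)) _.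
  exact/esym/scalerDr.
have e4 : x *m E = (scal a : AG) *: (ext u v *m E) by exact/esym/scalemxAl.
have e5 : (scal (augv taug x) : AG) *: base = (scal a : AG) *:
    (base *~ (augv (@cm_aug _ _ M1) u * augv (@cm_aug _ _ M2) v)).
  apply: etrans (congr1 (fun c => scal c *: base) (augvZ _ _ _)) _.
  rewrite gr_scaleU; apply: etrans (scal_mulz _ _ _).
  by congr (scal (_ * _) *: _); exact: augv_ext.
rewrite e1 e3 e4 e5; apply: etrans (esym (scalerDr _ _ _)) _.
by apply: etrans (congr1 _ (tcontr0P un vn)) _; exact: scalerBr.
Qed.

(** By additivity it is enough to treat monomials, which are multiples of pure
    tensors. *)
Lemma tcontrP x : (forall k, (n < deg k)%N -> x 0 k = 0) ->
  tcontr x *m D + tcontr (x *m D) = x *m E - (scal (augv taug x) : AG) *: base.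
Proof.
move=> xn; rewrite [x]row_sum_delta.
pose f y := tcontr y *m D + tcontr (y *m D).
pose h y := y *m E - (scal (augv taug y) : AG) *: base.
have fD y z : f (y + z) = f y + f z.
  by rewrite /f mulmxDl !tcontrD mulmxDl addrACA.
have hD y z : h (y + z) = h y + h z.
  by rewrite /h mulmxDl augvD scalD scalerDl opprD addrACA.
have f0 : f 0 = 0 by exact: additive0.
have h0 : h 0 = 0 by exact: additive0.
suff : f (\sum_k x 0 k *: delta_mx 0 k) = h (\sum_k x 0 k *: delta_mx 0 k) by [].
elim/big_ind : _ => [||k _]; first by rewrite f0 h0.
  by move=> y z fy fz; rewrite fD hD fy fz.
have [kn|/xn->] := leqP (deg k) n; last by rewrite scale0r f0 h0.
move: (x 0 k); apply: malg_ind => [|y z fy fz|a [g1 g2]].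
- by rewrite scale0r f0 h0.
- by rewrite scalerDl fD hD fy fz.
rewrite mon_ext; apply: tcontrP_mon; apply: basis_row_out.
  by apply: leq_trans kn; exact: leq_addr.
by apply: leq_trans kn; exact: leq_addl.
Qed.

End ProductContraction.

(** * The comparison map of a free resolution *)

Section FreeExtension.
Context {S : nzRingType} {M N : lmodType S} (B : set M) (u : M -> N).
Context (basisB : is_basis B).

(** The graph of the linear extension of u. Linear independence of B makes it
    the graph of a function (expansion_unique). *)
Definition expansion (v : M) (w : N) := exists (s : seq M) (c : M -> S),
  [/\ uniq s, [set` s] `<=` B, v = \sum_(b <- s) c b *: b & w = \sum_(b <- s) c b *: u b].

Lemma sum_undup (V : lmodType S) (s : seq M) (c : M -> S) (f : M -> V) :
  \sum_(b <- s) c b *: f b = \sum_(b <- undup s) (c b *+ count_mem b s) *: f b.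
Proof.
rewrite -big_undup_iterop_count; apply: eq_bigr => b _.
by rewrite -scalerMnl.
Qed.

Lemma expansion_exists v : exists w, expansion v w.
Proof.
have [s [c [sB ->]]] := basisB.1 v.
exists (\sum_(b <- undup s) (c b *+ count_mem b s) *: u b), (undup s).
exists (fun b => c b *+ count_mem b s); split=> //; first exact: undup_uniq.
- by move=> b /=; rewrite mem_undup; exact: sB.
exact: (sum_undup s c id).
Qed.

Lemma big_seq_widen (V : lmodType S) (s t : seq M) (c : M -> S) (f : M -> V) :
  uniq s -> uniq t -> {subset s <= t} ->
  \sum_(b <- s) c b *: f b = \sum_(b <- t) (if b \in s then c b else 0) *: f b.
Proof.
move=> us ut st.
rewrite [RHS](bigID (mem s)) /= [X in _ + X]big1 ?addr0 => [|b /negbTE->]; last first.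
  by rewrite scale0r.
rewrite -[RHS]big_filter [RHS](perm_big s) /=; last first.
  apply: uniq_perm => //; first exact: filter_uniq.
  by move=> b; rewrite mem_filter; case: (boolP (b \in s)) => // /st ->.
by rewrite big_seq [RHS]big_seq; apply: eq_bigr => b ->.
Qed.

Lemma expansion_linear x v w v' w' :
  expansion v w -> expansion v' w' -> expansion (x *: v + v') (x *: w + w').
Proof.
move=> [s [c [us sB -> ->]]] [s' [c' [us' sB' -> ->]]].
pose t := undup (s ++ s').
have ut : uniq t by exact: undup_uniq.
have st : {subset s <= t} by move=> b bs; rewrite mem_undup mem_cat bs.
have st' : {subset s' <= t} by move=> b bs; rewrite mem_undup mem_cat bs orbT.
exists t, (fun b => x * (if b \in s then c b else 0) + (if b \in s' then c' b else 0)).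
have e (V : lmodType S) (f : M -> V) :
    x *: (\sum_(b <- s) c b *: f b) + \sum_(b <- s') c' b *: f b =
    \sum_(b <- t) (x * (if b \in s then c b else 0) + (if b \in s' then c' b else 0)) *: f b.
  rewrite (big_seq_widen _ _ us ut st) (big_seq_widen _ _ us' ut st').
  rewrite scaler_sumr -big_split; apply: eq_bigr => b _ /=.
  by rewrite scalerDl scalerA.
split=> //; try exact: e.
by move=> b /=; rewrite mem_undup mem_cat => /orP[/sB|/sB'].
Qed.

Lemma expansion0 w : expansion 0 w -> w = 0.
Proof.
move=> [s [c [us sB /esym s0 ->]]]; rewrite big_seq big1 // => b bs.
by rewrite (basisB.2 s c us sB s0 b bs) scale0r.
Qed.

Lemma expansion_unique v w w' : expansion v w -> expansion v w' -> w = w'.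
Proof.
move=> vw vw'; apply/eqP; rewrite -subr_eq0; apply/eqP/expansion0.
have := expansion_linear (-1) vw' vw.
by rewrite !scaleN1r addNr addrC.
Qed.

Definition free_extend_fun v : N := projT1 (cid (expansion_exists v)).

Lemma free_extend_funP v : expansion v (free_extend_fun v).
Proof. exact: projT2 (cid (expansion_exists v)). Qed.

Lemma free_extend_linear : linear free_extend_fun.
Proof.
move=> x v v'; apply: (expansion_unique (free_extend_funP _)).
exact: expansion_linear (free_extend_funP _) (free_extend_funP _).
Qed.

HB.instance Definition _ := GRing.isLinear.Build _ _ _ _ free_extend_fun free_extend_linear.

Definition free_extend : {linear M -> N} := free_extend_fun.

Lemma free_extendE b : B b -> free_extend b = u b.
Proof.
move=> Bb; apply: (expansion_unique (free_extend_funP _)).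
exists [:: b], (fun=> 1); rewrite !big_seq1 !scale1r; split=> //.
by move=> b' /=; rewrite inE => /eqP ->.
Qed.

End FreeExtension.

Lemma basis_ext (S : nzRingType) (M N : lmodType S) (B : set M) (f g : {linear M -> N}) :
  is_basis B -> (forall b, B b -> f b = g b) -> forall v, f v = g v.
Proof.
move=> basisB fg v; have [s [c [sB ->]]] := basisB.1 v.
rewrite !linear_sum big_seq [RHS]big_seq; apply: eq_bigr => b bs.
by rewrite !linearZ /= fg //; exact: sB.
Qed.

Section ComparisonMap.
Context {G1 G2 : groupType} (A : comNzRingType) {n : nat}.
Context (M1 : contracted_model G1 n) (M2 : contracted_model G2 n).
Local Notation Z1 := (group_ring G1 int).
Local Notation Z2 := (group_ring G2 int).
Local Notation AG := (group_ring (G1 * G2)%type A).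
Local Notation l := (ginl : {rmorphism Z1 -> AG}).
Local Notation r := (ginr : {rmorphism Z2 -> AG}).
Local Notation p1 := (cm_p M1).
Local Notation p2 := (cm_p M2).
Local Notation I := #|{: 'I_p1 * 'I_p2}|.
Local Notation deg1 := (@cm_deg _ _ M1).
Local Notation deg2 := (@cm_deg _ _ M2).
Local Notation ext := (kron_row l r).
Local Notation d1 := (cm_d M1).
Local Notation d2 := (cm_d M2).
Local Notation e1 := (cm_e M1).
Local Notation e2 := (cm_e M2).
Local Notation D := (tdiff l r deg1 d1 d2).
Local Notation E := (kron l r e1 e2).
Local Notation deg := (tdeg deg1 deg2).
Local Notation base := (ext (cm_base M1) (cm_base M2)).

Local Notation taug := (@taug _ _ A _ M1 M2).
Context (C : resolution (trivial_mod (G1 * G2)%type A)) (B : forall k, set (C k)).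
Context (basisB : forall k, is_basis (@B k)).
Local Notation bd k := (res_diff C k).
Local Notation W := 'rV[AG]_I.

(** The comparison map of homological algebra, by recursion on the degree: on
    a basis vector c a preimage of the cycle comparison k (bd c) is given by
    the contraction. The idempotent and the projection to degree k + 1 do not
    change its boundary, and keep its values in the model. *)
Fixpoint comparison (k : nat) : {linear C k -> W} :=
  match k return {linear C k -> W} with
  | 0%N => free_extend (fun c => (scal (res_aug C c : A) : AG) *: base) (@basisB 0)
  | k.+1 => free_extend (fun c =>
      proj_deg deg k.+1 (tcontr (comparison k (bd k c)) *m E)) (@basisB k.+1)
  end.

Definition concentrated (k : nat) (x : W) := forall i, deg i != k -> x 0 i = 0.

Lemma concentrated_basis k (f : {linear C k -> W}) :
  (forall c, @B k c -> concentrated k (f c)) -> forall c, concentrated k (f c).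
Proof.
move=> fB c i ik; have [s [a [sB ->]]] := (@basisB k).1 c.
rewrite linear_sum summxE big_seq big1 // => b bs.
by rewrite linearZ mxE fB ?mulr0 //; exact: sB.
Qed.

Lemma comparison_deg k c : concentrated k (comparison k c).
Proof.
case: k c => [|k]; apply: concentrated_basis => c Bc i ik; rewrite /= free_extendE //.
  by rewrite mxE base_deg // mulr0.
exact: proj_deg_out.
Qed.

Lemma comparison0 c : @B 0 c -> comparison 0 c = (scal (res_aug C c : A) : AG) *: base.
Proof. exact: free_extendE. Qed.

Lemma comparisonS k c : @B k.+1 c -> comparison k.+1 c =
  proj_deg deg k.+1 (tcontr (comparison k (bd k c)) *m E).
Proof. exact: free_extendE. Qed.

Lemma proj_deg_idem k x : proj_deg deg k x *m E = proj_deg deg k (x *m E).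
Proof. by have := proj_deg_mul k x (@tensor_idem_graded _ _ A _ M1 M2); rewrite addn0. Qed.

Lemma proj_deg_diff k x : proj_deg deg k.+1 x *m D = proj_deg deg k (x *m D).
Proof. by have := proj_deg_mul k x (@tensor_diff_graded _ _ A _ M1 M2); rewrite addn1. Qed.

Lemma comparison_idem k c : comparison k c *m E = comparison k c.
Proof.
pose f : {linear C k -> W} := mulmxr E \o comparison k.
suff : f c = comparison k c by [].
apply: (basis_ext (@basisB k)) => {}c; case: k @f c => [|k] f c Bc; rewrite /f /=.
  rewrite comparison0 //; apply: etrans (esym (scalemxAl _ _ _)) _.
  by congr (_ *: _); exact: base_idem.
rewrite comparisonS //; apply: etrans (proj_deg_idem _ _) _; congr proj_deg.
by rewrite -mulmxA; congr (_ *m _); exact: tensor_idem_idem.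
Qed.

Lemma concentrated0_diff x : concentrated 0 x -> x *m D = 0.
Proof.
move=> x0; apply/rowP => j; rewrite !mxE; apply: big1 => i _.
have [e|/x0->] := eqVneq (deg i) 0%N; last by rewrite mul0r.
by rewrite (@tensor_diff_graded _ _ A _ M1 M2) ?mulr0 // e addn1.
Qed.

Lemma comparison_aug c : augv taug (comparison 0 c) = res_aug C c.
Proof.
have augL : linear (augv taug : W -> trivial_mod (G1 * G2)%type A).
  by move=> x u v; rewrite augvD augvZ.
pose F := GRing.isLinear.Build _ _ _ _ (augv taug : W -> trivial_mod (G1 * G2)%type A) augL.
pose L : {linear W -> trivial_mod (G1 * G2)%type A} :=
  HB.pack (augv taug : W -> trivial_mod (G1 * G2)%type A) F.
suff : (L \o comparison 0) c = res_aug C c by [].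
apply: (basis_ext (@basisB 0)) => {}c Bc.
rewrite /= comparison0 //; apply: etrans (augvZ _ _ _) _.
by rewrite gr_scaleU augv_base mulr1.
Qed.

Lemma concentrated_aug k x : concentrated k.+1 x -> augv taug x = 0.
Proof.
move=> xk; apply: big1 => i _.
have [e|/xk->] := eqVneq (deg i) k.+1; last by rewrite scale0r.
by rewrite taug_deg ?scaler0 // e.
Qed.

(** On a cycle of zero augmentation that the idempotent fixes, the contraction
    identity reads tcontr y D = y. *)
Lemma comparison_step k c : (k <= n)%N ->
  comparison k (bd k c) *m D = 0 -> augv taug (comparison k (bd k c)) = 0 ->
  tcontr (comparison k (bd k c)) *m D = comparison k (bd k c).
Proof.
move=> kn yD ya; set y := comparison k (bd k c) in yD ya *.
have yn i : (n < deg i)%N -> y 0 i = 0.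
  by move=> ni; rewrite comparison_deg //; apply: contraTneq ni => ->; rewrite -leqNgt.
have h1 : tcontr (y *m D) = 0.
  by rewrite yD; apply: additive0; exact: tcontrD.
have h2 : (scal (augv taug y) : AG) *: base = 0.
  by rewrite ya scal0; exact: scale0r.
apply: etrans (esym (etrans (congr1 _ h1) (addr0 _))) _.
apply: etrans (tcontrP yn) _.
apply: etrans (congr1 _ (congr1 _ h2)) _.
by apply: etrans (subr0 _) _; exact: comparison_idem.
Qed.

Lemma comparison_diff_step k : (k <= n)%N ->
  (forall c, comparison k (bd k c) *m D = 0) ->
  (forall c, augv taug (comparison k (bd k c)) = 0) ->
  forall c, comparison k (bd k c) = comparison k.+1 c *m D.
Proof.
move=> kn yD ya c.
pose f : {linear C k.+1 -> W} := comparison k \o bd k.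
pose g : {linear C k.+1 -> W} := mulmxr D \o comparison k.+1.
suff : f c = g c by [].
apply: (basis_ext (@basisB k.+1)) => {}c Bc; rewrite /f /g /= comparisonS //.
apply/esym; apply: etrans (proj_deg_diff _ _) _.
rewrite -mulmxA -(tensor_diff_idem A M1 M2) mulmxA (comparison_step kn (yD c) (ya c)) comparison_idem.
exact/proj_deg_id/comparison_deg.
Qed.

Lemma comparison_diff k : (k <= n)%N ->
  forall c, comparison k (bd k c) = comparison k.+1 c *m D.
Proof.
elim: k => [|k IH] kn; apply: comparison_diff_step => // c.
- exact/concentrated0_diff/comparison_deg.
- have e : res_aug C (bd 0 c) = 0 by apply/res_exact0; exists c.
  exact: etrans (comparison_aug _) e.
- rewrite -IH; last exact: ltnW.
  have -> : bd k (bd k.+1 c) = 0 by apply/res_exact; exists c.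
  exact: linear0.
exact/concentrated_aug/comparison_deg.
Qed.

End ComparisonMap.

(** * Collapsing the first factor *)

Lemma scale_trivial (G : groupType) (x : group_ring G int) (z : trivial_mod G int) :
  (x *: (1 : trivial_mod G int) : int) * z = x *: z.
Proof.
apply: (malg_additive_ext
  (f := fun x : group_ring G int => (x *: (1 : trivial_mod G int) : int) * z)
  (h := fun x : group_ring G int => (x *: z : int))).
- by move=> x1 x2; rewrite scalerDl; exact: mulrDl.
- by move=> x1 x2; rewrite scalerDl.
by move=> a g; rewrite !gr_scaleU mulr1.
Qed.

Section SplitModelOfProduct.
Context {G1 G2 : groupType} (A : comNzRingType) {n : nat}.
Context (M1 : contracted_model G1 n) (M2 : contracted_model G2 n).
Local Notation Z1 := (group_ring G1 int).
Local Notation Z2 := (group_ring G2 int).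
Local Notation AG := (group_ring (G1 * G2)%type A).
Local Notation l := (ginl : {rmorphism Z1 -> AG}).
Local Notation r := (ginr : {rmorphism Z2 -> AG}).
Local Notation p1 := (cm_p M1).
Local Notation p2 := (cm_p M2).
Local Notation I := #|{: 'I_p1 * 'I_p2}|.
Local Notation deg1 := (@cm_deg _ _ M1).
Local Notation deg2 := (@cm_deg _ _ M2).
Local Notation sg := (sign_mx Z1 deg1).
Local Notation d1 := (cm_d M1).
Local Notation d2 := (cm_d M2).
Local Notation D := (tdiff l r deg1 d1 d2).
Local Notation deg := (tdeg deg1 deg2).

Local Notation taug := (@taug _ _ A _ M1 M2).

Lemma scalC (a : A) (x : AG) : (scal a : AG) * x = x * scal a.
Proof.
apply: (malg_additive_ext (f := fun x : AG => (scal a : AG) * x) (h := fun x : AG => x * scal a)).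
- by move=> x1 x2; exact: mulrDr.
- by move=> x1 x2; exact: mulrDl.
by move=> b g; rewrite scalMU /scal skewUU mulg1 mulrC.
Qed.

Lemma vert_ginr y : vert (ginr y : AG) = ginr y.
Proof.
have := vert_ginl_ginr (A := A) (1 : Z1) y.
rewrite (rmorph1 l) mul1r scale1r => ->; exact: mul1r.
Qed.

Lemma vert_scal (a : A) : vert (scal a : AG) = scal a.
Proof. exact: vertU. Qed.

Lemma ginr_scale y (t : trivial_mod G2 int) :
  (ginr y : AG) *: ((t : int)%:~R : trivial_mod (G1 * G2)%type A) = (y *: t : int)%:~R.
Proof.
have := ginl_ginr_scale (A := A) (1 : Z1) y (1 : trivial_mod G1 int) t.
by rewrite (rmorph1 l) mul1r scale1r !mul1r.
Qed.

(** The augmentation of the first factor tensored with the identity of the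
    second. *)
Definition collapse : 'M[AG]_(I, p2) := \matrix_(k, j)
  if (enum_val k).2 == j then scal (cm_aug (enum_val k).1 : int)%:~R else 0.

Lemma mul_if0 (S : pzRingType) (x y : S) (b : bool) :
  x * (if b then y else 0) = if b then x * y else 0.
Proof. by case: b; rewrite ?mulr0. Qed.

Lemma vert_collapse (x : 'I_p1 -> Z1) (y : 'I_p2 -> Z2) j :
  \sum_(k < I) vert (ginl (x (enum_val k).1) * ginr (y (enum_val k).2) : AG) * collapse k j =
  scal (\sum_i x i *: cm_aug i : int)%:~R * ginr (y j).
Proof.
transitivity (\sum_(k < I) if (enum_val k).2 == j then
    (scal (x (enum_val k).1 *: cm_aug (enum_val k).1 : int)%:~R : AG) *
      ginr (y (enum_val k).2) else 0).
  apply: eq_bigr => k _; rewrite mxE vert_ginl_ginr; apply: etrans (mul_if0 _ _ _) _.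
  case: ifP => // _; apply: etrans (esym (mulrA _ _ _)) _.
  apply: etrans (congr1 _ (esym (scalC _ _))) _; apply: etrans (mulrA _ _ _) _.
  by rewrite scalM -rmorphM /= scale_trivial.
rewrite (sum_enum_pair (fun i j' => if j' == j then
  (scal (x i *: cm_aug i : int)%:~R : AG) * ginr (y j') else 0)).
transitivity (\sum_i (scal (x i *: cm_aug i : int)%:~R : AG) * ginr (y j)).
  apply: eq_bigr => i _; rewrite (bigD1 j) //= eqxx big1 ?addr0 // => j' /negbTE -> //.
rewrite -mulr_suml; congr (_ * _); rewrite rmorph_sum.
by elim/big_rec2: _ => [|i a b _ ->]; [rewrite scal0|rewrite scalD].
Qed.

Lemma sign_aug i : \sum_j sg i j *: cm_aug j = cm_aug i :> int.
Proof.
rewrite (bigD1 i) //= big1 ?addr0 => [|j ji].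
  rewrite !mxE eqxx mulr1n; have [->|i0] := eqVneq (deg1 i) 0%N.
    by rewrite expr0 scale1r.
  by rewrite cm_aug_deg // scaler0.
by rewrite !mxE eq_sym (negbTE ji) mulr0n scale0r.
Qed.

(** The augmentation vanishes on the image of d1, and the Koszul sign is 1 in
    degree 0, where the augmentation lives. *)
Lemma collapse_diff : map_mx vert D *m collapse = collapse *m map_mx ginr d2.
Proof.
apply/matrixP => k j; rewrite mxE [RHS]mxE.
have split_D k' : map_mx vert D k k' * collapse k' j =
    vert (ginl (d1 (enum_val k).1 (enum_val k').1) *
          ginr ((1%:M : 'M[Z2]_p2) (enum_val k).2 (enum_val k').2) : AG) * collapse k' j +
    vert (ginl (sg (enum_val k).1 (enum_val k').1) *
          ginr (d2 (enum_val k).2 (enum_val k').2) : AG) * collapse k' j.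
  by rewrite [map_mx _ _ _ _]mxE tdiffE vertD; exact: mulrDl.
apply: etrans (eq_bigr _ (fun k' _ => split_D k')) _.
apply: etrans (big_split _ _ _ _ _) _.
apply: etrans (congr2 +%R
  (vert_collapse (d1 (enum_val k).1) ((1%:M : 'M[Z2]_p2) (enum_val k).2) j)
  (vert_collapse (sg (enum_val k).1) (d2 (enum_val k).2) j)) _.
rewrite cm_aug_d sign_aug.
rewrite scal0 mul0r add0r (bigD1 (enum_val k).2) //= big1 ?addr0 => [|j' jk].
  by rewrite !mxE eqxx.
by rewrite [collapse _ _]mxE eq_sym (negbTE jk) mul0r.
Qed.

Lemma collapse_deg k j : deg k != deg2 j -> collapse k j = 0.
Proof.
move=> kj; rewrite mxE; case: eqP => // e; rewrite cm_aug_deg ?scal0 //.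
by apply: contra kj => /eqP k0; rewrite /tdeg k0 add0n e.
Qed.

Lemma collapse_aug k :
  \sum_j collapse k j *: ((cm_aug j : int)%:~R : trivial_mod (G1 * G2)%type A) = taug k.
Proof.
rewrite (bigD1 (enum_val k).2) //= big1 ?addr0 => [|j jk].
  by rewrite mxE eqxx gr_scaleU -rmorphM.
by rewrite mxE eq_sym (negbTE jk) scale0r.
Qed.

Definition product_model : split_model G1 G2 A.
Proof.
apply: (@SplitModel _ _ _ _ _ deg deg2 D (map_mx ginr d2) collapse
  (fun j => (cm_aug j : int)%:~R) (map_mx ginr (cm_base M2))).
- exact: tensor_diff_diff.
- by rewrite -map_mxM cm_dd map_mx0.
- exact: collapse_diff.
- by move=> i j; rewrite -addn1; exact: tensor_diff_graded.
- by move=> i j ij; rewrite mxE cm_d_deg // raddf0.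
- exact: collapse_deg.
- by move=> j j0; rewrite mxE cm_base_deg // raddf0.
- by move=> i j; rewrite mxE; exact: vert_ginr.
- by move=> i j; rewrite mxE; case: ifP => _; [exact: vert_scal|exact: vert0].
- by move=> j; rewrite mxE; exact: vert_ginr.
- move=> j; under eq_bigr do rewrite mxE ginr_scale.
  by rewrite -rmorph_sum cm_aug_d.
- under eq_bigr do rewrite mxE ginr_scale.
  by rewrite -rmorph_sum cm_aug_base.
Defined.

End SplitModelOfProduct.

(** * Vanishing for product actions *)

Section SmallTargets.
Context {R : realType} (n : nat) (Z : coef) {G1 G2 : groupType} {d1 d2 : measure_display}.
Context {X1 : measurableType d1} {X2 : measurableType d2}.
Context {mu1 : probability X1 R} {mu2 : probability X2 R}.
Context (alpha1 : pmp_action mu1 G1) (alpha2 : pmp_action mu2 G2).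
Context (infG : infinite_set [set: G1]) (amenG : amenable R G1).
Context (FP1 : type_FP n.+1 G1) (FP2 : type_FP n.+1 G2).
Context (std1 : standard_action alpha1).
Context (C : resolution (trivial_mod (G1 * G2)%type (coef_ring Z))).
Context (freeC : forall k, is_free (C k)).
Local Notation alpha := (prod_action alpha1 alpha2).

Lemma small_targets (eps : R) : 0 < eps -> exists D : marked_complex alpha Z,
  [/\ forall r, (r <= n)%N -> embedding_target C r D,
      forall k, marked_dim (mu1 \x mu2)%E (D k) <= eps &
      forall k, lognorm (mc_diff D k) <= eps].
Proof.
have [M1] := contracted_model_exists FP1; have [M2] := contracted_model_exists FP2.
pose B k := projT1 (cid (freeC k)).
have basisB k : is_basis (B k) by exact: (projT2 (cid (freeC k))).
pose f := comparison M1 M2 basisB.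
apply: (@small_embedding _ _ _ _ _ _ _ _ _ alpha1 alpha2 Z infG amenG std1
  (product_model (coef_ring Z) M1 M2) C n f).
- move=> k c i; exact: comparison_deg.
- move=> k c kn; exact: comparison_diff.
- move=> c; rewrite -(comparison_aug M1 M2 basisB); apply: eq_bigr => i _.
  by congr (_ *: _); exact: collapse_aug.
Qed.

Lemma ereal_inf_small (S : set (\bar R)) :
  (forall x, S x -> (0 <= x)%E) -> (forall eps : R, 0 < eps -> exists2 x, S x & (x <= eps%:E)%E) ->
  ereal_inf S = 0%E.
Proof.
move=> S0 Seps; apply/eqP; rewrite eq_le; apply/andP; split; last exact/ereal_infP.
apply/lee_addgt0Pr => e e0; have [x Sx xe] := Seps e e0.
by rewrite add0e; apply: le_trans xe; exact: ereal_inf_lbound.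
Qed.

Lemma medim_product_eq0 r : medim alpha C n r = 0%E.
Proof.
apply: ereal_inf_small => [_ [D _ <-]|eps e0]; first by rewrite lee_fin marked_dim_ge0.
have [D [Dr Dd _]] := small_targets e0.
exists (marked_dim (mu1 \x mu2)%E (D r))%:E; last by rewrite lee_fin.
by exists D => //; apply: Dr; exact: geq_minr.
Qed.

End SmallTargets.

Theorem proposition13p1 (R : realType) (n : nat) (Z : coef)
  (G1 G2 : groupType) (d1 d2 : measure_display)
  (X1 : measurableType d1) (X2 : measurableType d2)
  (mu1 : probability X1 R) (mu2 : probability X2 R)
  (alpha1 : pmp_action mu1 G1) (alpha2 : pmp_action mu2 G2) :
  infinite_set [set: G1] -> amenable R G1 -> type_FP n.+1 G1 ->
  type_FP n.+1 G2 ->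
  standard_action alpha1 -> standard_action alpha2 ->
  (forall C : resolution (trivial_mod (G1 * G2)%type (coef_ring Z)),
     (forall k : nat, is_free (C k)) ->
     forall r : nat, (r <= n.+1)%N ->
       medim (prod_action alpha1 alpha2) C n r = 0%E) /\
  (forall C : resolution (trivial_mod (G1 * G2)%type int),
     (forall k : nat, is_free (C k)) ->
     forall r : nat, (r <= n)%N ->
       mevol (prod_action alpha1 alpha2) C r = 0%E).
Proof.
move=> infG amenG FP1 FP2 std1 std2; split=> C freeC r rn.
  exact: (medim_product_eq0 alpha2 infG amenG FP1 FP2 std1 freeC).
apply: ereal_inf_small => [_ [D _ <-]|eps e0]; first by rewrite lee_fin lognorm_ge0.
have [D [Dr _ Dl]] := small_targets (Z := CoefInt) alpha2 infG amenG FP1 FP2 std1 freeC e0.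
exists (lognorm (mc_diff D r))%:E; last by rewrite lee_fin.
by exists D => //; exact: Dr.
Qed.
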